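(* Let $n\ge2$, $\boldsymbol{\gamma}\in\mathbb{C}^n$ with $\Re(\gamma_j)>0$ for all $j$, and $\mathbf b\in\mathbb C^n$ with $\Re(b_j)>-\Re(\gamma_1)$ for all $j$, $b_n-b_{n-1}\notin(-\infty,0]$, $(b_n-b_{n-1})/\gamma_n\notin(-\infty,0]$. Let $\boldsymbol{\mu}_{n-2}\in(\mathbb{T}\setminus\{1\})^{n-2}$. Then $\zeta_{n,n-2}(\mathbf{s},\boldsymbol{\gamma},\mathbf{b},\boldsymbol{\mu}_{n-2})$ has a meromorphic continuation to $\mathbb{C}^n$ whose possible singularities lie only on the hyperplanes $s_n=1$ and $s_{n-1}+s_n=k$ ($k\in\mathbb{Z}$, $k\le2$). Furthermore, for every $\mathbf N\in\mathbb N_0^n$, as $\boldsymbol\delta=(\delta_1,\dots,\delta_n)\to(0,\dots,0)$ with $\delta_{n-1}+\delta_n\neq0$, $$\zeta_{n,n-2}(-\mathbf{N}+\boldsymbol{\delta},\boldsymbol{\gamma},\mathbf{b},\boldsymbol{\mu}_{n-2})=-\frac{1}{N_n+1}\zeta_{n-1,n-2}(-\mathbf{N}^*_{n-1}(1),\boldsymbol{\gamma}_{n-1},\mathbf{b}_{n-1},\boldsymbol{\mu}_{n-2})\gamma_n^{-1}$$ $$+\sum_{l=0}^{N_n}\binom{N_n}{l}\zeta_{n-1,n-2}(-\mathbf{N}^*_{n-1}(-l),\boldsymbol{\gamma}_{n-1},\mathbf{b}_{n-1},\boldsymbol{\mu}_{n-2})\,\zeta\!\left(-l,\frac{b_n-b_{n-1}}{\gamma_n}\right)\gamma_n^l$$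 $$+\frac{(-1)^{N_{n-1}+1}N_n!\,N_{n-1}!}{(N_{n-1}+N_n+1)!}\cdot\frac{\epsilon(\delta_n)}{\delta_{n-1}+\delta_n}\cdot\zeta_{n-2,n-2}(-\mathbf N_{n-2}+\boldsymbol\delta_{n-2},\boldsymbol{\gamma}_{n-2},\mathbf{b}_{n-2},\boldsymbol{\mu}_{n-2})$$ $$\times\zeta\!\left(-N_{n-1}-N_n-1,\frac{b_n-b_{n-1}}{\gamma_n}\right)\gamma_{n-1}^{-1}\gamma_n^{N_{n-1}+N_n+1}+O\Big(\max_{1\le j\le n}|\delta_j|\Big),$$ where $\epsilon(\delta_n)$ is a function of $\delta_n$ alone satisfying $\epsilon(\delta_n)=\delta_n+O(\delta_n^2)$, and for $n=2$ one sets $\zeta_{0,0}\equiv1$.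
   Context: $\mathbb{T}=\{z\in\mathbb{C}:|z|=1\}$; principal branches for all powers. For $0\le k\le n$ and $\boldsymbol\mu_k\in(\mathbb T\setminus\{1\})^k$, $\zeta_{n,k}(\mathbf{s},\boldsymbol{\gamma},\mathbf{b},\boldsymbol{\mu}_k)=\sum_{m_1\geq1,\ m_2,\dots,m_n\geq0}\prod_{j=1}^k\mu_j^{m_j}\big/\prod_{j=1}^n(\gamma_1m_1+\cdots+\gamma_jm_j+b_j)^{s_j}$ (numerator $1$ if $k=0$), absolutely convergent when $\Re(s_j+\cdots+s_n)>n+1-j$ for all $j$ and meromorphically continued otherwise. For a vector $\mathbf v$, $\mathbf v_k$ denotes its first $k$ coordinates. $\mathbf N^*_{n-1}(l)=(N_1,\dots,N_{n-2},N_{n-1}+N_n+l)$ for $l\in\mathbb Z$. $\zeta(s,a)=\sum_{m\ge0}(m+a)^{-s}$ is the Hurwitz zeta-function (complex $a\notin(-\infty,0]$, continued meromorphically in $s$). *)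

(* Defs.v *)
From HB Require Import structures.
From mathcomp Require Import all_boot all_order all_algebra.
From mathcomp Require Import all_classical all_reals all_analysis.
From mathcomp Require Import complex.
Export Order.TTheory GRing.Theory Num.Theory.
Export numFieldNormedType.Exports.

Set Implicit Arguments.
Unset Strict Implicit.
Unset Printing Implicit Defensive.

Local Open Scope ring_scope.
Local Open Scope complex_scope.
Local Open Scope classical_set_scope.

(** The complex numbers over a real field R, with their canonical structure of
    a normed (topological) vector space over themselves (the "regular" copy).
    Complex differentiability ([differentiable] over [C R]) is holomorphy. *)
Definition C (R : realType) := (R[i])^o.

Section Defs.
Variable R : realType.
Local Notation C := (C R).

Definition cmod (z : C) : R := Num.sqrt (complex.Re z ^+ 2 + complex.Im z ^+ 2).

Definition nonpos_real (z : C) : Prop := complex.Im z = 0 /\ complex.Re z <= 0.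

Definition cexp (z : C) : C :=
  (expR (complex.Re z) * cos (complex.Im z)) +i* (expR (complex.Re z) * sin (complex.Im z)).

(** principal argument, in (-pi, pi] (0 at z = 0) *)
Definition Arg (z : C) : R :=
  if 0 < complex.Re z then atan (complex.Im z / complex.Re z)
  else if complex.Re z < 0 then
    (if 0 <= complex.Im z then atan (complex.Im z / complex.Re z) + pi else atan (complex.Im z / complex.Re z) - pi)
  else if 0 < complex.Im z then pi / 2
  else if complex.Im z < 0 then - (pi / 2) else 0.

Definition Log (z : C) : C := (ln (cmod z)) +i* (Arg z).

Definition cpow (z w : C) : C := if z == 0 then 0 else cexp (w * Log z).

Definition sv n (s : 'rV[C]_n) (j : nat) : C :=
  if (insub j : option 'I_n) is Some i then s ord0 i else 0.

(** general term of zeta_{n,k}(s, gamma, b, mu) at the multi-index m (0-based: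
    gamma_1 = gamma 0, ..., m_1 = m 0, ...):
    prod_{j<k} mu_j^{m_j} / prod_{j<n} (gamma_1 m_1 + ... + gamma_j m_j + b_j)^{s_j} *)
Definition zterm n k (s : 'rV[C]_n) (gam b mu : nat -> C) (m : 'I_n -> nat) : C :=
  (\prod_(j < n | (j < k)%N) mu j ^+ m j) /
  \prod_(j < n) cpow (\sum_(i < n | (i <= j)%N) gam i * (m i)%:R + b j) (s ord0 j).

Definition zpart n k (s : 'rV[C]_n) (gam b mu : nat -> C) (M : nat) : C :=
  \sum_(m : {ffun 'I_n -> 'I_M.+1} |
          [forall i : 'I_n, (nat_of_ord i == 0%N) ==> (0 < m i)%N])
    zterm k s gam b mu (fun i => nat_of_ord (m i)).

(** region of absolute convergence: Re(s_j + ... + s_n) > n + 1 - j (1-based) *)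
Definition absconv n (s : 'rV[C]_n) : Prop :=
  forall j : 'I_n, (n - j)%:R < complex.Re (\sum_(i < n | (j <= i)%N) s ord0 i).

(** Z is an analytic continuation of zeta_{n,k}(., gam, b, mu) to the open
    connected set D containing the region of absolute convergence: Z is
    holomorphic on D and equals the (absolutely convergent) multiple series
    on that region. (By the identity theorem Z is unique on D.) *)
Definition zeta_cont n k (gam b mu : nat -> C) (D : set 'rV[C]_n)
    (Z : 'rV[C]_n -> C) : Prop :=
  [/\ open D, connected D, (forall s, absconv s -> D s),
      (forall s, D s -> differentiable Z s) &
      (forall s, absconv s -> zpart k s gam b mu M @[M --> \oo] --> Z s)].

Definition hurwitz_cont (a : C) (Z : C -> C) : Prop :=
  (forall s : C, s != 1 -> differentiable Z s) /\
  (forall s : C, 1 < complex.Re s ->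
     (\sum_(m < M) 1 / cpow (m%:R + a) s) @[M --> \oo] --> Z s).

Definition meromorphic_off n (F : 'rV[C]_n -> C) (H : set 'rV[C]_n) : Prop :=
  forall p : 'rV[C]_n, exists g h : 'rV[C]_n -> C,
    (\forall s \near p,
       [/\ differentiable g s, differentiable h s & (~ H s -> F s * h s = g s)])
    /\ ~ (\forall s \near p, h s = 0).

Definition sing_set n : set 'rV[C]_n :=
  [set s | sv s n.-1 = 1 \/
           exists k : int, k <= 2 /\ sv s n.-2 + sv s n.-1 = k%:~R].

Definition maxabs n (d : 'rV[C]_n) : R := \big[Num.max/0]_(j < n) cmod (d ord0 j).

Definition mNstar n (N : nat -> nat) (l : int) : 'rV[C]_(n.-1) :=
  \row_(j < n.-1)
    (if (j < n.-2)%N then - (N j)%:R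
     else - (((N n.-2 + N n.-1)%N)%:Z + l)%:~R).

End Defs.

Arguments sing_set {R} n.
Arguments mNstar {R} n N l.

(* Main.v *)
Require Import Defs.
From HB Require Import structures.
From mathcomp Require Import all_boot all_order all_algebra.
From mathcomp Require Import all_classical all_reals all_analysis.
From mathcomp Require Import complex ring lra.
Import Order.TTheory GRing.Theory Num.Theory.
Import numFieldNormedType.Exports.
Local Open Scope ring_scope.
Local Open Scope complex_scope.
Local Open Scope classical_set_scope.

(** Telescoping in the last summation variable continues the series. With
    a = (b_n - b_(n-1)) / gamma_n, the generating function of
    e^(a X) / (1 - t e^X) gives A(x) = q x^(1-s) + sum_(l < K) c_l(s) x^(-s-l)
    such that (x + b_n - b_(n-1))^(-s) - (A(x) - t A(x + gamma_n)) gains K powers of x. Summing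
    over m_n leaves finitely many (n-1)-fold series with last exponent
    s_(n-1) + s_n + l (l = -1, 0, 1, ...) and a remainder that converges on a
    half-space growing with K. The leading term q occurs only for t = 1, and so
    does the pole at s = 1; a twisted level (t <> 1) therefore preserves
    entireness, and the only poles come from the last two, untwisted levels.
    At s = -N + delta the remainder and all terms of index l > N_n vanish to
    first order, except that for l = N_(n-1) + N_n + 1 the zero
    epsilon(delta_n) of c_l meets the pole 1 / (delta_(n-1) + delta_n) of the
    (n-1)-fold function, whose residue is the (n-2)-fold one. The value of the
    Hurwitz zeta-function at -l is l! times the coefficient of X^l in
    e^(a X) / (1 - e^X), by the same telescoping in the one-variable case.

    Holomorphy is local uniform approximability by polynomials, converted to
    differentiability by Cauchy estimates obtained from averages over roots of
    unity. *)

(** The poles shape the proof. A division by 1 - s inside a level would destroy the entireness on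
    which the next level relies, so a level is continued as [rf] times the series and divided only
    afterwards. The first untwisted numerator [Ufun] is then entire, and on s_(n-1) = 1 it equals -1
    / gamma_(n-1) times the (n-2)-fold function. Near the singular point a Lipschitz bound for
    [Ufun] suffices: with eta = delta_(n-1) + delta_n, replacing its value at 1 + eta by that at 1
    costs O(eta), the quotient by eta stays bounded, and epsilon(delta_n) makes it small however
    fast eta tends to 0. Letting m_1 start at 0 replaces b_j by gamma_1 + b_j; the hypothesis on
    Re(b_j) then puts all linear forms into one sector, where they are comparable with 1 + m_1 + ...
    + m_j, and all estimates are uniform for s in bounded sets. The value obtained does not depend
    on the order K, because the telescoped series of index K converges wherever the remainder of
    order K does. *)

Section ComplexBasics.
Variable R : realType.
Local Notation C := (C R).
Local Notation Re := complex.Re.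
Local Notation Im := complex.Im.
Implicit Types (x y z w : C).

(** * The complex exponential, principal powers and their Taylor remainders *)

Lemma cmodE z : cmod z = Normc.normc z. Proof. by case: z. Qed.

Lemma normC_cmod z : `|z| = (cmod z)%:C. Proof. by rewrite normc_def. Qed.

Lemma cmod_ge0 z : 0 <= cmod z. Proof. exact: sqrtr_ge0. Qed.

Lemma cmod0 : cmod (0 : C) = 0.
Proof. by rewrite cmodE Normc.normc0. Qed.

Lemma cmod1 : cmod (1 : C) = 1.
Proof. by rewrite cmodE Normc.normc1. Qed.

Lemma cmodM x y : cmod (x * y) = cmod x * cmod y.
Proof. by rewrite !cmodE Normc.normcM. Qed.

Lemma cmodN x : cmod (- x) = cmod x.
Proof. by rewrite !cmodE normcN. Qed.

Lemma cmodD x y : cmod (x + y) <= cmod x + cmod y.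
Proof. by rewrite !cmodE le_normcD. Qed.

Lemma cmodB x y : cmod (x - y) <= cmod x + cmod y.
Proof. by rewrite -(cmodN y) cmodD. Qed.

Lemma cmodBC x y : cmod (x - y) = cmod (y - x).
Proof. by rewrite -cmodN opprB. Qed.

Lemma cmodV x : cmod x^-1 = (cmod x)^-1.
Proof. by rewrite !cmodE Normc.normcV. Qed.

Lemma cmod_eq0 x : (cmod x == 0) = (x == 0).
Proof.
apply/eqP/eqP => [|->]; last exact: cmod0.
by rewrite cmodE => /Normc.eq0_normc.
Qed.

Lemma cmod_gt0 x : (0 < cmod x) = (x != 0).
Proof. by rewrite lt_def cmod_ge0 andbT cmod_eq0. Qed.

Lemma cmodX x n : cmod (x ^+ n) = cmod x ^+ n.
Proof. by elim: n => [|n IH]; rewrite ?expr0 ?cmod1 // !exprS cmodM IH. Qed.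

Lemma cmod_sum (I : Type) (r : seq I) (P : pred I) (F : I -> C) :
  cmod (\sum_(i <- r | P i) F i) <= \sum_(i <- r | P i) cmod (F i).
Proof.
elim/big_ind2: _ => [|a b c d h1 h2|//]; first by rewrite cmod0.
by rewrite (le_trans (cmodD _ _)) // lerD.
Qed.

Lemma cmod_prod (I : Type) (r : seq I) (P : pred I) (F : I -> C) :
  cmod (\prod_(i <- r | P i) F i) = \prod_(i <- r | P i) cmod (F i).
Proof. by elim/big_rec2: _ => [|i a b _ <-]; rewrite ?cmod1 ?cmodM. Qed.

Lemma cmod_real (r : R) : cmod (r%:C : C) = `|r|.
Proof. by rewrite /cmod /= expr0n addr0 sqrtr_sqr. Qed.

Lemma natC n : (n%:R : C) = (n%:R : R)%:C.
Proof. by rewrite (rmorph_nat (real_complex R)). Qed.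

Lemma cmod_nat n : cmod (n%:R : C) = n%:R.
Proof. by rewrite natC cmod_real ger0_norm. Qed.

Lemma ReD x y : Re (x + y) = Re x + Re y. Proof. by case: x; case: y. Qed.
Lemma ImD x y : Im (x + y) = Im x + Im y. Proof. by case: x; case: y. Qed.
Lemma ReN x : Re (- x) = - Re x. Proof. by case: x. Qed.
Lemma ImN x : Im (- x) = - Im x. Proof. by case: x. Qed.
Lemma ReB x y : Re (x - y) = Re x - Re y. Proof. by rewrite ReD ReN. Qed.
Lemma ImB x y : Im (x - y) = Im x - Im y. Proof. by rewrite ImD ImN. Qed.
Lemma ReM x y : Re (x * y) = Re x * Re y - Im x * Im y.
Proof. by case: x; case: y. Qed.
Lemma ImM x y : Im (x * y) = Re x * Im y + Im x * Re y.
Proof. by case: x => a b; case: y => c d /=; rewrite addrC. Qed.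
Lemma Re_nat n : Re (n%:R : C) = n%:R. Proof. by rewrite natC. Qed.
Lemma Im_nat n : Im (n%:R : C) = 0. Proof. by rewrite natC. Qed.
Lemma ReMn x n : Re (x * n%:R) = Re x * n%:R.
Proof. by rewrite ReM Re_nat Im_nat mulr0 subr0. Qed.
Lemma Re_sum (I : Type) (r : seq I) (P : pred I) (F : I -> C) :
  Re (\sum_(i <- r | P i) F i) = \sum_(i <- r | P i) Re (F i).
Proof. by elim/big_rec2: _ => // i a b _ <-; rewrite ReD. Qed.

Lemma Re_cmod x : `|Re x| <= cmod x.
Proof. by rewrite -sqrtr_sqr ler_wsqrtr // lerDl sqr_ge0. Qed.
Lemma Im_cmod x : `|Im x| <= cmod x.
Proof. by rewrite -sqrtr_sqr ler_wsqrtr // lerDr sqr_ge0. Qed.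
Lemma cmod_ReIm x : cmod x <= `|Re x| + `|Im x|.
Proof.
have -> : x = (Re x)%:C + (0 +i* Im x) by case: x => a b; simpc.
rewrite (le_trans (cmodD _ _))// cmod_real ReD ImD /= !addr0 add0r lerD2l.
by rewrite /cmod /= expr0n add0r sqrtr_sqr.
Qed.

Lemma Re_gt0_neq0 x : 0 < Re x -> x != 0.
Proof. by apply: contraTneq => ->; rewrite ltxx. Qed.

Lemma C_eqP x y : Re x = Re y -> Im x = Im y -> x = y.
Proof. by case: x => a b; case: y => c d /= -> ->. Qed.

Lemma cexp0 : cexp (0 : C) = 1.
Proof. by rewrite /cexp /= expR0 cos0 sin0 mulr1 mulr0. Qed.

Lemma cexpD x y : cexp (x + y) = cexp x * cexp y.
Proof.
apply: C_eqP; rewrite ?ReM ?ImM /= ReD ImD expRD ?cosD ?sinD; ring.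
Qed.

Lemma cmod_cexp x : cmod (cexp x) = expR (Re x).
Proof.
rewrite /cmod /= !exprMn -mulrDr cos2Dsin2 mulr1 sqrtr_sqr ger0_norm //.
Qed.

Lemma cexp_neq0 x : cexp x != 0.
Proof. by rewrite -cmod_gt0 cmod_cexp expR_gt0. Qed.

Lemma cexpN x : cexp (- x) = (cexp x)^-1.
Proof.
apply: (mulfI (cexp_neq0 x)).
by rewrite -cexpD subrr cexp0 divff // cexp_neq0.
Qed.

Lemma cexp_nat n x : cexp (n%:R * x) = cexp x ^+ n.
Proof.
elim: n => [|n IH]; first by rewrite mul0r cexp0 expr0.
by rewrite exprS -IH -cexpD -natr1 mulrDl mul1r addrC.
Qed.

Lemma cmod_pos_Re z : 0 < Re z -> cmod z = Re z * Num.sqrt (1 + (Im z / Re z) ^+ 2).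
Proof.
move=> h; rewrite /cmod -{2}(ger0_norm (ltW h)) -sqrtr_sqr -sqrtrM ?sqr_ge0 //.
by congr Num.sqrt; field; rewrite gt_eqF.
Qed.

Lemma cos_sin_atan z : 0 < Re z ->
  cmod z * cos (atan (Im z / Re z)) = Re z /\ cmod z * sin (atan (Im z / Re z)) = Im z.
Proof.
move=> h; set t := Im z / Re z.
have s0 : Num.sqrt (1 + t ^+ 2) != 0.
  by rewrite gt_eqF // sqrtr_gt0 ltr_pwDl // sqr_ge0.
have c : cmod z * cos (atan t) = Re z.
  by rewrite cmod_pos_Re // -/t cos_atan mulfK.
split=> //; have : tan (atan t) = t by rewrite atanK.
rewrite /tan => e.
have c0 : cos (atan t) != 0 by rewrite cos_atan invr_neq0.
have -> : sin (atan t) = t * cos (atan t) by rewrite -{2}e mulfVK.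
by rewrite mulrCA c /t mulfVK // gt_eqF.
Qed.

Lemma cos_sin_Arg z : z != 0 -> cmod z * cos (Arg z) = Re z /\ cmod z * sin (Arg z) = Im z.
Proof.
move=> z0; rewrite /Arg; case: ltrP => h1; first exact: cos_sin_atan.
have [h2|h2] := ltrP (Re z) 0.
  have h3 : 0 < Re (- z) by rewrite ReN oppr_gt0.
  have := cos_sin_atan _ h3; rewrite cmodN ReN ImN invrN mulrNN => -[c s].
  have ecs : cmod z * cos (atan (Im z / Re z) + pi) = Re z /\
             cmod z * sin (atan (Im z / Re z) + pi) = Im z.
    rewrite cosD sinD cospi sinpi !mulr0 subr0 addr0 !mulrN1 !mulrN c s.
    by rewrite !opprK.
  case: ifP => // _.
  by rewrite cosB sinB cospi sinpi !mulr0 subr0 addr0 !mulrN1 !mulrN c s !opprK.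
have r0 : Re z = 0 by apply/eqP; rewrite eq_le h1 h2.
have cm : cmod z = `|Im z| by rewrite /cmod r0 expr0n add0r sqrtr_sqr.
have [h3|h3] := ltrP 0 (Im z).
  by rewrite cos_pihalf sin_pihalf mulr0 mulr1 cm gtr0_norm.
have [h4|h4] := ltrP (Im z) 0.
  by rewrite cosN sinN cos_pihalf sin_pihalf mulr0 mulrN1 cm ltr0_norm ?opprK.
have i0 : Im z = 0 by apply/eqP; rewrite eq_le h3 h4.
by move: z0; rewrite -cmod_eq0 cm i0 normr0 eqxx.
Qed.

Lemma cexp_Log z : z != 0 -> cexp (Log z) = z.
Proof.
move=> z0; have [c s] := cos_sin_Arg z z0.
have cp : cmod z \in Num.pos by rewrite posrE cmod_gt0.
by apply: C_eqP; rewrite /= lnK.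
Qed.

Lemma Arg_Re_pos z : 0 < Re z -> `|Arg z| <= pi.
Proof.
move=> h; rewrite /Arg h ler_norml.
have := atan_gtNpi2 (Im z / Re z); have := atan_ltpi2 (Im z / Re z).
have := pi_gt0 R; lra.
Qed.

(** A version of [Log] that is differentiable along lines in Re z > 0
    without having to localise. *)
Definition lg z : C := (ln (Re z ^+ 2 + Im z ^+ 2) / 2) +i* atan (Im z / Re z).

Lemma lgE z : 0 < Re z -> Log z = lg z.
Proof.
move=> h; rewrite /Log /lg /Arg h; congr (_ +i* _).
have c0 : 0 < cmod z by rewrite cmod_gt0 Re_gt0_neq0.
have -> : Re z ^+ 2 + Im z ^+ 2 = cmod z ^+ 2.
  by rewrite /cmod sqr_sqrtr // addr_ge0 ?sqr_ge0.
by rewrite lnXn // mulr2n; field.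
Qed.

Lemma cexp_lg z : 0 < Re z -> cexp (lg z) = z.
Proof. by move=> h; rewrite -lgE // cexp_Log // Re_gt0_neq0. Qed.

(** [pw x w] is the principal value of x^(-w) when Re x > 0. *)
Definition pw x w : C := cexp (- w * lg x).

Lemma cpowV x w : 0 < Re x -> (cpow x w)^-1 = pw x w.
Proof.
move=> h; have x0 := Re_gt0_neq0 x h.
by rewrite /cpow (negbTE x0) /pw mulNr cexpN lgE.
Qed.

Lemma pw0 x : pw x 0 = 1. Proof. by rewrite /pw oppr0 mul0r cexp0. Qed.

Lemma pwD x w w' : pw x (w + w') = pw x w * pw x w'.
Proof. by rewrite /pw opprD mulrDl cexpD. Qed.

Lemma pwN_nat x n : 0 < Re x -> pw x (- n%:R) = x ^+ n.
Proof. by move=> h; rewrite /pw opprK cexp_nat cexp_lg. Qed.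

Lemma pwN1 x : 0 < Re x -> pw x (- 1) = x.
Proof. by move=> h; rewrite (pwN_nat x 1). Qed.

Lemma cmod_pw x w : 0 < Re x ->
  cmod (pw x w) = expR (- Re w * ln (cmod x) + Im w * Arg x).
Proof. by move=> h; rewrite /pw -lgE // cmod_cexp ReM ReN ImN /= !mulNr opprK. Qed.

(** Differentiability in a real variable, component by component: only mean values along segments
    are taken, and for these the real theory suffices. *)
Definition cder (g : R -> C) (t : R) (d : C) : Prop :=
  is_derive t 1 (fun u => Re (g u)) (Re d) /\ is_derive t 1 (fun u => Im (g u)) (Im d).

Lemma is_deriveE (f : R -> R) (t a b : R) : is_derive t 1 f a -> a = b -> is_derive t 1 f b.
Proof. by move=> h <-. Qed.

Lemma cderE g t d d' : cder g t d -> d = d' -> cder g t d'.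
Proof. by move=> h <-. Qed.

Lemma cder_ext f g t d : (forall u, f u = g u) -> cder f t d -> cder g t d.
Proof. by move=> /funext ->. Qed.

Lemma cder_cst c t : cder (fun=> c) t 0.
Proof. by split; apply: is_derive_cst. Qed.

Lemma cderD f g t d e : cder f t d -> cder g t e -> cder (fun u => f u + g u) t (d + e).
Proof.
move=> [f1 f2] [g1 g2]; split.
  under eq_fun do rewrite ReD.
  by rewrite ReD; apply: is_deriveD.
under eq_fun do rewrite ImD.
by rewrite ImD; apply: is_deriveD.
Qed.

Lemma cderM f g t d e : cder f t d -> cder g t e ->
  cder (fun u => f u * g u) t (d * g t + f t * e).
Proof.
move=> [f1 f2] [g1 g2]; split.
  under eq_fun do rewrite ReM.
  apply: is_deriveE (is_deriveB (is_deriveM f1 g1) (is_deriveM f2 g2)) _.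
  by rewrite ReD !ReM /GRing.scale /=; ring.
under eq_fun do rewrite ImM.
apply: is_deriveE (is_deriveD (is_deriveM f1 g2) (is_deriveM f2 g1)) _.
by rewrite ImD !ImM /GRing.scale /=; ring.
Qed.

Lemma cderZ c f t d : cder f t d -> cder (fun u => c * f u) t (c * d).
Proof. by move=> h; apply: cderE (cderM _ _ _ _ _ (cder_cst c t) h) _; rewrite mul0r add0r. Qed.

Lemma cder_sum n (f : 'I_n -> R -> C) t (d : 'I_n -> C) :
  (forall i, cder (f i) t (d i)) -> cder (fun u => \sum_(i < n) f i u) t (\sum_(i < n) d i).
Proof.
elim: n f d => [|n IH] f d h.
  rewrite big_ord0; apply: cder_ext (cder_cst 0 t) => u; by rewrite big_ord0.
rewrite big_ord_recr /=.
apply: cder_ext (cderD _ _ _ _ _ (IH _ _ (fun i => h (widen_ord (leqnSn n) i))) (h ord_max)) => u.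
by rewrite big_ord_recr.
Qed.

Lemma cder_cexp f t d : cder f t d -> cder (fun u => cexp (f u)) t (d * cexp (f t)).
Proof.
move=> [f1 f2].
have e : is_derive t 1 (fun u => expR (Re (f u))) (Re d * expR (Re (f t))).
  by have := @is_derive1_comp R expR _ t _ _ (is_derive_expR _) f1; rewrite mulrC.
have s : is_derive t 1 (fun u => sin (Im (f u))) (Im d * cos (Im (f t))).
  by have := @is_derive1_comp R sin _ t _ _ (is_derive_sin _) f2; rewrite mulrC.
have c : is_derive t 1 (fun u => cos (Im (f u))) (- (Im d * sin (Im (f t)))).
  by have := @is_derive1_comp R cos _ t _ _ (is_derive_cos _) f2; rewrite mulNr mulrC.
split.
  apply: is_deriveE (is_deriveM e c) _.
  by rewrite ReM /= /GRing.scale /=; ring.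
apply: is_deriveE (is_deriveM e s) _.
by rewrite ImM /= /GRing.scale /=; ring.
Qed.

Lemma cder_line x h t : cder (fun u : R => x + (u%:C : C) * h) t h.
Proof.
split.
  under eq_fun do rewrite ReD ReM /= mul0r subr0.
  apply: is_deriveE (is_deriveD (is_derive_cst (Re x) t 1)
    (is_deriveM (is_derive_id t 1) (is_derive_cst (Re h) t 1))) _.
  by rewrite /GRing.scale /=; ring.
under eq_fun do rewrite ImD ImM /= mul0r addr0.
apply: is_deriveE (is_deriveD (is_derive_cst (Im x) t 1)
  (is_deriveM (is_derive_id t 1) (is_derive_cst (Im h) t 1))) _.
by rewrite /GRing.scale /=; ring.
Qed.

Lemma cder_lg f t d : 0 < Re (f t) -> cder f t d -> cder (fun u => lg (f u)) t (d / f t).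
Proof.
move=> h [f1 f2].
have n0 : 0 < Re (f t) ^+ 2 + Im (f t) ^+ 2 by rewrite ltr_pwDl ?exprn_gt0 ?sqr_ge0.
have f0 : Re (f t) != 0 by rewrite gt_eqF.
have s1 : is_derive t 1 (fun u => Re (f u) ^+ 2 + Im (f u) ^+ 2)
    (2 * (Re (f t) * Re d + Im (f t) * Im d)).
  apply: is_deriveE (is_deriveD (is_deriveX 2 f1) (is_deriveX 2 f2)) _.
  by rewrite /GRing.scale /= !expr1 mulr2n; ring.
have s2 := @is_derive1_comp R (@ln R) _ t _ _ (is_derive1_ln n0) s1.
have s3 : is_derive t 1 (fun u => (Re (f u))^-1) (- (Re (f t) ^- 2) * Re d).
  by have := is_deriveV f0 f1.
have s4 := @is_derive1_comp R atan _ t _ _ (is_derive1_atan _) (is_deriveM f2 s3).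
have ed : d / f t = ((Re (f t) * Re d + Im (f t) * Im d) / (Re (f t) ^+ 2 + Im (f t) ^+ 2))
   +i* ((Re (f t) * Im d - Im (f t) * Re d) / (Re (f t) ^+ 2 + Im (f t) ^+ 2)).
  have z0 := Re_gt0_neq0 _ h; apply: (mulIf z0); rewrite mulfVK //.
  have := n0; move/lt0r_neq0.
  by case: (f t) => a b; case: d {f1 f2 s1 s2 s3 s4} => x y /= nz; apply: C_eqP => /=; field.
rewrite ed; split => /=.
  apply: is_deriveE (is_deriveM s2 (is_derive_cst (2^-1 : R) t 1)) _.
  by rewrite /GRing.scale /=; field; rewrite gt_eqF.
apply: is_deriveE s4 _.
by rewrite /GRing.scale /= mulrfctE; field; rewrite f0 gt_eqF.
Qed.

Lemma cder_pw x h w t : 0 < Re (x + (t%:C : C) * h) ->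
  cder (fun u : R => pw (x + (u%:C : C) * h) w) t (- w * h * pw (x + (t%:C : C) * h) (w + 1)).
Proof.
move=> p; have l := cder_lg _ _ _ p (cder_line x h t).
apply: cderE (cder_cexp _ _ _ (cderZ (- w) _ _ _ l)) _.
rewrite -/(pw _ w) pwD.
have -> : pw (x + (t%:C : C) * h) 1 = (x + (t%:C : C) * h)^-1.
  apply: (mulfI (Re_gt0_neq0 _ p)); rewrite divff ?Re_gt0_neq0 //.
  by rewrite -{1}(pwN1 _ p) -pwD addNr pw0.
ring.
Qed.

(** The mean value inequality, obtained from the real mean value theorem for
    the component of [g] in the direction of [g 1 - g 0]. *)
Lemma cmvt (g g' : R -> C) (M : R) :
  (forall t, 0 <= t <= 1 -> cder g t (g' t)) -> (forall t, 0 <= t <= 1 -> cmod (g' t) <= M) ->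
  cmod (g 1 - g 0) <= M.
Proof.
move=> dg bg; set D := g 1 - g 0.
pose phi (t : R) := Re D * Re (g t) + Im D * Im (g t).
pose psi (t : R) := Re D * Re (g' t) + Im D * Im (g' t).
have dphi (t : R) : 0 <= t <= 1 -> is_derive t 1 phi (psi t).
  move=> /dg [g1 g2].
  have h1 := is_deriveM (is_derive_cst (Re D) t 1) g1.
  have h2 := is_deriveM (is_derive_cst (Im D) t 1) g2.
  apply: is_deriveE (is_deriveD h1 h2) _.
  by rewrite /GRing.scale /= !mulr0 !addr0.
have [c cin e] : exists2 c : R, c \in `[0, 1]%R & phi 1 - phi 0 = psi c * (1 - 0).
  apply: MVT_segment => // [x|].
    by rewrite in_itv /= => /andP[a b]; apply: dphi; rewrite !ltW.
  apply: derivable_within_continuous => x; rewrite in_itv /= => /dphi h.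
  by case: h.
have e2 : cmod D ^+ 2 = psi c.
  rewrite subr0 mulr1 in e; rewrite -e /cmod sqr_sqrtr ?addr_ge0 ?sqr_ge0 //.
  by rewrite /phi {2 4}/D ReB ImB; ring.
have cs : psi c <= cmod D * cmod (g' c).
  have -> : psi c = Re ((Re D -i* Im D : C) * g' c) by rewrite ReM /=; rewrite /psi mulNr opprK.
  apply: le_trans (ler_norm _) _; apply: le_trans (Re_cmod _) _.
  by rewrite cmodM /cmod /= sqrrN.
have := cmod_ge0 D; rewrite le_eqVlt => /predU1P[<-|D0].
  by apply: le_trans (bg 0 _); rewrite ?cmod_ge0 ?lexx ?ler01.
rewrite -(ler_pM2l D0) -expr2 e2 (le_trans cs) // ler_pM2l // bg //.
Qed.

(** [ff w l] is the l-th derivative of x^(-w) at 1. *)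
Definition ff w l : C := \prod_(i < l) (- w - i%:R).

(** The remainder of order L in the Taylor expansion of x ^ (- w) for the increment h. *)
Definition Tay (L : nat) w x h : C :=
  pw (x + h) w - \sum_(l < L) ff w l / (l`!)%:R * h ^+ l * pw x (w + l%:R).

Lemma ff0 w : ff w 0 = 1. Proof. by rewrite /ff big_ord0. Qed.
Lemma ffS w l : ff w l.+1 = - w * ff (w + 1) l.
Proof.
rewrite /ff big_ord_recl /= subr0; congr (_ * _); apply: eq_bigr => i _.
by rewrite /= /bump /= add1n -natr1; ring.
Qed.
Lemma ffSr w l : ff w l.+1 = ff w l * (- w - l%:R).
Proof. by rewrite /ff big_ord_recr. Qed.
Lemma ff_add w i j : ff w i * ff (w + i%:R) j = ff w (i + j).
Proof.
elim: j => [|j IH]; first by rewrite ff0 mulr1 addn0.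
by rewrite addnS !ffSr mulrA IH natrD; ring.
Qed.

Lemma natC_neq0 n : (n.+1%:R : C) != 0.
Proof. by rewrite -cmod_gt0 cmod_nat. Qed.

Lemma fact_neq0 n : (n`!%:R : C) != 0.
Proof. by rewrite -(prednK (fact_gt0 n)) natC_neq0. Qed.

(** Differentiating in the increment turns the remainder of order L + 1 at w into the one of order L
    at w + 1; this drives the induction for [cmod_Tay]. *)
Lemma cder_Tay L w x h t : 0 < Re (x + (t%:C : C) * h) ->
  cder (fun u : R => Tay L.+1 w x ((u%:C : C) * h)) t
    (- w * h * Tay L (w + 1) x ((t%:C : C) * h)).
Proof.
move=> p; rewrite /Tay.
have hp (l : nat) : cder (fun u : R => ((u%:C : C) * h) ^+ l) t (l%:R * h * ((t%:C : C) * h) ^+ l.-1).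
  have lin : cder (fun u : R => (u%:C : C) * h) t h.
    by apply: cder_ext (cder_line 0 h t) => u; rewrite add0r.
  elim: l => [|l IH]; first by rewrite !mul0r; apply: cder_cst.
  apply: cder_ext (fun u => esym (exprS _ _)) _.
  apply: cderE (cderM _ _ _ _ _ lin IH) _.
  by case: l {IH} => [|l]; rewrite ?expr0 -?natr1 ?exprS /=; ring.
have hs : cder (fun u : R => - 1 * \sum_(l < L.+1) (ff w l / (l`!)%:R * pw x (w + l%:R)) * ((u%:C : C) * h) ^+ l) t
    (- 1 * \sum_(l < L.+1) (ff w l / (l`!)%:R * pw x (w + l%:R)) * (l%:R * h * ((t%:C : C) * h) ^+ l.-1)).
  by apply: cderZ; apply: cder_sum => i; apply: cderZ; apply: hp.
apply: cder_ext (cderE _ _ _ _ (cderD _ _ _ _ _ (cder_pw x h w t p) hs) _) => [u|].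
  rewrite mulN1r; congr (_ - _); apply: eq_bigr => i _; ring.
rewrite mulrBr mulN1r; congr (_ - _).
rewrite big_ord_recl /= !mul0r mulr0 add0r mulr_sumr; apply: eq_bigr => i _.
rewrite /= /bump /= add1n ffS factS natrM -natr1.
have -> : w + (i%:R + 1) = w + 1 + i%:R by ring.
have i0 : (i%:R + 1 : C) != 0 by rewrite natr1 natC_neq0.
by field; rewrite i0 fact_neq0.
Qed.

(** Induction on L by the mean value inequality, since the remainder vanishes at increment 0. A mean
    value in place of an integral yields no factor 1 / L!. *)
Lemma cmod_Tay L w x h (M : R) :
  (forall t, 0 <= t <= 1 -> 0 < Re (x + (t%:C : C) * h) /\
      cmod (pw (x + (t%:C : C) * h) (w + L%:R)) <= M) ->
  cmod (Tay L w x h) <= \prod_(i < L) (cmod w + i%:R) * cmod h ^+ L * M.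
Proof.
elim: L w h => [|L IH] w h H.
  rewrite big_ord0 expr0 !mul1r /Tay big_ord0 subr0.
  have [] := H 1; first by rewrite ler01 lexx.
  by rewrite addr0 mul1r.
have Tay0 : Tay L.+1 w x (((0:R)%:C : C) * h) = 0.
  rewrite mul0r /Tay addr0 big_ord_recl ff0 fact0 expr0 addr0 big1 ?addr0; last first.
    by move=> i _; rewrite expr0n /= mulr0 mul0r.
  by rewrite divr1 !mul1r subrr.
have -> : Tay L.+1 w x h = Tay L.+1 w x (((1:R)%:C : C) * h) - Tay L.+1 w x (((0:R)%:C : C) * h).
  by rewrite Tay0 subr0 mul1r.
apply: (cmvt (fun u : R => Tay L.+1 w x ((u%:C : C) * h))) => [t /H [p _]|t /andP[t0 t1]].
  exact: cder_Tay p.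
have M0 : 0 <= M.
  by have [|_] := H 0; [rewrite lexx ler01|apply: le_trans; apply: cmod_ge0].
have hb : cmod (Tay L (w + 1) x ((t%:C : C) * h)) <=
   \prod_(i < L) (cmod (w + 1) + i%:R) * cmod ((t%:C : C) * h) ^+ L * M.
  (* Points of the shorter segment lie on the original one, with parameter u * t. *)
  apply: IH => u /andP[u0 u1].
  have -> : (u%:C : C) * (t%:C * h) = ((u * t)%:C : C) * h by rewrite mulrA -rmorphM.
  have -> : w + 1 + L%:R = w + L.+1%:R by rewrite -natr1; ring.
  by apply: H; rewrite mulr_ge0 //= mulr_ile1.
rewrite !cmodM cmodN big_ord_recl /= addr0 exprS.
rewrite [leRHS](_ : _ = cmod w * cmod h * (\prod_(i < L) (cmod w + (bump 0 i)%:R) * cmod h ^+ L * M)); last by ring.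
apply: ler_wpM2l; first by rewrite mulr_ge0 ?cmod_ge0.
apply: le_trans hb _; apply: ler_wpM2r => //.
apply: ler_pM.
- by apply: prodr_ge0 => i _; rewrite addr_ge0 ?cmod_ge0.
- by rewrite exprn_ge0 ?cmod_ge0.
- apply: ler_prod => i _; rewrite addr_ge0 ?cmod_ge0 //=.
  have := cmodD w 1; rewrite cmod1 /bump /= add1n -natr1; lra.
- rewrite lerXn2r ?nnegrE ?cmod_ge0 // cmodM cmod_real ger0_norm //.
  by rewrite ler_piMl ?cmod_ge0.
Qed.

End ComplexBasics.

Arguments lg {R} z.
Arguments pw {R} x w.
Arguments cder {R} g t d.
Arguments ff {R} w l.
Arguments Tay {R} L w x h.

(** * Convergence of complex sequences *)

Section ComplexSequences.
Variable R : realType.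
Local Notation C := (C R).
Local Notation Re := complex.Re.
Local Notation Im := complex.Im.

(** Elementary convergence with weak inequalities, convenient for passing bounds to the limit;
    [ccvg_cvg] turns it into filter convergence. *)
Definition ccvg (u : nat -> C) (l : C) : Prop :=
  forall e : R, 0 < e -> exists N, forall n, (N <= n)%N -> cmod (u n - l) <= e.

Lemma ccvg_cst c : ccvg (fun=> c) c.
Proof. by move=> e e0; exists 0 => n _; rewrite subrr cmod0 ltW. Qed.

Lemma ccvg_eq u v l : (forall n, u n = v n) -> ccvg u l -> ccvg v l.
Proof. by move=> /funext ->. Qed.

Lemma ccvgD u v l m : ccvg u l -> ccvg v m -> ccvg (fun n => u n + v n) (l + m).
Proof.
move=> hu hv e e0; have e2 : 0 < e / 2 by rewrite divr_gt0.
have [N hN] := hu _ e2; have [M hM] := hv _ e2; exists (maxn N M) => n.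
rewrite geq_max => /andP[/hN a /hM b].
have -> : u n + v n - (l + m) = (u n - l) + (v n - m) by ring.
by rewrite (le_trans (cmodD _ _ _))// (splitr e) lerD.
Qed.

Lemma ccvgZ c u l : ccvg u l -> ccvg (fun n => c * u n) (c * l).
Proof.
move=> hu e e0; have c0 : 0 < cmod c + 1 by rewrite ltr_pwDr // cmod_ge0.
have [N hN] := hu _ (divr_gt0 e0 c0); exists N => n /hN h.
rewrite -mulrBr cmodM; apply: le_trans (_ : (cmod c + 1) * (e / (cmod c + 1)) <= _).
  by apply: ler_pM => //; rewrite ?cmod_ge0 // lerDl.
by rewrite mulrCA divff ?mulr1 // gt_eqF.
Qed.

Lemma ccvg_sum n (u : 'I_n -> nat -> C) (l : 'I_n -> C) :
  (forall i, ccvg (u i) (l i)) -> ccvg (fun k => \sum_(i < n) u i k) (\sum_(i < n) l i).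
Proof.
elim: n u l => [|n IH] u l h.
  rewrite big_ord0; apply: ccvg_eq (ccvg_cst 0) => k; by rewrite big_ord0.
rewrite big_ord_recr /=.
apply: ccvg_eq (ccvgD _ _ _ _ (IH _ _ (fun i => h (widen_ord (leqnSn n) i))) (h ord_max)) => k.
by rewrite big_ord_recr.
Qed.

Lemma ccvg_unique u l m : ccvg u l -> ccvg u m -> l = m.
Proof.
move=> hl hm; apply/eqP; rewrite -subr_eq0 -cmod_eq0 eq_le cmod_ge0 andbT.
apply/ler_addgt0Pr => e e0; rewrite add0r.
have e2 : 0 < e / 2 by rewrite divr_gt0.
have [N hN] := hl _ e2; have [M hM] := hm _ e2.
have -> : l - m = (u (maxn N M) - m) - (u (maxn N M) - l) by ring.
rewrite (le_trans (cmodB _ _ _)) // (splitr e) lerD // ?hN ?hM // ?leq_maxl ?leq_maxr //.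
Qed.

Lemma R_rate_cvg (u a : nat -> R) :
  (forall e : R, 0 < e -> exists N, forall n, (N <= n)%N -> a n <= e) ->
  (forall i k, (i <= k)%N -> `|u i - u k| <= a i) ->
  exists l, forall e : R, 0 < e -> exists N, forall n, (N <= n)%N -> `|u n - l| <= e.
Proof.
move=> ha hu.
have : cvg (u @ \oo).
  apply: R_complete; apply: cauchy_exP => e e0.
  have [N hN] := ha _ (divr_gt0 e0 (ltr0n R 2)); exists (u N).
  exists N => // k /= Nk; rewrite /ball /=.
  by rewrite (le_lt_trans (hu _ _ Nk)) // (le_lt_trans (hN _ (leqnn _))) // ltr_pdivrMr // mulr_natr mulr2n ltrDl.
move=> /cvg_ex [l hl]; exists l => e e0.
have /cvgrPdist_le /(_ _ e0) [N _ hN] := hl.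
by exists N => n /hN; rewrite distrC.
Qed.

(** The Cauchy rate [a] survives as a bound for the distance to the limit; with a rate free of
    parameters, convergence is uniform in them. *)
Lemma rate_cvg (u : nat -> C) (a : nat -> R) :
  (forall e : R, 0 < e -> exists N, forall n, (N <= n)%N -> a n <= e) ->
  (forall i k, (i <= k)%N -> cmod (u i - u k) <= a i) ->
  exists l, ccvg u l /\ forall i, cmod (u i - l) <= a i.
Proof.
move=> ha hu.
have [|r hr] := R_rate_cvg (fun n => Re (u n)) a ha.
  by move=> i k ik; rewrite -ReB (le_trans (Re_cmod _ _)) // hu.
have [|s hs] := R_rate_cvg (fun n => Im (u n)) a ha.
  by move=> i k ik; rewrite -ImB (le_trans (Im_cmod _ _)) // hu.
have cl : ccvg u (r +i* s).
  move=> e e0; have e2 : 0 < e / 2 by rewrite divr_gt0.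
  have [N hN] := hr _ e2; have [M hM] := hs _ e2; exists (maxn N M) => n.
  rewrite geq_max => /andP[/hN h1 /hM h2].
  by rewrite (le_trans (cmod_ReIm _ _)) // ReB ImB (splitr e) lerD.
exists (r +i* s); split=> // i; apply/ler_addgt0Pr => e e0.
have [N hN] := cl _ e0.
have -> : u i - (r +i* s) = (u i - u (maxn i N)) + (u (maxn i N) - (r +i* s)) by ring.
by rewrite (le_trans (cmodD _ _ _)) // lerD // ?hu ?hN // ?leq_maxl ?leq_maxr.
Qed.

(** A total limit operator, with value 0 when there is no limit. *)
Definition clim (u : nat -> C) : C :=
  if pselect (exists l, ccvg u l) is left h then projT1 (cid h) else 0.

Lemma climP u l : ccvg u l -> clim u = l.
Proof.
rewrite /clim => h; case: pselect => [h'|/(_ (ex_intro _ l h))//].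
by case: cid => m /= hm; apply: ccvg_unique hm h.
Qed.

Lemma half_pow (e : R) : 0 < e -> exists n, 2^-1 ^+ n <= e.
Proof.
move=> e0; have h : (fun n => 2^-1 ^+ n : R) @ \oo --> (0 : R).
  by apply: cvg_expr; rewrite ger0_norm ?invf_lt1 ?ltr1n.
have /cvgrPdist_le /(_ _ e0) [N _ hN] := h.
by exists N; have := hN N (leqnn N); rewrite sub0r normrN ger0_norm // exprn_ge0.
Qed.

Lemma inv_nat_small (e : R) : 0 < e -> exists N, forall n, (N <= n)%N -> n.+1%:R^-1 <= e.
Proof.
move=> e0; exists (Num.truncn e^-1) => n hn.
rewrite -[e]invrK lef_pV2 ?posrE ?invr_gt0 //.
apply: le_trans (ltW (truncnS_gt _)) _.
by rewrite ler_nat ltnS.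
Qed.

End ComplexSequences.

Arguments ccvg {R} u l.
Arguments clim {R} u.

(** * Cauchy estimates for polynomials *)

Section CauchyEstimate.
Variable R : realType.
Local Notation C := (C R).
Local Notation Re := complex.Re.
Local Notation Im := complex.Im.

Lemma root_of_unity N : (0 < N)%N -> exists w : C, [/\ w ^+ N = 1, cmod w = 1 &
  forall k, (0 < k < N)%N -> w ^+ k != 1].
Proof.
move=> N0; pose th : R := 2 * pi / N%:R.
have N0' : (0 : R) < N%:R by rewrite ltr0n.
exists (cexp (0 +i* th)); rewrite cmod_cexp expR0; split => //.
  rewrite -cexp_nat; have -> : N%:R * (0 +i* th) = 0 +i* (pi *+ 2) :> C.
    apply: C_eqP; rewrite ?ReM ?ImM Re_nat Im_nat /= ?mulr0 ?mul0r ?addr0 ?subr0 //.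
    by rewrite /th mulrC mulfVK ?gt_eqF // mulrC mulr_natr.
  by apply: C_eqP; rewrite /= expR0 mul1r ?cos2pi ?sin2pi.
move=> k /andP[k0 kN]; apply/negP => /eqP; rewrite -cexp_nat.
have -> : k%:R * (0 +i* th) = 0 +i* (k%:R * th) :> C.
  by apply: C_eqP; rewrite ?ReM ?ImM Re_nat Im_nat /= ?mulr0 ?mul0r ?addr0 ?subr0.
move=> /(congr1 (@complex.Re R)) /=; rewrite expR0 mul1r.
(* With x = pi k / N strictly between 0 and pi, cos (2 x) = 1 would force sin x = 0. *)
pose x : R := k%:R / N%:R * pi.
have -> : k%:R * th = x *+ 2 by rewrite /x /th -mulr_natr; field; rewrite gt_eqF.
rewrite cos_mulr2n => e.
have c2 : cos x ^+ 2 = 1 by move: e; rewrite mulr2n; lra.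
have : 0 < sin x.
  apply: sin_gt0_pi; rewrite /x pmulr_lgt0 ?pi_gt0 // divr_gt0 ?ltr0n //=.
  by rewrite gtr_pMl ?pi_gt0 // ltr_pdivrMr // mul1r ltr_nat.
by move=> s0; have := sin2cos2 x; rewrite c2 subrr => /eqP; rewrite expf_eq0 /= gt_eqF.
Qed.

(** Averaging over roots of unity isolates a coefficient. *)
Lemma cauchy_coef (q : {poly C}) (r M : R) k : 0 < r ->
  (forall z, cmod z <= r -> cmod q.[z] <= M) -> cmod q`_k * r ^+ k <= M.
Proof.
move=> r0 H.
have M0 : 0 <= M by apply: le_trans (H 0 _); rewrite ?cmod_ge0 // cmod0 ltW.
have [kq|kq] := leqP (size q) k; first by rewrite nth_default // cmod0 mul0r.
set N := size q in kq; have N0 : (0 < N)%N by apply: leq_ltn_trans kq.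
have [w [wN w1 wk]] := root_of_unity N N0.
(* The exponent N - k stands for - k modulo N, so that only i = k survives the averaging. *)
have wsum i : (i < N)%N -> \sum_(j < N) (w ^+ (i + (N - k))) ^+ j = if i == k then N%:R else 0.
  move=> iN; case: eqP => [->|/eqP ik].
    rewrite subnKC ?(ltnW kq) // wN (eq_bigr (fun=> 1)) => [|j _]; last by rewrite expr1n.
    by rewrite sumr_const card_ord.
  set z := w ^+ _; have z1 : z - 1 != 0.
    rewrite subr_eq0 /z; case: (ltngtP i k) ik => // h _.
      by apply: wk; rewrite addn_gt0 subn_gt0 kq orbT /= addnBA ?(ltnW kq) // ltn_subLR
         ?ltn_add2r // (leq_trans (ltnW kq)) // leq_addl.
    have -> : (i + (N - k) = (i - k) + N)%N by rewrite addnBA ?(ltnW kq) // addnBAC // ltnW.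
    rewrite exprD wN mulr1; apply: wk; rewrite subn_gt0 h /=.
    by apply: leq_ltn_trans (leq_subr _ _) iN.
  apply: (mulfI z1); rewrite -subrX1 mulr0 /z -exprM mulnC exprM wN expr1n subrr //.
have E : \sum_(j < N) q.[(r%:C : C) * w ^+ j] * w ^+ (j * (N - k)) = N%:R * (q`_k * (r%:C : C) ^+ k).
  under eq_bigr do rewrite horner_coef mulr_suml.
  rewrite exchange_big /= (bigD1 (Ordinal kq)) //= [X in _ + X]big1 ?addr0.
    rewrite -{1}[N]/N; transitivity (q`_k * (r%:C : C) ^+ k * \sum_(j < N) (w ^+ (k + (N - k))) ^+ j).
      rewrite mulr_sumr; apply: eq_bigr => j _.
      by rewrite exprMn -!exprM mulnDl exprD mulnC [in RHS](mulnC (N - k)%N); ring.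
    by rewrite wsum // eqxx mulrC.
  move=> i ik; transitivity (q`_i * (r%:C : C) ^+ i * \sum_(j < N) (w ^+ (i + (N - k))) ^+ j).
    rewrite mulr_sumr; apply: eq_bigr => j _.
    by rewrite exprMn -!exprM mulnDl exprD mulnC [in RHS](mulnC (N - k)%N); ring.
  by rewrite wsum // -(inj_eq val_inj) /= in ik *; rewrite (negbTE ik) mulr0.
have : cmod (N%:R * (q`_k * (r%:C : C) ^+ k)) <= N%:R * M.
  rewrite -E (le_trans (cmod_sum _ _ _ _ _)) //.
  have -> : N%:R * M = \sum_(j < N) M by rewrite sumr_const card_ord mulr_natl.
  apply: ler_sum => j _; rewrite cmodM !cmodX w1 expr1n mulr1; apply: H.
  by rewrite cmodM cmodX w1 expr1n mulr1 cmod_real gtr0_norm.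
by rewrite !cmodM cmod_nat cmodX cmod_real gtr0_norm // ler_pM2l ?ltr0n.
Qed.

Lemma geom_le2 (x : R) n : 0 <= x <= 2^-1 -> \sum_(i < n) x ^+ i <= 2.
Proof.
move=> /andP[x0 x1]; suff h : \sum_(i < n) x ^+ i <= 2 - 2 * 2^-1 ^+ n.
  by apply: le_trans h _; rewrite gerBl mulr_ge0 ?exprn_ge0.
elim: n => [|n IH]; first by rewrite big_ord0 expr0 mulr1 subrr.
rewrite big_ord_recr /=; have := lerXn2r n; move=> /(_ _ x 2^-1); rewrite !nnegrE x0 invr_ge0 ler0n.
move=> /(_ isT isT x1) h; rewrite exprS; lra.
Qed.

(** [cauchy_coef] bounds the tail by a geometric series of ratio cmod z / r <= 1 / 2, whence the
    factor 2. *)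
Lemma poly_rem1 (q : {poly C}) (r M : R) z : 0 < r -> 
  (forall z, cmod z <= r -> cmod q.[z] <= M) -> cmod z <= r / 2 ->
  cmod (q.[z] - q.[0]) <= 2 * M / r * cmod z.
Proof.
move=> r0 H hz; set n := size q.
have M0 : 0 <= M by apply: le_trans (H 0 _); rewrite ?cmod_ge0 // cmod0 ltW.
rewrite horner_coef0 (@horner_coef_wide _ n.+1) //.
rewrite big_ord_recl /= expr0 mulr1 addrC addKr.
set x := cmod z / r.
have hx : 0 <= x <= 2^-1 by rewrite divr_ge0 ?cmod_ge0 ?(ltW r0) //= /x ler_pdivrMr // mulrC.
apply: le_trans (cmod_sum _ _ _ _ _) _.
apply: le_trans (_ : \sum_(i < n) M * x * x ^+ i <= _).
  apply: ler_sum => i _; rewrite cmodM cmodX /bump /= add1n.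
  rewrite -mulrA -exprS.
  have -> : cmod z ^+ i.+1 = r ^+ i.+1 * x ^+ i.+1 by rewrite -exprMn /x mulrC mulfVK // gt_eqF.
  rewrite mulrA ler_wpM2r ?exprn_ge0 //; first by case/andP: hx.
  exact: cauchy_coef.
rewrite -mulr_sumr; have -> : 2 * M / r * cmod z = M * x * 2 by rewrite /x; ring.
by apply: ler_wpM2l (geom_le2 _ _ hx); rewrite mulr_ge0 //; case/andP: hx.
Qed.

Lemma poly_rem2 (q : {poly C}) (r M : R) z : 0 < r ->
  (forall z, cmod z <= r -> cmod q.[z] <= M) -> cmod z <= r / 2 ->
  cmod (q.[z] - q.[0] - q`_1 * z) <= 2 * M / r ^+ 2 * cmod z ^+ 2.
Proof.
move=> r0 H hz; set n := size q.
have M0 : 0 <= M by apply: le_trans (H 0 _); rewrite ?cmod_ge0 // cmod0 ltW.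
rewrite horner_coef0 (@horner_coef_wide _ n.+2 q z (leqW (leqnSn n))).
rewrite !big_ord_recl /= expr0 mulr1 expr1 addrAC addrC !addrA addNr add0r addrAC.
rewrite /bump /= add1n subrr add0r.
set x := cmod z / r.
have hx : 0 <= x <= 2^-1 by rewrite divr_ge0 ?cmod_ge0 ?(ltW r0) //= /x ler_pdivrMr // mulrC.
apply: le_trans (cmod_sum _ _ _ _ _) _.
apply: le_trans (_ : \sum_(i < n) M * x ^+ 2 * x ^+ i <= _).
  apply: ler_sum => i _; rewrite cmodM cmodX !add1n.
  rewrite -mulrA -exprD add2n.
  have -> : cmod z ^+ i.+2 = r ^+ i.+2 * x ^+ i.+2 by rewrite -exprMn /x mulrC mulfVK // gt_eqF.
  rewrite mulrA ler_wpM2r ?exprn_ge0 //; first by case/andP: hx.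
  exact: cauchy_coef.
rewrite -mulr_sumr; have -> : 2 * M / r ^+ 2 * cmod z ^+ 2 = M * x ^+ 2 * 2 by rewrite /x; field; rewrite gt_eqF.
by apply: ler_wpM2l (geom_le2 _ _ hx); rewrite mulr_ge0 // exprn_ge0 //; case/andP: hx.
Qed.

End CauchyEstimate.

(** Quadratic vanishing at p makes the zero map the differential. The field is general because over
    the complex numbers the norm takes complex values. *)
Lemma diff_quad_gen (K : numFieldType) (V W : normedModType K) (f : V -> W) (p : V) (r M : K) :
  0 < r -> 0 <= M -> (forall h, `|h| <= r -> `|f (h + p)| <= M * `|h| ^+ 2) ->
  differentiable f p.
Proof.
move=> r0 M0 H.
have f0 : f p = 0.
  have := H 0; rewrite normr0 add0r expr0n mulr0 => /(_ (ltW r0)) h.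
  by apply/eqP; rewrite -normr_eq0 eq_le h normr_ge0.
pose L : {linear V -> W} := \0.
have Lc : continuous L by change (continuous (fun _ : V => (0 : W))); apply: cst_continuous.
have E : f \o shift p = cst (f p) + L +o_ 0 id.
  apply/eqaddoP => e e0; near=> h.
  rewrite !fctE f0 add0r /L /= subr0.
  have M1 : 0 < M + 1 by rewrite ltr_wpDl.
  have hr : `|h| <= r by near: h; apply: nbhs0_le.
  have he : `|h| <= e / (M + 1) by near: h; apply: nbhs0_le; rewrite divr_gt0 // ltr_wpDl.
  apply: le_trans (H h hr) _; rewrite expr2 mulrA ler_wpM2r //.
  apply: le_trans (_ : (M + 1) * `|h| <= _); first by rewrite ler_wpM2r // lerDl.
  by rewrite mulrC -ler_pdivlMr.
by apply/diff_locallyP; rewrite (diff_unique Lc E); split.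
Unshelve. all: by end_near.
Qed.

(** * Holomorphy as local approximability by polynomials *)

Section Approximation.
Variable R : realType.
Local Notation C := (C R).
Local Notation Re := complex.Re.
Local Notation Im := complex.Im.
Variable n : nat.
Local Notation V := 'rV[C]_n.

(** Polynomial functions; [apx] is local uniform approximability by them, the
    form in which holomorphy is carried through the construction. *)
Inductive pf : (V -> C) -> Prop :=
| pf_cst c : pf (fun=> c)
| pf_coord j : pf (fun v => v ord0 j)
| pf_add f g : pf f -> pf g -> pf (fun v => f v + g v)
| pf_mul f g : pf f -> pf g -> pf (fun v => f v * g v).

Lemma pf_eq f g : (forall v, f v = g v) -> pf f -> pf g.
Proof. by move=> /funext ->. Qed.

Lemma pf_opp f : pf f -> pf (fun v => - f v).
Proof. by move=> h; apply: pf_eq (pf_mul _ _ (pf_cst (- 1)) h) => v; rewrite mulN1r. Qed.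

(** The gradient of a polynomial function is read off its restrictions to complex lines, as the
    coefficient of degree 1; one-variable Cauchy estimates then apply at once. *)
Definition isgrad (f : V -> C) (p : V) (g : 'I_n -> C) : Prop :=
  forall v, exists q : {poly C},
    (forall z, f (p + z *: v) = q.[z]) /\ q`_1 = \sum_j v ord0 j * g j.

Lemma pf_grad f p : pf f -> exists g, isgrad f p g.
Proof.
elim=> [c|j|f1 f2 _ [g1 h1] _ [g2 h2]|f1 f2 _ [g1 h1] _ [g2 h2]].
- exists (fun=> 0) => v; exists c%:P; split=> [z|]; first by rewrite hornerC.
  by rewrite coefC big1 // => i _; rewrite mulr0.
- exists (fun i => (i == j)%:R) => v; exists ((p ord0 j)%:P + (v ord0 j)%:P * 'X); split=> [z|].
    by rewrite !hornerE !mxE mulrC.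
  rewrite coefD coefC coefMX coefC /= add0r (bigD1 j) //= eqxx mulr1 big1 ?addr0 // => i /negbTE ->.
  by rewrite mulr0.
- exists (fun i => g1 i + g2 i) => v; have [q1 [a1 b1]] := h1 v; have [q2 [a2 b2]] := h2 v.
  exists (q1 + q2); split=> [z|]; first by rewrite hornerD a1 a2.
  by rewrite coefD b1 b2 -big_split; apply: eq_bigr => i _; rewrite mulrDr.
- exists (fun i => f1 p * g2 i + g1 i * f2 p) => v.
  have [q1 [a1 b1]] := h1 v; have [q2 [a2 b2]] := h2 v.
  exists (q1 * q2); split=> [z|]; first by rewrite hornerM a1 a2.
  have e1 : f1 p = q1`_0 by rewrite -horner_coef0 -a1 scale0r addr0.
  have e2 : f2 p = q2`_0 by rewrite -horner_coef0 -a2 scale0r addr0.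
  rewrite coefM !big_ord_recl big_ord0 /= addr0 /bump /= addn0 subn0 subnn b1 b2 e1 e2.
  rewrite mulr_sumr mulr_suml -big_split; apply: eq_bigr => i _ /=; ring.
Qed.

Lemma isgradB f1 f2 p g1 g2 : isgrad f1 p g1 -> isgrad f2 p g2 ->
  isgrad (fun v => f1 v - f2 v) p (fun i => g1 i - g2 i).
Proof.
move=> h1 h2 v; have [q1 [a1 b1]] := h1 v; have [q2 [a2 b2]] := h2 v.
exists (q1 - q2); split=> [z|]; first by rewrite hornerD hornerN a1 a2.
by rewrite coefB b1 b2 -sumrB; apply: eq_bigr => i _; rewrite mulrBr.
Qed.

Definition pdisc (p : V) (r : R) (v : V) : Prop := forall j, cmod (v ord0 j - p ord0 j) <= r.

Lemma pdisc_center p r : 0 <= r -> pdisc p r p.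
Proof. by move=> r0 j; rewrite subrr cmod0. Qed.

Lemma pdisc_trans p q v r s t : pdisc p r q -> pdisc q s v -> r + s <= t -> pdisc p t v.
Proof.
move=> h1 h2 le j; apply: le_trans le; rewrite [leRHS]addrC.
have -> : v ord0 j - p ord0 j = (v ord0 j - q ord0 j) + (q ord0 j - p ord0 j) by ring.
by rewrite (le_trans (cmodD _ _ _)) // lerD.
Qed.

Lemma pdisc_le p r s v : pdisc p r v -> r <= s -> pdisc p s v.
Proof. by move=> h rs j; apply: le_trans (h j) rs. Qed.

Lemma maxabs_ge0 (h : V) : 0 <= maxabs h.
Proof. by rewrite /maxabs; elim/big_rec: _ => // i x _; rewrite le_max => ->; rewrite orbT. Qed.

Lemma le_maxabs (h : V) j : cmod (h ord0 j) <= maxabs h.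
Proof. by rewrite /maxabs (bigD1 j) //= le_max lexx. Qed.

Lemma maxabs_le (h : V) r : 0 <= r -> (forall j, cmod (h ord0 j) <= r) -> maxabs h <= r.
Proof. by move=> r0 H; rewrite /maxabs; elim/big_rec: _ => // i x _ xr; rewrite ge_max H. Qed.

Lemma pdisc_maxabs p r v : pdisc p r v -> 0 <= r -> maxabs (v - p) <= r.
Proof. by move=> h r0; apply: maxabs_le => // j; rewrite !mxE; apply: h. Qed.

Lemma line_pdisc p r (h : V) z : 0 < maxabs h -> cmod z <= r ->
  pdisc p r (p + z *: ((maxabs h)^-1%:C *: h)).
Proof.
move=> h0 zr j; rewrite !mxE addrAC subrr add0r !cmodM cmod_real ger0_norm ?invr_ge0 ?(ltW h0) //.
apply: le_trans (_ : cmod z * 1 <= _); last by rewrite mulr1.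
by apply: ler_wpM2l; rewrite ?cmod_ge0 // mulrC ler_pdivrMr // mul1r le_maxabs.
Qed.

Lemma maxabs0_eq (h : V) : maxabs h = 0 -> h = 0.
Proof.
move=> h0; apply/rowP => j; rewrite mxE; apply/eqP; rewrite -cmod_eq0 eq_le cmod_ge0 andbT.
by rewrite -h0 le_maxabs.
Qed.

Lemma unit_dirK (h : V) : 0 < maxabs h -> (maxabs h)%:C *: ((maxabs h)^-1%:C *: h) = h.
Proof.
move=> h0; rewrite scalerA; have -> : (maxabs h)%:C * (maxabs h)^-1%:C = 1 :> C.
  by rewrite -rmorphM divff // gt_eqF.
by rewrite scale1r.
Qed.

(** On the complex line through p in the normalised direction of h, the claims are [poly_rem2] and
    [poly_rem1] at z = [maxabs h]. *)
Lemma grad_bounds f p g r M h : pf f -> isgrad f p g -> 0 < r ->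
  (forall v, pdisc p r v -> cmod (f v) <= M) -> maxabs h <= r / 2 ->
  cmod (f (p + h) - f p - \sum_j h ord0 j * g j) <= 2 * M / r ^+ 2 * maxabs h ^+ 2 /\
  cmod (f (p + h) - f p) <= 2 * M / r * maxabs h.
Proof.
move=> pff hg r0 H hr.
have := maxabs_ge0 h; rewrite le_eqVlt => /predU1P[/esym h0|h0].
  rewrite (maxabs0_eq _ h0) addr0 subrr sub0r cmodN big1; last by move=> i _; rewrite mxE mul0r.
  have -> : maxabs (0 : V) = 0 by rewrite -(maxabs0_eq _ h0).
  by rewrite cmod0 expr0n !mulr0.
set d := (maxabs h)^-1%:C *: h; have [q [a b]] := hg d.
have Hq z : cmod z <= r -> cmod q.[z] <= M.
  by move=> zr; rewrite -a; apply: H; apply: line_pdisc.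
have E1 : f (p + h) = q.[(maxabs h)%:C] by rewrite -a unit_dirK.
have E2 : f p = q.[0] by rewrite -a scale0r addr0.
have E3 : \sum_j h ord0 j * g j = q`_1 * (maxabs h)%:C.
  rewrite b mulr_suml; apply: eq_bigr => j _; rewrite -{1}(unit_dirK h h0) mxE -/d; ring.
have cm : cmod ((maxabs h)%:C : C) = maxabs h by rewrite cmod_real gtr0_norm.
rewrite E1 E2 E3; split.
  by have := poly_rem2 _ q r M (maxabs h)%:C r0 Hq; rewrite cm; apply.
by have := poly_rem1 _ q r M (maxabs h)%:C r0 Hq; rewrite cm; apply.
Qed.

Lemma grad_coord f p g r M j : isgrad f p g -> 0 < r ->
  (forall v, pdisc p r v -> cmod (f v) <= M) -> cmod (g j) * r <= M.
Proof.
move=> hg r0 H; have [q [a b]] := hg (delta_mx ord0 j).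
have <- : q`_1 = g j.
  rewrite b (bigD1 j) //= mxE !eqxx mul1r big1 ?addr0 // => i ij.
  by rewrite mxE (negbTE ij) andbF mul0r.
rewrite -[r]expr1; apply: cauchy_coef => // z zr; rewrite -a; apply: H => i.
rewrite !mxE addrAC subrr add0r cmodM; apply: le_trans zr; rewrite -[leRHS]mulr1.
apply: ler_wpM2l; rewrite ?cmod_ge0 // cmod_nat /=.
by case: (_ == _).
Qed.

Definition apx (p : V) (r : R) (f : V -> C) : Prop :=
  forall e : R, 0 < e -> exists2 P, pf P & forall v, pdisc p r v -> cmod (f v - P v) <= e.

Lemma apx_pf p r f : pf f -> apx p r f.
Proof. by move=> h e e0; exists f => // v _; rewrite subrr cmod0 ltW. Qed.

Lemma apx_ext p r f g : (forall v, pdisc p r v -> f v = g v) -> apx p r f -> apx p r g.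
Proof. by move=> E h e /h [P pP H]; exists P => // v hv; rewrite -E ?H. Qed.

Lemma apx_sub p r p' r' f : (forall v, pdisc p' r' v -> pdisc p r v) -> apx p r f -> apx p' r' f.
Proof. by move=> E h e /h [P pP H]; exists P => // v /E; apply: H. Qed.

Lemma pf_bounded p r f : pf f -> exists2 M, 0 <= M & forall v, pdisc p r v -> cmod (f v) <= M.
Proof.
elim=> [c|j|f1 f2 _ [M1 m1 h1] _ [M2 m2 h2]|f1 f2 _ [M1 m1 h1] _ [M2 m2 h2]].
- by exists (cmod c) => //; apply: cmod_ge0.
- exists (cmod (p ord0 j) + `|r|); first by rewrite addr_ge0 ?cmod_ge0.
  move=> v /(_ j) h; have -> : v ord0 j = p ord0 j + (v ord0 j - p ord0 j) by ring.
  by rewrite (le_trans (cmodD _ _ _)) // lerD // (le_trans h) // ler_norm.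
- exists (M1 + M2); first by rewrite addr_ge0.
  by move=> v hv; rewrite (le_trans (cmodD _ _ _)) // lerD ?h1 ?h2.
- exists (M1 * M2); first by rewrite mulr_ge0.
  by move=> v hv; rewrite cmodM ler_pM ?cmod_ge0 ?h1 ?h2.
Qed.

Lemma apx_bounded p r f : apx p r f -> exists2 M, 0 <= M & forall v, pdisc p r v -> cmod (f v) <= M.
Proof.
move=> /(_ 1 ltr01) [P pP H]; have [M M0 HM] := pf_bounded p r _ pP.
exists (M + 1); first by rewrite addr_ge0.
move=> v hv; have -> : f v = P v + (f v - P v) by ring.
by rewrite (le_trans (cmodD _ _ _)) // lerD ?HM ?H.
Qed.

Lemma apx_add p r f g : apx p r f -> apx p r g -> apx p r (fun v => f v + g v).
Proof.
move=> hf hg e e0; have e2 : 0 < e / 2 by rewrite divr_gt0.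
have [P pP HP] := hf _ e2; have [Q pQ HQ] := hg _ e2.
exists (fun v => P v + Q v); first exact: pf_add.
move=> v hv; have -> : f v + g v - (P v + Q v) = (f v - P v) + (g v - Q v) by ring.
by rewrite (le_trans (cmodD _ _ _)) // (splitr e) lerD ?HP ?HQ.
Qed.

Lemma apx_mul p r f g : apx p r f -> apx p r g -> apx p r (fun v => f v * g v).
Proof.
move=> hf hg e e0.
have [M M0 HM] := apx_bounded _ _ _ hf; have [L L0 HL] := apx_bounded _ _ _ hg.
have k0 : 0 < M + L + 1 by rewrite ltr_wpDl // addr_ge0.
(* d <= 1 keeps P bounded by M + 1; the two errors then add up to at most d * (M + L + 1). *)
set d := Num.min 1 (e / (M + L + 1)).
have d0 : 0 < d by rewrite lt_min ltr01 divr_gt0.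
have d1 : d <= 1 by rewrite ge_min lexx.
have de : d * (M + L + 1) <= e by rewrite -ler_pdivlMr // ge_min lexx orbT.
have [P pP HP] := hf _ d0; have [Q pQ HQ] := hg _ d0.
exists (fun v => P v * Q v); first exact: pf_mul.
move=> v hv; have -> : f v * g v - P v * Q v = (f v - P v) * g v + P v * (g v - Q v) by ring.
have hP : cmod (P v) <= M + 1.
  have -> : P v = f v - (f v - P v) by ring.
  by rewrite (le_trans (cmodB _ _ _)) // lerD ?HM // (le_trans (HP v hv)).
apply: le_trans de; rewrite (le_trans (cmodD _ _ _)) // !cmodM.
have -> : d * (M + L + 1) = d * L + (M + 1) * d by ring.
by rewrite lerD // ler_pM ?cmod_ge0 ?HP ?HQ ?HL.
Qed.

Lemma apx_lim p r f :
  (forall e : R, 0 < e -> exists2 g, apx p r g & forall v, pdisc p r v -> cmod (f v - g v) <= e) ->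
  apx p r f.
Proof.
move=> h e e0; have e2 : 0 < e / 2 by rewrite divr_gt0.
have [g hg H] := h _ e2; have [P pP HP] := hg _ e2.
exists P => // v hv; have -> : f v - P v = (f v - g v) + (g v - P v) by ring.
by rewrite (le_trans (cmodD _ _ _)) // (splitr e) lerD ?HP ?H.
Qed.

Lemma apx_cst p r c : apx p r (fun=> c). Proof. exact: apx_pf (pf_cst c). Qed.

Lemma apx_exp p r f k : apx p r f -> apx p r (fun v => f v ^+ k).
Proof.
move=> h; elim: k => [|k IH]; first by apply: apx_ext (apx_cst p r 1) => v _; rewrite expr0.
by apply: apx_ext (apx_mul _ _ _ _ h IH) => v _; rewrite exprS.
Qed.

Lemma apx_sum p r k (f : 'I_k -> V -> C) :
  (forall i, apx p r (f i)) -> apx p r (fun v => \sum_(i < k) f i v).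
Proof.
elim: k f => [|k IH] f h; first by apply: apx_ext (apx_cst p r 0) => v _; rewrite big_ord0.
by apply: apx_ext (apx_add _ _ _ _ (IH _ (fun i => h (widen_ord (leqnSn k) i))) (h ord_max)) => v _; rewrite big_ord_recr.
Qed.

Lemma apx_prod p r k (f : 'I_k -> V -> C) :
  (forall i, apx p r (f i)) -> apx p r (fun v => \prod_(i < k) f i v).
Proof.
elim: k f => [|k IH] f h; first by apply: apx_ext (apx_cst p r 1) => v _; rewrite big_ord0.
by apply: apx_ext (apx_mul _ _ _ _ (IH _ (fun i => h (widen_ord (leqnSn k) i))) (h ord_max)) => v _; rewrite big_ord_recr.
Qed.

Definition expS L (z : C) : C := \sum_(l < L) z ^+ l / (l`!)%:R.

(** Mean value inequality along the segment from 0 to z: the derivative of the remainder of order L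
    + 1 is z times the remainder of order L. *)
Lemma expS_rem L (z : C) : cmod (cexp z - expS L z) <= cmod z ^+ L * expR (cmod z).
Proof.
elim: L z => [|L IH] z.
  rewrite /expS big_ord0 subr0 expr0 mul1r cmod_cexp ler_expR.
  by rewrite (le_trans (ler_norm _)) // Re_cmod.
have lin (t : R) : cder (fun u : R => (u%:C : C) * z) t z.
  by apply: cder_ext (cder_line _ 0 z t) => u; rewrite add0r.
have hp (l : nat) (t : R) : cder (fun u : R => ((u%:C : C) * z) ^+ l / (l`!)%:R) t
    (if l is l'.+1 then z * (((t%:C : C) * z) ^+ l' / (l'`!)%:R) else 0).
  elim: l => [|l IHl]; first by apply: cder_ext (cder_cst _ 1 t) => u; rewrite expr0 divr1.
  apply: cder_ext (cderE _ _ _ _ _ (cderZ _ (l.+1%:R^-1) _ _ _ (cderM _ _ _ _ _ _ (lin t) IHl)) _) => [u|].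
    rewrite exprS factS natrM; have := natC_neq0 R l.
    by move: (l.+1%:R : C) => a a0; field; rewrite fact_neq0 a0.
  case: l {IHl} => [|l]; rewrite ?fact0 ?expr0 ?mulr0 ?addr0 ?invr1 ?mul1r ?mulr1 //.
  rewrite exprS factS natrM -[l.+2%:R]natr1; have := natC_neq0 R l.+1; have := natC_neq0 R l.
  by rewrite -[l.+2%:R]natr1; move: (l.+1%:R : C) => a a0 a1; field; rewrite fact_neq0 a0 a1.
pose g (u : R) : C := cexp ((u%:C : C) * z) + - 1 * expS L.+1 ((u%:C : C) * z).
have g1 : g 1 - g 0 = cexp z - expS L.+1 z.
  rewrite /g mul1r mul0r cexp0 mulN1r; have -> : expS L.+1 0 = 1 by rewrite /expS big_ord_recl
   expr0 fact0 divr1 big1 ?addr0 // => i _; rewrite expr0n /= mul0r.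
  ring.
rewrite -g1; apply: (cmvt _ g (fun t => z * (cexp ((t%:C : C) * z) - expS L ((t%:C : C) * z)))).
  move=> t _; apply: cderE.
    apply: cderD; first exact: cder_cexp (lin t).
    by apply: cderZ; apply: cder_sum => i; apply: hp.
  rewrite big_ord_recl add0r mulN1r mulrBr; congr (_ - _).
  by rewrite /expS mulr_sumr; apply: eq_bigr.
move=> t /andP[t0 t1].
have tz : cmod ((t%:C : C) * z) <= cmod z by rewrite cmodM cmod_real ger0_norm // ler_piMl ?cmod_ge0.
rewrite cmodM exprS -mulrA ler_wpM2l ?cmod_ge0 //.
apply: le_trans (IH _) _; apply: ler_pM; rewrite ?exprn_ge0 ?cmod_ge0 ?expR_ge0 ?ler_expR //.
by rewrite lerXn2r ?nnegrE ?cmod_ge0.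
Qed.

(** The exponent is divided by an integer k that brings it below 1 / 2, where the Taylor sums
    converge geometrically; the k-th power undoes the division. *)
Lemma apx_cexp p r f : apx p r f -> apx p r (fun v => cexp (f v)).
Proof.
move=> hf; have [M M0 HM] := apx_bounded _ _ _ hf.
have [k k0 Hk] : exists2 k, (0 < k)%N & M / k%:R <= 2^-1.
  exists (2 * (Num.truncn M).+1)%N => //.
  rewrite ler_pdivrMr ?ltr0n // natrM mulrA mulVf ?pnatr_eq0 // mul1r.
  exact: ltW (truncnS_gt _).
have kC : (k%:R : C) != 0 by case: k k0 {Hk} => // k _; apply: natC_neq0.
have small : apx p r (fun v => cexp (k%:R^-1 * f v)).
  apply: apx_lim => e e0.
  have E0 : 0 < e / expR (2^-1 : R) by rewrite divr_gt0 ?expR_gt0.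
  have [L HL] := half_pow _ _ E0.
  exists (fun v => expS L (k%:R^-1 * f v)).
    apply: apx_sum => i; apply: apx_mul (apx_cst _ _ _); apply: apx_exp.
    by apply: apx_mul hf; apply: apx_cst.
  move=> v hv; apply: le_trans (expS_rem _ _) _.
  have hb : cmod (k%:R^-1 * f v) <= 2^-1.
    rewrite cmodM cmodV cmod_nat; apply: le_trans Hk; rewrite mulrC.
    by rewrite ler_wpM2r ?invr_ge0 // HM.
  apply: le_trans (_ : 2^-1 ^+ L * expR 2^-1 <= _); last by rewrite -ler_pdivlMr ?expR_gt0.
  apply: ler_pM; rewrite ?exprn_ge0 ?cmod_ge0 ?expR_ge0 ?ler_expR //.
  by rewrite lerXn2r ?nnegrE ?cmod_ge0 ?invr_ge0.
apply: apx_ext (apx_exp _ _ _ k small) => v _.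
by rewrite -cexp_nat mulrA divff // mul1r.
Qed.

(** 1 / f = c^-1 / (1 - u) with u = 1 - f / c of modulus at most 1 / 2, expanded in a geometric
    series. *)
Lemma apx_inv p r f c : c != 0 -> apx p r f ->
  (forall v, pdisc p r v -> cmod (f v - c) <= cmod c / 2) -> apx p r (fun v => (f v)^-1).
Proof.
move=> c0 hf H; have cm : 0 < cmod c by rewrite cmod_gt0.
pose u v := 1 - c^-1 * f v.
have hu : apx p r u.
  apply: apx_add (apx_cst _ _ 1) _; apply: apx_ext (apx_mul _ _ _ _ (apx_cst _ _ (- c^-1)) hf) => v _.
  by rewrite mulNr.
have ub v : pdisc p r v -> cmod (u v) <= 2^-1.
  move=> /H h; have -> : u v = - (c^-1 * (f v - c)) by rewrite /u mulrBr mulVf // opprB.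
  by rewrite cmodN cmodM cmodV mulrC ler_pdivrMr // mulrC.
apply: apx_lim => e e0.
have E0 : 0 < e * (cmod c / 2) by rewrite mulr_gt0 // divr_gt0.
have [L HL] := half_pow _ _ E0.
exists (fun v => c^-1 * \sum_(i < L) u v ^+ i).
  by apply: apx_mul (apx_cst _ _ _) _; apply: apx_sum => i; apply: apx_exp.
move=> v hv.
have fb : cmod c / 2 <= cmod (f v).
  have -> : f v = c - (c - f v) by ring.
  have h1 := cmodD _ (c - (c - f v)) (c - f v); rewrite subrK in h1.
  have := H v hv; rewrite cmodBC; lra.
have f0 : f v != 0 by rewrite -cmod_gt0 (lt_le_trans _ fb) // divr_gt0.
have u1 : 1 - u v = c^-1 * f v by rewrite /u; ring.
have -> : (f v)^-1 - c^-1 * \sum_(i < L) u v ^+ i = u v ^+ L / f v.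
  apply: (mulIf f0); rewrite mulfVK // mulrBl mulVf // mulrAC -u1.
  by rewrite -(opprB (u v) 1) mulNr -subrX1 opprB; ring.
rewrite cmodM cmodV cmodX ler_pdivrMr ?cmod_gt0 //.
apply: le_trans (_ : 2^-1 ^+ L <= _); first by rewrite lerXn2r ?nnegrE ?cmod_ge0 ?invr_ge0 ?ub.
by apply: le_trans HL _; rewrite ler_pM2l.
Qed.

(** The approximating polynomials are bounded by M + 1, hence Lipschitz with a common constant. The
    radius r / 8 is small enough: two points differ by at most (r / 2) / 2 in each coordinate, and
    the polydisc of radius r / 2 about either lies in that of radius r. *)
Lemma apx_lip p r f : 0 < r -> apx p r f -> exists2 L, 0 <= L &
  forall v w, pdisc p (r / 8) v -> pdisc p (r / 8) w -> cmod (f v - f w) <= L * maxabs (v - w).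
Proof.
move=> r0 hf; have [M M0 HM] := apx_bounded _ _ _ hf.
exists (2 * (M + 1) / (r / 2)); first by rewrite mulr_ge0 ?invr_ge0 ?mulr_ge0 ?addr_ge0 ?divr_ge0 // ltW.
move=> v w hv hw; apply/ler_addgt0Pr => e e0.
set d := Num.min 1 (e / 2).
have d0 : 0 < d by rewrite lt_min ltr01 divr_gt0.
have d1 : d <= 1 by rewrite ge_min lexx.
have de : d <= e / 2 by rewrite ge_min lexx orbT.
have [P pP HP] := hf _ d0; have [g hg] := pf_grad P w pP.
have Pb x : pdisc w (r / 2) x -> cmod (P x) <= M + 1.
  move=> hx; have hx' : pdisc p r x by apply: pdisc_trans hw hx _; lra.
  have -> : P x = f x - (f x - P x) by ring.
  by rewrite (le_trans (cmodB _ _ _)) // lerD ?HM // (le_trans (HP x hx')).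
have hvw : maxabs (v - w) <= r / 2 / 2.
  apply: maxabs_le; first by rewrite !divr_ge0 // ltW.
  move=> j; rewrite !mxE.
  have -> : v ord0 j - w ord0 j = (v ord0 j - p ord0 j) - (w ord0 j - p ord0 j) by ring.
  rewrite (le_trans (cmodB _ _ _)) //; have := hv j; have := hw j; lra.
have r2 : 0 < r / 2 by rewrite divr_gt0.
have [_] := grad_bounds _ _ _ _ _ _ pP hg r2 Pb hvw.
have -> : w + (v - w) = v by rewrite addrC subrK.
move=> hh; have -> : f v - f w = (P v - P w) + ((f v - P v) - (f w - P w)) by ring.
rewrite (le_trans (cmodD _ _ _)) // lerD // (le_trans (cmodB _ _ _)) //.
have h8 : r / 8 <= r by lra.
have := HP v (pdisc_le _ _ _ _ hv h8); have := HP w (pdisc_le _ _ _ _ hw h8); lra.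
Qed.

(** Weierstrass: the gradients of the approximating polynomials converge. *)
Lemma apx_quad p r f : 0 < r -> apx p r f -> exists g (K : R), 0 <= K /\
  forall h, maxabs h <= r / 2 ->
    cmod (f (p + h) - f p - \sum_j h ord0 j * g j) <= K * maxabs h ^+ 2.
Proof.
move=> r0 hf; have [M M0 HM] := apx_bounded _ _ _ hf.
have /choice [Pq HPq] : forall i : nat, exists Pg : (V -> C) * ('I_n -> C),
    [/\ pf Pg.1, isgrad Pg.1 p Pg.2 & forall v, pdisc p r v -> cmod (f v - Pg.1 v) <= i.+1%:R^-1].
  move=> i; have i0 : (0 : R) < i.+1%:R^-1 by rewrite invr_gt0.
  have [P pP HP] := hf _ i0; have [g hg] := pf_grad P p pP.
  by exists (P, g).
have gcauchy j i k : (i <= k)%N -> cmod ((Pq i).2 j - (Pq k).2 j) <= 2 / r * i.+1%:R^-1.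
  move=> ik; have [p1 g1 b1] := HPq i; have [p2 g2 b2] := HPq k.
  have ki : k.+1%:R^-1 <= i.+1%:R^-1 :> R by rewrite lef_pV2 ?posrE ?ler_nat.
  have := grad_coord _ _ _ r (2 * i.+1%:R^-1) j (isgradB _ _ _ _ _ g1 g2) r0.
  rewrite -ler_pdivlMr // mulrAC; apply=> v hv.
  have -> : (Pq i).1 v - (Pq k).1 v = (f v - (Pq k).1 v) - (f v - (Pq i).1 v) by ring.
  rewrite (le_trans (cmodB _ _ _)) //; move: (b1 v hv) (b2 v hv) ki.
  by move: (i.+1%:R^-1) (k.+1%:R^-1) => x y; lra.
have rate0 e : 0 < e -> exists N, forall k, (N <= k)%N -> 2 / r * k.+1%:R^-1 <= e.
  move=> e0; have [|N HN] := inv_nat_small _ (e / (2 / r)); first by rewrite !divr_gt0.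
  by exists N => k /HN; rewrite ler_pdivlMr ?divr_gt0 // mulrC.
have /choice [g Hg] : forall j, exists l, forall i, cmod ((Pq i).2 j - l) <= 2 / r * i.+1%:R^-1.
  move=> j; have [l [_ hl]] := rate_cvg _ (fun i => (Pq i).2 j) _ rate0 (gcauchy j).
  by exists l.
exists g, (2 * (M + 1) / r ^+ 2); split.
  by rewrite mulr_ge0 ?invr_ge0 ?mulr_ge0 ?addr_ge0 ?exprn_ge0 // ltW.
move=> h hr; set S := \sum_j cmod (h ord0 j).
have S0 : 0 <= S by apply: sumr_ge0 => i _; apply: cmod_ge0.
(* The factor with which the error 1 / (i + 1) enters: 2 for the values at p and p + h, S * (2 / r)
   for the gradients. *)
have T0 : 0 < 2 + S * (2 / r) by rewrite ltr_pwDl // mulr_ge0 // divr_ge0 // ltW.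
apply/ler_addgt0Pr => e e0.
have [i Hi] := inv_nat_small _ _ (divr_gt0 e0 T0); have {Hi} := Hi _ (leqnn i).
have [pP hg b] := HPq i; set a := i.+1%:R^-1 => ae.
have a0 : 0 <= a by rewrite invr_ge0.
have Pb x : pdisc p r x -> cmod ((Pq i).1 x) <= M + 1.
  move=> hx; have -> : (Pq i).1 x = f x - (f x - (Pq i).1 x) by ring.
  rewrite (le_trans (cmodB _ _ _)) // lerD ?HM // (le_trans (b x hx)) // /a.
  by rewrite invf_le1 // ler1n.
have [Q _] := grad_bounds _ _ _ _ _ _ pP hg r0 Pb hr.
have hp : pdisc p r (p + h).
  move=> j; rewrite !mxE addrAC subrr add0r (le_trans (le_maxabs _ _)) // (le_trans hr) //; lra.
have -> : f (p + h) - f p - \sum_j h ord0 j * g j =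
  ((Pq i).1 (p + h) - (Pq i).1 p - \sum_j h ord0 j * (Pq i).2 j)
  + (((f (p + h) - (Pq i).1 (p + h)) - (f p - (Pq i).1 p)) + \sum_j h ord0 j * ((Pq i).2 j - g j)).
  under [X in _ + (_ + X)]eq_bigr do rewrite mulrBr.
  rewrite sumrB; ring.
rewrite (le_trans (cmodD _ _ _)) // lerD //.
apply: le_trans (_ : a * (2 + S * (2 / r)) <= _); last by rewrite -ler_pdivlMr.
rewrite (le_trans (cmodD _ _ _)) // mulrDr lerD //.
  rewrite (le_trans (cmodB _ _ _)) //; have := b _ hp; have := b _ (pdisc_center p r (ltW r0)).
  by rewrite -/a; lra.
rewrite (le_trans (cmod_sum _ _ _ _ _)) // mulrCA /S mulr_suml; apply: ler_sum => j _.
by rewrite cmodM ler_wpM2l ?cmod_ge0 // mulrC.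
Qed.

(** Bridges the real number [maxabs h] and the norm of the library, which is complex-valued here. *)
Lemma normV_maxabs (h : V) : `|h| = (maxabs h)%:C.
Proof.
apply/eqP; rewrite eq_le; apply/andP; split.
  rewrite [leLHS]/Num.norm /= mx_normE.
  have nn : (0 : R[i]) <= (maxabs h)%:C by rewrite lecR maxabs_ge0.
  have -> : (maxabs h)%:C = (NngNum nn)%:num by [].
  rewrite num_le; apply/bigmax_leP; split; first by rewrite -num_le.
  case=> i j _; rewrite -num_le /= normC_cmod lecR (ord1 i); exact: le_maxabs.
have hx j : (cmod (h ord0 j))%:C <= `|h|.
  rewrite -normC_cmod [leRHS]/Num.norm /= mx_normE.
  by rewrite -[leLHS]nngE num_le; exact: (le_bigmax _ _ (ord0, j)).
have /complex_realP [x hn] : `|h| \is Num.real by apply: normr_real.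
rewrite hn lecR; apply: maxabs_le.
  by rewrite -lecR -hn normr_ge0.
by move=> j; rewrite -lecR -hn.
Qed.

Lemma diff_quad (f : V -> C) p (r K : R) : 0 < r -> 0 <= K ->
  (forall h, maxabs h <= r -> cmod (f (p + h)) <= K * maxabs h ^+ 2) -> differentiable f p.
Proof.
move=> r0 K0 H.
have f0 : f p = 0.
  have m0 : maxabs (0 : V) = 0.
    by apply/eqP; rewrite eq_le maxabs_ge0 andbT; apply: maxabs_le => // j; rewrite mxE cmod0.
  have := H 0; rewrite m0 addr0 => /(_ (ltW r0)); rewrite expr0n mulr0 => h.
  by apply/eqP; rewrite -cmod_eq0 eq_le h cmod_ge0.
apply: (@diff_quad_gen (Defs.C R) 'rV[Defs.C R]_n (Defs.C R) f p r%:C K%:C).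
- by rewrite ltcR.
- by rewrite lecR.
move=> h; rewrite normV_maxabs lecR normC_cmod => hr.
by rewrite -rmorphXn -rmorphM lecR addrC H.
Qed.

(** f is its affine part plus a remainder with the quadratic bound of [apx_quad], and both are
    differentiable. *)
Lemma apx_differentiable p r f : 0 < r -> apx p r f -> differentiable f p.
Proof.
move=> r0 hf; have [g [K [K0 H]]] := apx_quad _ _ _ r0 hf.
have -> : f = (fun v => (f v - f p - \sum_j (v ord0 j - p ord0 j) * g j)) +
    ((fun=> f p) + (\sum_j (fun v : V => (v ord0 j - p ord0 j) * g j))).
  by apply/funext => v; rewrite !fctE fct_sumE; ring.
apply: differentiableD; last apply: differentiableD; last apply: differentiable_sum.
- apply: (diff_quad _ _ (r / 2) K) => // [|h hh]; first by rewrite divr_gt0.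
  apply: le_trans (H h hh); rewrite le_eqVlt; apply/orP; left; apply/eqP; congr (cmod (_ - _)).
  by apply: eq_bigr => j _; rewrite mxE addrAC subrr add0r.
- exact: differentiable_cst.
move=> j; apply: differentiableM; last exact: differentiable_cst.
by apply: differentiableB; [apply: differentiable_coord|apply: differentiable_cst].
Qed.

End Approximation.

Arguments pf {R n} f.
Arguments pdisc {R n} p r v.
Arguments apx {R n} p r f.

(** * Sums over boxes and their uniform convergence *)

Definition ext (m : nat -> nat) (n k : nat) : nat -> nat := fun i => if i == n then k else m i.

(** The first index has M values and every other one M + 1: in the original partial sums m_1 runs
    from 1 to M, the others from 0 to M. *)
Definition bnd (M j : nat) : nat := (M + (j != 0))%N.

Section BoxSums.
Variable R : realType.
Local Notation C := (C R).
Local Notation Re := complex.Re.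
Local Notation Im := complex.Im.
Implicit Types (f g : (nat -> nat) -> C) (B : nat -> nat) (m : nat -> nat).

(** The variable of highest index is summed innermost, as telescoping requires; multi-indices are
    total sequences, 0 from n on. *)
Fixpoint bs B (n : nat) f : C :=
  if n is n'.+1 then bs B n' (fun m => \sum_(k < B n') f (ext m n' k)) else f (fun=> 0).

Lemma bs_eq B n f g : (forall m, f m = g m) -> bs B n f = bs B n g.
Proof. by move=> /funext ->. Qed.

Lemma bsD B n f g : bs B n (fun m => f m + g m) = bs B n f + bs B n g.
Proof.
elim: n f g => [//|n IH] f g /=; rewrite -IH; apply: bs_eq => m.
by rewrite big_split.
Qed.

Lemma bsZ B n a f : bs B n (fun m => a * f m) = a * bs B n f.
Proof.
elim: n f => [//|n IH] f /=; rewrite -IH; apply: bs_eq => m.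
by rewrite mulr_sumr.
Qed.

Lemma bs0 B n : bs B n (fun=> 0) = 0.
Proof. by elim: n => [//|n IH] /=; rewrite -[RHS]IH; apply: bs_eq => m; rewrite big1. Qed.

Lemma bsB B n f g : bs B n (fun m => f m - g m) = bs B n f - bs B n g.
Proof. by rewrite -(mulN1r (bs B n g)) -bsZ -bsD; apply: bs_eq => m; rewrite mulN1r. Qed.

Lemma bs_sum B n k (f : 'I_k -> (nat -> nat) -> C) :
  bs B n (fun m => \sum_(i < k) f i m) = \sum_(i < k) bs B n (f i).
Proof.
elim: k f => [|k IH] f.
  by rewrite big_ord0 -[RHS](bs0 B n); apply: bs_eq => m; rewrite big_ord0.
rewrite big_ord_recr /= -IH -bsD; apply: bs_eq => m; by rewrite big_ord_recr.
Qed.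

Lemma prod_ext (q : nat -> R) n m k :
  \prod_(i < n.+1) q (ext m n k i) = (\prod_(i < n) q (m i)) * q k.
Proof.
rewrite big_ord_recr /= /ext eqxx; congr (_ * _); apply: eq_bigr => i _.
by rewrite ltn_eqF.
Qed.

Section Majorized.
Variables (q : nat -> R) (Qi : R).
Hypothesis q0 : forall k, 0 <= q k.
Hypothesis qQ : forall b, \sum_(k < b) q k <= Qi.

Let Q b := \sum_(k < b) q k.

Lemma Q_ge0 b : 0 <= Q b. Proof. by apply: sumr_ge0. Qed.

Lemma Q_mono a b : (a <= b)%N -> Q a <= Q b.
Proof.
move=> ab; rewrite /Q -!(big_mkord predT) (big_cat_nat _ ab) //= lerDl.
by apply: sumr_ge0.
Qed.

Lemma bs_le B n f (M : R) : (forall m, cmod (f m) <= M * \prod_(i < n) q (m i)) ->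
  cmod (bs B n f) <= M * \prod_(i < n) Q (B i).
Proof.
elim: n f M => [|n IH] f M H /=; first by apply: le_trans (H _) _; rewrite !big_ord0.
rewrite big_ord_recr /= mulrA mulrAC; apply: IH => m.
apply: le_trans (cmod_sum _ _ _ _ _) _; rewrite mulrAC mulr_sumr; apply: ler_sum => k _.
by apply: le_trans (H _) _; rewrite prod_ext mulrA.
Qed.

(** The increment of a sum is at most that of the product majorant, so the rate of convergence is
    that of an increasing real sequence. *)
Lemma bs_diff B B' n f (M : R) : 0 <= M -> (forall j, (B j <= B' j)%N) ->
  (forall m, cmod (f m) <= M * \prod_(i < n) q (m i)) ->
  cmod (bs B' n f - bs B n f) <= M * (\prod_(i < n) Q (B' i) - \prod_(i < n) Q (B i)).
Proof.
move=> M0 BB; elim: n f M M0 => [|n IH] f M M0 H /=; first by rewrite !big_ord0 !subrr cmod0 mulr0.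
set g' := fun m => \sum_(k < B' n) f (ext m n k); set g := fun m => \sum_(k < B n) f (ext m n k).
have -> : bs B' n g' - bs B n g = (bs B' n g' - bs B n g') + bs B n (fun m => g' m - g m).
  by rewrite bsB; ring.
rewrite (le_trans (cmodD _ _ _)) // !big_ord_recr /=.
set P' := \prod_(i < n) Q (B' i); set P := \prod_(i < n) Q (B i).
have -> : M * (P' * Q (B' n) - P * Q (B n)) = (M * Q (B' n)) * (P' - P) + (M * (Q (B' n) - Q (B n))) * P by ring.
apply: lerD.
  apply: IH => [|m]; first by rewrite mulr_ge0 ?Q_ge0.
  apply: le_trans (cmod_sum _ _ _ _ _) _; rewrite mulrAC mulr_sumr; apply: ler_sum => k _.
  by apply: le_trans (H _) _; rewrite prod_ext mulrA.
apply: bs_le => m.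
have -> : g' m - g m = \sum_(B n <= k < B' n) f (ext m n k).
  rewrite /g' /g -!(big_mkord predT (fun k => f (ext m n k))).
  by rewrite (big_cat_nat _ (BB n)) //= [LHS]addrC addKr.
apply: le_trans (cmod_sum _ _ _ _ _) _.
have -> : Q (B' n) - Q (B n) = \sum_(B n <= k < B' n) q k.
  by rewrite /Q -!(big_mkord predT) (big_cat_nat _ (BB n)) //= [LHS]addrC addKr.
rewrite mulrAC mulr_sumr; apply: ler_sum => k _.
by apply: le_trans (H _) _; rewrite prod_ext mulrA.
Qed.

Lemma bnd_mono i k j : (i <= k)%N -> (bnd i j <= bnd k j)%N.
Proof. by move=> ik; rewrite /bnd leq_add2r. Qed.

(** The rate depends on q and n only, f entering through the constant M. Hence series that share a
    majorant converge uniformly. *)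
Lemma box_rate n : exists a : nat -> R,
  (forall e : R, 0 < e -> exists N, forall k, (N <= k)%N -> a k <= e) /\
  forall f (M : R), 0 <= M -> (forall m, cmod (f m) <= M * \prod_(i < n) q (m i)) ->
    exists l, ccvg (fun k => bs (bnd k) n f) l /\ forall i, cmod (bs (bnd i) n f - l) <= M * a i.
Proof.
pose P k := \prod_(i < n) Q (bnd k i).
have Pm i k : (i <= k)%N -> P i <= P k.
  by move=> ik; apply: ler_prod => j _; rewrite Q_ge0 Q_mono // bnd_mono.
have Pb k : P k <= Qi ^+ n.
  by rewrite -[X in Qi ^+ X](card_ord n) -prodr_const; apply: ler_prod => j _; rewrite Q_ge0 qQ.
have cP : cvgn P.
  by apply: nondecreasing_is_cvgn; [move=> i k; apply: Pm|exists (Qi ^+ n) => _ [k _ <-]].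
have Pl k : P k <= limn P by apply: nondecreasing_cvgn_le => // i j; apply: Pm.
pose a k := limn P - P k.
have a0 : forall e : R, 0 < e -> exists N, forall k, (N <= k)%N -> a k <= e.
  move=> e e0; have /cvgrPdist_le /(_ _ e0) [N _ hN] := cP.
  exists N => k /hN; apply: le_trans; exact: ler_norm.
exists a; split=> // f M M0 H.
have M1 : 0 < M + 1 by rewrite ltr_wpDl.
have ak k : 0 <= a k by rewrite subr_ge0.
apply: (rate_cvg _ _ (fun i => M * a i)) => [e e0|i k ik].
  have [N hN] := a0 _ (divr_gt0 e0 M1); exists N => k /hN.
  rewrite ler_pdivlMr // mulrC; apply: le_trans; rewrite ler_wpM2r // lerDl //.
rewrite cmodBC; apply: le_trans (bs_diff _ _ _ _ _ M0 (bnd_mono _ _ ^~ ik) H) _.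
by apply: ler_wpM2l => //; rewrite /a lerB // Pl.
Qed.

Lemma bs_apx nn (p : 'rV[C]_nn) r B n (f : 'rV[C]_nn -> (nat -> nat) -> C) :
  (forall m, apx p r (fun v => f v m)) -> apx p r (fun v => bs B n (f v)).
Proof.
elim: n f => [|n IH] f H /=; first exact: H.
by apply: IH => m; apply: apx_sum => k.
Qed.

(** The box sums are finite, hence approximable, and by [box_rate] they converge uniformly on the
    polydisc. *)
Lemma clim_bs_apx nn (p : 'rV[C]_nn) r n (f : 'rV[C]_nn -> (nat -> nat) -> C) (M : R) :
  0 <= M -> (forall m, apx p r (fun v => f v m)) ->
  (forall v m, pdisc p r v -> cmod (f v m) <= M * \prod_(i < n) q (m i)) ->
  apx p r (fun v => clim (fun k => bs (bnd k) n (f v))).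
Proof.
move=> M0 hf H; have [a [a0 Ha]] := box_rate n.
apply: apx_lim => e e0; have M1 : 0 < M + 1 by rewrite ltr_wpDl.
have [N hN] := a0 _ (divr_gt0 e0 M1).
exists (fun v => bs (bnd N) n (f v)); first exact: bs_apx.
move=> v hv; have [l [cl hl]] := Ha (f v) M M0 (fun m => H v m hv).
rewrite (climP _ _ _ cl) cmodBC; apply: le_trans (hl N) _.
have aN : a N <= e / (M + 1) by apply: hN.
have aN0 : 0 <= e / (M + 1) by rewrite divr_ge0 // ltW.
apply: le_trans (_ : M * (e / (M + 1)) <= _); first by rewrite ler_wpM2l.
apply: le_trans (_ : (M + 1) * (e / (M + 1)) <= _); first by rewrite ler_wpM2r // lerDl.
by rewrite mulrCA divff ?mulr1 // gt_eqF.
Qed.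

End Majorized.

Lemma box_cvg (q : nat -> R) (Qi M : R) n f : (forall k, 0 <= q k) ->
  (forall b, \sum_(k < b) q k <= Qi) -> 0 <= M ->
  (forall m, cmod (f m) <= M * \prod_(i < n) q (m i)) ->
  ccvg (fun k => bs (bnd k) n f) (clim (fun k => bs (bnd k) n f)).
Proof.
move=> q0 qQ M0 H; have [a [_ Ha]] := box_rate q Qi q0 qQ n.
by have [l [cl _]] := Ha f M M0 H; rewrite (climP _ _ _ cl).
Qed.

End BoxSums.

Arguments bs {R} B n f.

(** * Summable majorants from conditions on the tails of the exponents *)

Section Majorants.
Variable R : realType.
Implicit Types (m : nat -> nat).

Definition lnS (k : nat) : R := ln (k.+1%:R).

Lemma lnS_ge0 k : 0 <= lnS k. Proof. by rewrite ln_ge0 // ler1n. Qed.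

Lemma lnS_mono i j : (i <= j)%N -> lnS i <= lnS j.
Proof. by move=> ij; rewrite ler_ln ?posrE // ler_nat. Qed.

(** The summable sequence (k + 1) ^ (- 1 - e). *)
Definition qeps (e : R) (k : nat) : R := expR (- (1 + e) * lnS k).

(** Comparison with the integral, by induction on the sharper bound 1 + (1 - (b + 1) ^ (- e)) / e;
    the step rests on 1 / (b + 2) <= ln (b + 2) - ln (b + 1) and 1 + x <= exp x. *)
Lemma qeps_sum e b : 0 < e -> \sum_(k < b) qeps e k <= 1 + e^-1.
Proof.
move=> e0; suff h : \sum_(k < b.+1) qeps e k <= 1 + e^-1 * (1 - expR (- e * lnS b)).
  apply: le_trans (_ : \sum_(k < b.+1) qeps e k <= _).
    by rewrite big_ord_recr /= lerDl expR_ge0.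
  by apply: le_trans h _; rewrite lerD2l ler_piMr ?invr_ge0 ?(ltW e0) // gerBl expR_ge0.
elim: b => [|b IH].
  by rewrite big_ord_recl big_ord0 addr0 /qeps /lnS ln1 !mulr0 expR0 subrr mulr0 addr0.
rewrite big_ord_recr /=; apply: le_trans (lerD IH (lexx _)) _.
rewrite -addrA lerD2l -(ler_pM2l e0) mulrDr !mulrA divff ?gt_eqF // !mul1r.
set d := lnS b.+1 - lnS b.
have bb : (0 : R) < b.+2%:R by rewrite ltr0n.
have hd : expR (- lnS b.+1) <= d.
  have h : ln (1 + (- b.+2%:R^-1)) <= - (b.+2%:R^-1) :> R.
    by apply: le_ln1Dx; rewrite ltrN2 invf_lt1 // ltr1n.
  have E : 1 - b.+2%:R^-1 = b.+1%:R / b.+2%:R :> R.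
    have b0 := lt0r_neq0 bb; move: b0; rewrite -[b.+2%:R]natr1.
    by move: (b.+1%:R : R) => x x0; field.
  rewrite E ln_div ?posrE // in h.
  by rewrite expRN lnK ?posrE // -lerN2 /d /lnS opprB.
have -> : qeps e b.+1 = expR (- e * lnS b.+1) * expR (- lnS b.+1).
  by rewrite /qeps -expRD; congr expR; ring.
have -> : expR (- e * lnS b) = expR (- e * lnS b.+1) * expR (e * d).
  by rewrite -expRD; congr expR; rewrite /d; ring.
set u := expR (- e * lnS b.+1).
have u0 : 0 < u by apply: expR_gt0.
have h2 : 1 + e * d <= expR (e * d) by rewrite expR_ge1Dx.
have h3 : u * (1 + e * expR (- lnS b.+1)) <= u * expR (e * d).
  by rewrite ler_pM2l //; apply: le_trans h2; rewrite lerD2l ler_pM2l.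
lra.
Qed.

(** Abel summation: only the tails of the exponents matter. *)
Lemma abel_tail n (d y : nat -> R) : (forall i, 0 <= y i) -> (forall i, y i <= y i.+1) ->
  (forall j, (j < n)%N -> 0 <= \sum_(j <= i < n) d i) ->
  0 <= \sum_(0 <= i < n) d i * y i.
Proof.
move=> y0 ym H.
suff h k : (k <= n)%N -> (\sum_(k <= i < n) d i) * y k <= \sum_(k <= i < n) d i * y i.
  apply: le_trans (h 0 (leq0n n)); case: n H {h} => [|n] H; first by rewrite big_nil mul0r.
  by rewrite mulr_ge0 // H.
move=> kn; rewrite -(subKn kn); move: (n - k)%N (leq_subr k n) => t {k kn}.
elim: t => [|t IH] tn; first by rewrite subn0 !big_geq // mul0r.
have e : (n - t.+1).+1 = (n - t)%N by rewrite subnSK.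
have lt : (n - t.+1 < n)%N by rewrite ltn_subrL; case: (n) tn.
rewrite !(big_ltn lt) mulrDl lerD2l e; apply: le_trans (IH (ltnW tn)).
case: t tn e {IH lt} => [|t] tn e; first by rewrite subn0 !big_geq // !mul0r.
rewrite -[in X in _ <= _ * X]e; apply: ler_wpM2l => //; apply: H.
by rewrite ltn_subrL /= (leq_trans _ tn).
Qed.

Definition ysum m (j : nat) : nat := \sum_(i < j) m i.

(** The numbers 1 + m_0 + ... + m_i increase with i, so by [abel_tail] every exponent may be
    replaced by 1 + e once all tail sums allow it; then 1 + m_0 + ... + m_i >= 1 + m_i. *)
Lemma majorant n (s : nat -> R) (e : R) m : 0 < e ->
  (forall j, (j < n)%N -> (n - j)%:R * (1 + e) <= \sum_(j <= i < n) s i.+1) ->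
  expR (- \sum_(0 <= i < n) s i.+1 * lnS (ysum m i.+1)) <= \prod_(i < n) qeps e (m i).
Proof.
move=> e0 H.
have h : 0 <= \sum_(0 <= i < n) (s i.+1 - (1 + e)) * lnS (ysum m i.+1).
  apply: (abel_tail n (fun i => s i.+1 - (1 + e)) (fun i => lnS (ysum m i.+1))) => [i|i|j jn].
  - exact: lnS_ge0.
  - by apply: lnS_mono; rewrite [in leqRHS]/ysum big_ord_recr /= leq_addr.
  - by rewrite sumrB sumr_const_nat subr_ge0 -mulr_natl H.
apply: le_trans (_ : expR (- \sum_(0 <= i < n) (1 + e) * lnS (ysum m i.+1)) <= _).
  rewrite ler_expR lerN2 -subr_ge0 -sumrB; under eq_bigr do rewrite -mulrBl; exact: h.
rewrite big_mkord -sumrN expR_sum; apply: ler_prod => i _.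
rewrite expR_ge0 ler_expR -mulNr; apply: ler_wnM2l; first by rewrite oppr_le0 addr_ge0 // ltW.
by apply: lnS_mono; rewrite /ysum big_ord_recr /= leq_addl.
Qed.

End Majorants.

(** * Expansion coefficients and the one-variable telescoping identity *)

Section Coefficients.
Variable R : realType.
Local Notation C := (C R).
Local Notation Re := complex.Re.
Local Notation Im := complex.Im.
Implicit Types (t a g b s x w : C).

(** The coefficients of [e^(a X) / (1 - t e^X)]: [pm1 t] is that of [X^(-1)]
    and [pc t a l] that of [X^l]. *)
Definition pm1 t : C := if t == 1 then - 1 else 0.

(** The equation P = e^(a X) + t e^X P solved degree by degree. For t <> 1 degree l gives the
    coefficient l; for t = 1 that coefficient cancels in degree l, and degree l + 1 determines
    it. *)
Definition pnext t a (l : nat) (p : seq C) : C :=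
  if t == 1 then ((l.+2)`!%:R)^-1 - a ^+ l.+1 / (l.+1)`!%:R
                   - \sum_(i < l) nth 0 p i / (l.+1 - i)`!%:R
  else (a ^+ l / l`!%:R + t * \sum_(i < l) nth 0 p i / (l - i)`!%:R) / (1 - t).

(** Course-of-values recursion: the list holds the first k coefficients. *)
Fixpoint plist t a k : seq C :=
  if k is k'.+1 then rcons (plist t a k') (pnext t a k' (plist t a k')) else [::].

Definition pc t a l : C := nth 0 (plist t a l.+1) l.

Lemma size_plist t a k : size (plist t a k) = k.
Proof. by elim: k => [//|k IH] /=; rewrite size_rcons IH. Qed.

Lemma nth_plist t a k i : (i < k)%N -> nth 0 (plist t a k) i = pc t a i.
Proof.
elim: k => [//|k IH]; rewrite ltnS leq_eqVlt => /predU1P[->//|ik] /=.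
by rewrite nth_rcons size_plist ik IH.
Qed.

Lemma pcE t a l : pc t a l = pnext t a l (plist t a l).
Proof. by rewrite /pc /= nth_rcons size_plist ltnn eqxx. Qed.

Lemma pc_rel t a l : pc t a l = a ^+ l / l`!%:R + t * pm1 t / (l.+1)`!%:R
   + t * \sum_(i < l.+1) pc t a i / (l - i)`!%:R.
Proof.
rewrite big_ord_recr /= subnn fact0 divr1 /pm1.
case: (eqVneq t 1) => [->|t1].
  (* For t = 1 the coefficient l stands on both sides; what remains is the definition of the
     coefficient l - 1, and for l = 0 a trivial identity. *)
  rewrite !mul1r mulN1r; suff h : a ^+ l / l`!%:R - (l.+1)`!%:R^-1 + \sum_(i < l) pc 1 a i / (l - i)`!%:R = 0.
    by rewrite addrA h add0r.
  case: l => [|l]; first by rewrite big_ord0 expr0 !fact0 invr1 mulr1 addr0 subrr.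
  rewrite big_ord_recr /= subSnn (_ : 1`! = 1)%N // divr1 [pc 1 a l]pcE /pnext eqxx.
  have -> : \sum_(i < l) nth 0 (plist 1 a l) i / (l.+1 - i)`!%:R =
            \sum_(i < l) pc 1 a i / (l.+1 - i)`!%:R.
    by apply: eq_bigr => i _; rewrite nth_plist.
  ring.
rewrite mulr0 mul0r addr0 mulrDr addrA.
have -> : \sum_(i < l) pc t a i / (l - i)`!%:R = \sum_(i < l) nth 0 (plist t a l) i / (l - i)`!%:R.
  by apply: eq_bigr => i _; rewrite nth_plist.
have t1' : 1 - t != 0 by rewrite subr_eq0 eq_sym.
apply/eqP; rewrite -subr_eq -mulrN1 mulrC -{1}[pc t a l]mulr1 ; apply/eqP.
rewrite [X in pc _ _ _ * 1 + X](_ : _ = - t * pc t a l); last ring.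
rewrite [LHS](_ : _ = pc t a l * (1 - t)); last ring.
by rewrite pcE /pnext (negbTE t1) mulfVK.
Qed.

(** In the equation of degree l + 1 the term p (l + 1) cancels and p l is determined; coefficients
    are thus identified by their generating function. *)
Lemma pc_unique (a : C) (p p' : nat -> C) :
  (forall l, p l = a ^+ l / l`!%:R - (l.+1)`!%:R^-1 + \sum_(i < l.+1) p i / (l - i)`!%:R) ->
  (forall l, p' l = a ^+ l / l`!%:R - (l.+1)`!%:R^-1 + \sum_(i < l.+1) p' i / (l - i)`!%:R) ->
  forall l, p l = p' l.
Proof.
move=> H H' l; elim/ltn_ind: l => l IH.
have h := H l.+1; have h' := H' l.+1.
rewrite 2!big_ord_recr /= subnn subSnn fact0 (_ : 1`! = 1)%N // !divr1 in h.
rewrite 2!big_ord_recr /= subnn subSnn fact0 (_ : 1`! = 1)%N // !divr1 in h'.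
have e : \sum_(i < l) p i / (l.+1 - i)`!%:R = \sum_(i < l) p' i / (l.+1 - i)`!%:R.
  by apply: eq_bigr => i _; rewrite IH.
move: h h'; rewrite e => /eqP; rewrite -subr_eq0 => /eqP h /eqP; rewrite -subr_eq0 => /eqP h'.
move: (\sum_(i < l) _) h h' => S h h'.
have e1 : a ^+ l.+1 / (l.+1)`!%:R - (l.+2)`!%:R^-1 + S + p l = 0 by rewrite -[RHS]oppr0 -h; ring.
have e2 : a ^+ l.+1 / (l.+1)`!%:R - (l.+2)`!%:R^-1 + S + p' l = 0 by rewrite -[RHS]oppr0 -h'; ring.
by apply: (addrI (a ^+ l.+1 / (l.+1)`!%:R - (l.+2)`!%:R^-1 + S)); rewrite e1 e2.
Qed.

Lemma tri_sum K (G : nat -> nat -> C) :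
  \sum_(l < K) \sum_(i < K - l) G l (l + i)%N = \sum_(t < K) \sum_(l < t.+1) G l t.
Proof.
elim: K => [|K IH]; first by rewrite !big_ord0.
rewrite big_ord_recr /= subSnn big_ord_recr big_ord0 /= addn0 add0r.
rewrite [RHS]big_ord_recr /= -IH [in RHS]big_ord_recr /= addrA; congr (_ + _).
rewrite -big_split; apply: eq_bigr => l _ /=.
by rewrite subSn ?(ltnW (ltn_ord l)) // big_ord_recr /= subnKC // ltnW.
Qed.

(** [Afun] solves [rf * (x + b)^(-s) = A x - t * A (x + g)] up to the remainder
    [Dfun], which gains K powers of x over [x^(-s)]. The factor [rf] removes the
    pole at s = 1 which only the untwisted case t = 1 has, and [qf] is the
    coefficient of the leading term x^(1-s) which only this case has. *)
Definition rf t s : C := if t == 1 then 1 - s else 1.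
Definition qf t g : C := if t == 1 then - g^-1 else 0.

Section Level.
Variables (b g t : C).
Hypothesis g0 : g != 0.
Let a := b / g.

Definition Acoef (l : nat) s : C := pc t (b / g) l * ff s l * g ^+ l.

Definition Afun K s x : C :=
  qf t g * pw x (s - 1) + rf t s * \sum_(l < K) Acoef l s * pw x (s + l%:R).

Definition Dfun K s x : C :=
  rf t s * Tay K s x b +
  t * (qf t g * Tay K.+1 (s - 1) x g +
       rf t s * \sum_(l < K) Acoef l s * Tay (K - l) (s + l%:R) x g).

(** All powers are expanded at x by Taylor, and the coefficients of x ^ (- s - u) agree by [pc_rel].
    The truncation orders K, K + 1 and K - l make every remainder start at x ^ (- s - K). *)
Lemma D_eq K s x :
  rf t s * pw (x + b) s = Afun K s x - t * Afun K s (x + g) + Dfun K s x.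
Proof.
have tq : t * qf t g = qf t g by rewrite /qf; case: eqP => [->|_]; rewrite ?mul1r ?mulr0.
(* Links the leading coefficient to [pm1], the coefficient of X^(-1). *)
have rq : qf t g * (1 - s) * g = rf t s * pm1 t.
  by rewrite /qf /rf /pm1; case: eqP => _; rewrite ?mul0r ?mulr0 // mulrAC mulNr mulVf //; ring.
suff key : Afun K s x =
    rf t s * (\sum_(l < K) ff s l / (l`!)%:R * b ^+ l * pw x (s + l%:R)) +
    t * (qf t g * (\sum_(l < K.+1) ff (s - 1) l / (l`!)%:R * g ^+ l * pw x (s - 1 + l%:R)) +
      rf t s * \sum_(l < K) Acoef l s *
        (\sum_(i < K - l) ff (s + l%:R) i / (i`!)%:R * g ^+ i * pw x (s + l%:R + i%:R))).
  rewrite key /Dfun /Afun /Tay.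
  under [X in _ = _ + (_ + t * (_ + _ * X))]eq_bigr do rewrite mulrBr.
  by rewrite sumrB; ring.
rewrite big_ord_recl ff0 fact0 divr1 expr0 addr0 !mul1r.
(* Terms are collected by u = l + i, the total number of powers gained. *)
pose G l u := Acoef l s * (ff (s + l%:R) (u - l) / ((u - l)`!)%:R * g ^+ (u - l) * pw x (s + u%:R)).
have -> : \sum_(l < K) Acoef l s *
    (\sum_(i < K - l) ff (s + l%:R) i / (i`!)%:R * g ^+ i * pw x (s + l%:R + i%:R)) =
    \sum_(u < K) \sum_(l < u.+1) G l u.
  rewrite -tri_sum; apply: eq_bigr => l _; rewrite mulr_sumr; apply: eq_bigr => i _.
  by rewrite /G addKn natrD addrA.
suff key2 : rf t s * (\sum_(l < K) Acoef l s * pw x (s + l%:R)) =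
    rf t s * (\sum_(l < K) ff s l / (l`!)%:R * b ^+ l * pw x (s + l%:R)) +
    t * qf t g * (\sum_(i < K) ff (s - 1) (lift ord0 i) / ((lift ord0 i)`!)%:R * g ^+ lift ord0 i *
       pw x (s - 1 + (lift ord0 i)%:R)) +
    t * rf t s * (\sum_(u < K) \sum_(l < u.+1) G l u).
  rewrite /Afun key2 -{1}tq; ring.
rewrite !mulr_sumr -!big_split /=.
apply: eq_bigr => u _; rewrite /bump /= add1n.
have -> : s - 1 + u.+1%:R = s + u%:R by rewrite -natr1; ring.
rewrite [ff (s - 1) u.+1]ffS subrK.
have -> : \sum_(l < u.+1) G l u = ff s u * g ^+ u * pw x (s + u%:R) *
    \sum_(l < u.+1) pc t (b / g) l / (u - l)`!%:R.
  rewrite mulr_sumr; apply: eq_bigr => l _; rewrite /G /Acoef.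
  have lu : (l <= u)%N by rewrite -ltnS.
  have fE : ff s u = ff s l * ff (s + l%:R) (u - l) by rewrite ff_add subnKC.
  have gE : g ^+ u = g ^+ l * g ^+ (u - l) by rewrite -exprD subnKC.
  by rewrite fE gE; ring.
rewrite /Acoef [X in X * ff s u]pc_rel.
have bE : b = b / g * g by rewrite mulfVK.
rewrite [b ^+ u](_ : _ = (b / g) ^+ u * g ^+ u); last by rewrite -exprMn -bE.
move: (\sum_(l < u.+1) _) => S.
have -> : t * qf t g * (- (s - 1) * ff s u / (u.+1)`!%:R * g ^+ u.+1 * pw x (s + u%:R)) =
   t * (qf t g * (1 - s) * g) * (ff s u / (u.+1)`!%:R * g ^+ u * pw x (s + u%:R)).
  by rewrite exprS; ring.
rewrite rq; ring.
Qed.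

End Level.

(** x has the size of Y inside a fixed sector of the right half-plane. The condition is convex in x,
    so it extends to the segments used in Taylor estimates. *)
Definition sect (k K Y : R) (x : C) : Prop := k * Y <= Re x /\ cmod x <= K * Y.

Lemma sect_Re k K Y x : 0 < k -> 1 <= Y -> sect k K Y x -> 0 < Re x.
Proof. by move=> k0 Y1 [h _]; apply: lt_le_trans h; rewrite mulr_gt0 // (lt_le_trans ltr01). Qed.

Lemma sect_conv k K Y x h (t : R) : 0 <= t <= 1 -> sect k K Y x -> sect k K Y (x + h) ->
  sect k K Y (x + (t%:C : C) * h).
Proof.
move=> /andP[t0 t1] [x1 x2] [y1 y2]; have -> : x + (t%:C : C) * h = (1 - t)%:C * x + t%:C * (x + h).
  by rewrite rmorphB rmorph1; ring.
split.
  rewrite ReD !ReM /= !mul0r !subr0.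
  have -> : k * Y = (1 - t) * (k * Y) + t * (k * Y) by ring.
  by rewrite lerD // ler_wpM2l // subr_ge0.
apply: le_trans (cmodD _ _ _) _; rewrite !cmodM !cmod_real !ger0_norm ?subr_ge0 //.
have -> : K * Y = (1 - t) * (K * Y) + t * (K * Y) by ring.
by rewrite lerD // ler_wpM2l // subr_ge0.
Qed.

(** The logarithms of cmod x and Y differ by a constant and the argument is at most pi, which costs
    only a factor exponential in cmod w. *)
Lemma pw_sect (k K : R) : 0 < k -> 0 < K -> exists2 A, 0 <= A & forall x w Y, 1 <= Y ->
  sect k K Y x -> cmod (pw x w) <= expR (A * cmod w) * expR (- Re w * ln Y).
Proof.
move=> k0 K0; exists (pi + `|ln k| + `|ln K|); first by apply: addr_ge0 => //; apply: addr_ge0 => //; apply: pi_ge0.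
move=> x w Y Y1 hx; have x0 := sect_Re _ _ _ _ k0 Y1 hx; case: hx => h1 h2.
have Y0 : 0 < Y by rewrite (lt_le_trans ltr01).
rewrite cmod_pw // -expRD ler_expR.
have cx : 0 < cmod x by rewrite cmod_gt0 Re_gt0_neq0.
have l1 : ln k + ln Y <= ln (cmod x).
  rewrite -lnM ?posrE // ler_ln ?posrE ?mulr_gt0 // (le_trans h1) //.
  by apply: le_trans (ler_norm _) (Re_cmod _ _).
have l2 : ln (cmod x) <= ln K + ln Y.
  by rewrite -lnM ?posrE // ler_ln ?posrE ?mulr_gt0.
set d := ln (cmod x) - ln Y.
have hd : `|d| <= `|ln k| + `|ln K|.
  rewrite ler_norml; have := ler_norm (ln K); have := ler_norm (- ln k); rewrite normrN.
  have := normr_ge0 (ln k); have := normr_ge0 (ln K); rewrite /d; lra.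
have -> : - Re w * ln (cmod x) + Im w * Arg x = (- Re w * d + Im w * Arg x) - Re w * ln Y.
  by rewrite /d; ring.
rewrite [X in _ <= _ + X]mulNr; apply: lerD => //.
apply: le_trans (_ : cmod w * (`|ln k| + `|ln K|) + cmod w * pi <= _); last first.
  by rewrite le_eqVlt; apply/orP; left; apply/eqP; ring.
apply: lerD.
  apply: le_trans (ler_norm _) _; rewrite normrM normrN; apply: ler_pM => //; exact: Re_cmod.
apply: le_trans (ler_norm _) _; rewrite normrM; apply: ler_pM => //; first exact: Im_cmod.
exact: Arg_Re_pos.
Qed.

Lemma Tay_sect (k K : R) L h (W : R) : 0 < k -> 0 < K -> 0 <= W -> exists2 M, 0 <= M &
  forall w x Y, 1 <= Y -> cmod w <= W -> sect k K Y x -> sect k K Y (x + h) ->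
    cmod (Tay L w x h) <= M * expR (- (Re w + L%:R) * ln Y).
Proof.
move=> k0 K0 W0; have [A A0 HA] := pw_sect _ _ k0 K0.
exists (\prod_(i < L) (W + i%:R) * cmod h ^+ L * expR (A * (W + L%:R))).
  by rewrite !mulr_ge0 ?expR_ge0 ?exprn_ge0 ?cmod_ge0 ?prodr_ge0 // => i _; rewrite addr_ge0.
move=> w x Y Y1 wW hx hxh; rewrite -[X in _ <= X]mulrA.
apply: le_trans (cmod_Tay _ _ _ _ _ (expR (A * (W + L%:R)) * expR (- (Re w + L%:R) * ln Y)) _) _.
  move=> u hu; have hs := sect_conv _ _ _ _ _ _ hu hx hxh; split.
    exact: sect_Re k0 Y1 hs.
  apply: le_trans (HA _ _ _ Y1 hs) _; rewrite ReD Re_nat ler_wpM2r ?expR_ge0 //.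
  rewrite ler_expR ler_wpM2l // (le_trans (cmodD _ _ _)) // cmod_nat lerD2r //.
apply: ler_wpM2r; first by rewrite mulr_ge0 ?expR_ge0.
apply: ler_wpM2r; first by rewrite exprn_ge0 ?cmod_ge0.
by apply: ler_prod => i _; rewrite addr_ge0 ?cmod_ge0 //= lerD2r.
Qed.

Definition cbdd (c : C -> C) : Prop :=
  forall W : R, exists2 M : R, 0 <= M & forall s, cmod s <= W -> cmod (c s) <= M.

Lemma cbdd_cst c : cbdd (fun=> c).
Proof. by move=> W; exists (cmod c) => //; apply: cmod_ge0. Qed.

Lemma cbdd_id : cbdd id.
Proof. by move=> W; exists `|W| => // s h; apply: le_trans h (ler_norm _). Qed.

Lemma cbddM f h : cbdd f -> cbdd h -> cbdd (fun s => f s * h s).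
Proof.
move=> hf hg W; have [M M0 HM] := hf W; have [N N0 HN] := hg W.
by exists (M * N) => [|s sW]; rewrite ?mulr_ge0 // cmodM ler_pM ?cmod_ge0 ?HM ?HN.
Qed.

Lemma cbddD f h : cbdd f -> cbdd h -> cbdd (fun s => f s + h s).
Proof.
move=> hf hg W; have [M M0 HM] := hf W; have [N N0 HN] := hg W.
exists (M + N) => [|s sW]; first by rewrite addr_ge0.
by rewrite (le_trans (cmodD _ _ _)) // lerD ?HM ?HN.
Qed.

Lemma cbdd_ff l : cbdd (fun s => ff s l).
Proof.
elim: l => [|l IH].
  by have -> : (fun s => ff s 0) = (fun=> 1) by [apply/funext => s; rewrite ff0]; apply: cbdd_cst.
have -> : (fun s : C => ff s l.+1) = (fun s => ff s l * ((- 1) * s + (- l%:R))).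
  by apply/funext => s; rewrite ffSr mulN1r.
by apply: cbddM => //; apply: cbddD (cbdd_cst _); apply: cbddM (cbdd_cst _) cbdd_id.
Qed.

Lemma cbdd_rf t : cbdd (rf t).
Proof.
rewrite /rf; case: eqP => _; last exact: cbdd_cst.
have -> : (fun s : C => 1 - s) = (fun s => 1 + (- 1) * s) by apply/funext => s; rewrite mulN1r.
by apply: cbddD (cbdd_cst _) _; apply: cbddM (cbdd_cst _) cbdd_id.
Qed.

Section DBound.
Variables (k K : R) (b g : C).
Hypotheses (k0 : 0 < k) (K0 : 0 < K).

(** Order x ^ (- s - e), uniformly for s in bounded sets; x + b and x + g must lie in the same
    sector as x because [Dfun] joins them to it by segments. *)
Definition dbdd (e : R) (f : C -> C -> C) : Prop :=
  forall W : R, 0 <= W -> exists2 M, 0 <= M &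
  forall s x Y, 1 <= Y -> cmod s <= W -> sect k K Y x -> sect k K Y (x + b) -> sect k K Y (x + g) ->
    cmod (f s x) <= M * expR (- (Re s + e) * ln Y).

Lemma dbdd_mul e c f : cbdd c -> dbdd e f -> dbdd e (fun s x => c s * f s x).
Proof.
move=> hc hf W W0; have [M M0 HM] := hc W; have [N N0 HN] := hf W W0.
exists (M * N) => [|s x Y Y1 sW h1 h2 h3]; first by rewrite mulr_ge0.
by rewrite cmodM -mulrA ler_pM ?cmod_ge0 ?HM ?HN.
Qed.

Lemma dbdd_add e f h : dbdd e f -> dbdd e h -> dbdd e (fun s x => f s x + h s x).
Proof.
move=> hf hg W W0; have [M M0 HM] := hf W W0; have [N N0 HN] := hg W W0.
exists (M + N) => [|s x Y Y1 sW h1 h2 h3]; first by rewrite addr_ge0.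
by rewrite (le_trans (cmodD _ _ _)) // mulrDl lerD ?HM ?HN.
Qed.

Lemma dbdd_sum e n (f : 'I_n -> C -> C -> C) : (forall i, dbdd e (f i)) ->
  dbdd e (fun s x => \sum_(i < n) f i s x).
Proof.
elim: n f => [|n IH] f H.
  by move=> W W0; exists 0 => // *; rewrite big_ord0 cmod0 mul0r.
move=> W W0; have [M M0 HM] := dbdd_add _ _ _ (IH _ (fun i => H (widen_ord (leqnSn n) i))) (H ord_max) W W0.
by exists M => // s x Y *; rewrite big_ord_recr /= HM.
Qed.

Lemma dbdd_Tay e L (u : R) h : (h = b) \/ (h = g) -> e = u + L%:R ->
  dbdd e (fun s x => Tay L (s + u%:C) x h).
Proof.
move=> hb eE W W0; have W1 : 0 <= W + `|u| by rewrite addr_ge0.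
have [M M0 HM] := Tay_sect _ _ L h _ k0 K0 W1; exists M => // s x Y Y1 sW h1 h2 h3.
have := HM (s + u%:C) x Y Y1; rewrite ReD /= eE addrA; apply=> //.
  by rewrite (le_trans (cmodD _ _ _)) // cmod_real lerD2r.
by case: hb => ->.
Qed.

Lemma dbdd_D t n : dbdd n%:R (Dfun b g t n).
Proof.
rewrite /Dfun; apply: dbdd_add.
  apply: dbdd_mul (cbdd_rf t) _.
  have := dbdd_Tay n%:R n 0 b (or_introl erefl); rewrite add0r => /(_ erefl).
  by under eq_fun do under eq_fun do rewrite addr0.
apply: (dbdd_mul _ (fun=> t)); first exact: cbdd_cst.
apply: dbdd_add.
  apply: (dbdd_mul _ (fun=> qf t g)); first exact: cbdd_cst.
  have := dbdd_Tay n%:R n.+1 (- 1) g (or_intror erefl); rewrite -natr1 => h.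
  have {h} := h _; under eq_fun do under eq_fun do rewrite rmorphN rmorph1.
  by apply; ring.
apply: dbdd_mul (cbdd_rf t) _; apply: dbdd_sum => i; apply: dbdd_mul.
  apply: cbddM (cbdd_cst _); apply: cbddM (cbdd_ff _); exact: cbdd_cst.
have := dbdd_Tay n%:R (n - i) i%:R g (or_intror erefl).
under eq_fun do under eq_fun do rewrite rmorph_nat.
by apply; rewrite -natrD subnKC // ltnW.
Qed.

End DBound.
End Coefficients.

Arguments pc {R} t a l.
Arguments pm1 {R} t.
Arguments rf {R} t s.
Arguments qf {R} t g.
Arguments Acoef {R} b g t l s.
Arguments Afun {R} b g t K s x.
Arguments Dfun {R} b g t K s x.
Arguments sect {R} k K Y x.

(** * The step from n to n + 1 summation variables *)

Section Levels.
Variable R : realType.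
Local Notation C := (C R).
Local Notation Re := complex.Re.
Local Notation Im := complex.Im.
Implicit Types (s : nat -> C) (m : nat -> nat) (w : C).

Lemma fin_pos n (d : nat -> R) : (forall j, (j < n)%N -> 0 < d j) ->
  exists2 e : R, 0 < e & forall j, (j < n)%N -> e <= d j.
Proof.
elim: n => [|n IH] H; first by exists 1.
have [|e e0 He] := IH; first by move=> j jn; apply: H; apply: ltnW.
exists (Num.min e (d n)) => [|j]; first by rewrite lt_min e0 H.
rewrite ltnS leq_eqVlt => /predU1P[->|/He h]; first by rewrite ge_min lexx orbT.
by rewrite ge_min h.
Qed.

Lemma fin_bound n (d : nat -> R) : exists2 K : R, 0 < K & forall j, (j < n)%N -> d j <= K.
Proof.
elim: n => [|n [K K0 H]]; first by exists 1.
exists (Num.max K (d n)) => [|j]; first by rewrite lt_max K0.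
rewrite ltnS leq_eqVlt => /predU1P[->|/H h]; first by rewrite le_max lexx orbT.
by rewrite le_max h.
Qed.

Lemma expR_lnS_small (d e : R) : 0 < d -> 0 < e ->
  exists N, forall k, (N <= k)%N -> expR (- d * lnS R k) <= e.
Proof.
move=> d0 e0; pose L := - ln e / d; exists (Num.truncn (expR L)) => k hk.
rewrite -[leRHS]lnK ?posrE // ler_expR mulNr lerNl -ler_pdivrMl // mulrC -/L.
rewrite -[leLHS]expRK ler_ln ?posrE ?expR_gt0 //.
by rewrite (le_trans (ltW (truncnS_gt _))) // ler_nat ltnS.
Qed.

Variables (gam c tau : nat -> C).
Hypothesis gam0 : forall j, 0 < Re (gam j).
Hypothesis c0 : forall j, 0 < Re (c j).
Hypothesis tau1 : forall j, cmod (tau j) <= 1.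

Definition Xf m j : C := c j + \sum_(i < j) gam i * (m i)%:R.

(** There are n summation variables but n + 1 factors: summing over the first variable leaves a
    power of [c 0], and the factor of index 0 is there to receive it. *)
Definition term n s m : C :=
  (\prod_(i < n) tau i ^+ m i) * \prod_(j < n.+1) pw (Xf m j) (s j).

Definition box n s (M : nat) : C := bs (bnd M) n (term n s).

Definition upd s n w : nat -> C := fun j => if j == n then s n + w else s j.

Definition bt n : C := c n.+1 - c n.

Definition xf m n : C := Xf m n + gam n * (m n)%:R.

Lemma Xf_ext m n k j : (j <= n)%N -> Xf (ext m n k) j = Xf m j.
Proof.
move=> jn; rewrite /Xf; congr (_ + _); apply: eq_bigr => i _.
by rewrite /ext ltn_eqF // (leq_trans (ltn_ord i)).
Qed.

Lemma XfS m n : Xf m n.+1 = xf m n + bt n.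
Proof. by rewrite /xf /Xf big_ord_recr /= /bt; ring. Qed.

Lemma term_ext n s m k : term n s (ext m n k) = term n s m.
Proof.
rewrite /term; congr (_ * _); apply: eq_bigr => i _.
  by rewrite /ext ltn_eqF.
by rewrite Xf_ext // -ltnS.
Qed.

Lemma termS n s m : term n.+1 s m = term n s m * tau n ^+ m n * pw (xf m n + bt n) (s n.+1).
Proof. by rewrite /term big_ord_recr /= [X in _ * X]big_ord_recr /= XfS; ring. Qed.

Lemma term_upd n s w m : term n (upd s n w) m = term n s m * pw (Xf m n) w.
Proof.
rewrite /term !big_ord_recr /= /upd eqxx pwD -!mulrA; congr (_ * (_ * _)).
by apply: eq_bigr => i _; rewrite ltn_eqF.
Qed.

Lemma term_eq n s s' m : (forall j, (j <= n)%N -> s j = s' j) -> term n s m = term n s' m.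
Proof.
by move=> H; rewrite /term; congr (_ * _); apply: eq_bigr => j _; rewrite H // -ltnS.
Qed.

Definition Yf m j : R := (ysum m j).+1%:R.

Lemma Yf_ge1 m j : 1 <= Yf m j. Proof. by rewrite /Yf ler1n. Qed.

Lemma sect_lin (k K : R) z m j : 0 <= k -> (forall i, (i < j)%N -> k <= Re (gam i)) ->
  (forall i, (i < j)%N -> cmod (gam i) <= K) -> k <= Re z -> cmod z <= K ->
  sect k K (Yf m j) (z + \sum_(i < j) gam i * (m i)%:R).
Proof.
move=> k0 gk gK zk zK.
have E (a : R) : a * Yf m j = a + \sum_(i < j) a * (m i)%:R.
  by rewrite /Yf -natr1 mulrDr mulr1 addrC /ysum natr_sum mulr_sumr.
split; rewrite E.
  rewrite ReD Re_sum lerD //; apply: ler_sum => i _.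
  by rewrite ReMn ler_wpM2r // gk.
rewrite (le_trans (cmodD _ _ _)) // lerD // (le_trans (cmod_sum _ _ _ _ _)) //.
by apply: ler_sum => i _; rewrite cmodM cmod_nat ler_wpM2r // gK.
Qed.

Lemma sect_all n : exists k K, [/\ 0 < k, 0 < K,
  (forall m j, (j <= n)%N -> sect k K (Yf m j) (Xf m j)) &
  (forall m, [/\ sect k K (Yf m n.+1) (xf m n), sect k K (Yf m n.+1) (xf m n + bt n) &
                 sect k K (Yf m n.+1) (xf m n + gam n)])].
Proof.
have [k1 k10 Hk1] := fin_pos n.+1 (fun j => Re (gam j)) (fun j _ => gam0 j).
have [k2 k20 Hk2] := fin_pos n.+2 (fun j => Re (c j)) (fun j _ => c0 j).
have [K1 K10 HK1] := fin_bound n.+1 (fun j => cmod (gam j)).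
have [K2 K20 HK2] := fin_bound n.+2 (fun j => cmod (c j)).
exists (Num.min k1 k2), (K1 + K2); rewrite lt_min k10 k20 addr_gt0 //; split=> //.
  move=> m j jn; apply: sect_lin.
  - by rewrite le_min !ltW.
  - by move=> i ij; rewrite ge_min Hk1 // ltnS (leq_trans (ltnW ij)).
  - by move=> i ij; rewrite (le_trans (HK1 i _)) ?lerDl ?(ltW K20) // ltnS (leq_trans (ltnW ij)).
  - by rewrite ge_min Hk2 ?orbT // ltnS (leq_trans jn).
  - by rewrite (le_trans (HK2 j _)) ?lerDr ?(ltW K10) // ltnS (leq_trans jn).
move=> m.
have S z : Num.min k1 k2 <= Re z -> cmod z <= K1 + K2 ->
    sect (Num.min k1 k2) (K1 + K2) (Yf m n.+1) (z + \sum_(i < n.+1) gam i * (m i)%:R).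
  apply: sect_lin.
  - by rewrite le_min !ltW.
  - by move=> i ij; rewrite ge_min Hk1.
  - by move=> i ij; rewrite (le_trans (HK1 i _)) ?lerDl ?(ltW K20).
have E : xf m n = c n + \sum_(i < n.+1) gam i * (m i)%:R.
  by rewrite /xf /Xf big_ord_recr /= addrA.
have rn : k2 <= Re (c n) by apply: Hk2.
have cn : cmod (c n) <= K2 by apply: HK2.
split.
- rewrite E; apply: S; first by rewrite ge_min rn orbT.
  by rewrite (le_trans cn) // lerDr ltW.
- rewrite -XfS; apply: S; first by rewrite ge_min Hk2 ?orbT.
  by rewrite (le_trans (HK2 _ _)) // lerDr ltW.
- rewrite E addrAC; apply: S.
    by rewrite ReD ge_min (le_trans rn) ?orbT // lerDl ltW.
  by rewrite (le_trans (cmodD _ _ _)) // addrC lerD // HK1.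
Qed.

(** [region n K s] is the domain reached after subtracting K terms of the
    asymptotic expansion; [region n 0] is the region of absolute convergence.
    The exponent [s 0] belongs to the constant factor [c 0] and is free. *)
Definition region n K s : Prop := forall j, (j < n)%N ->
  (n - j)%:R < \sum_(j <= i < n) Re (s i.+1) + K%:R.

(** The slack e serves twice: inside 1 + e for summability, and alone as a reserve that pays for the
    decay of the boundary terms and for small changes of s. *)
Definition marg n K (e : R) s : Prop := forall j, (j < n)%N ->
  (n - j)%:R * (1 + e) + e <= \sum_(j <= i < n) Re (s i.+1) + K%:R.

Lemma region_marg n K s : region n K s -> exists2 e, 0 < e & marg n K e s.
Proof.
move=> H; have [|e e0 He] := fin_pos n (fun j => \sum_(j <= i < n) Re (s i.+1) + K%:R - (n - j)%:R).
  by move=> j jn; rewrite subr_gt0 H.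
have n1 : (0 : R) < n.+1%:R by rewrite ltr0n.
exists (e / n.+1%:R); first by rewrite divr_gt0.
move=> j jn; have := He j jn; rewrite lerBrDl; apply: le_trans.
rewrite mulrDr mulr1 -addrA lerD2l.
have -> : (n - j)%:R * (e / n.+1%:R) + e / n.+1%:R = e * ((n - j).+1%:R / n.+1%:R).
  by rewrite -[(n - j).+1%:R]natr1; ring.
by rewrite ler_piMr ?(ltW e0) // ler_pdivrMr // mul1r ler_nat ltnS leq_subr.
Qed.

Lemma regionW n K K' s : (K <= K')%N -> region n K s -> region n K' s.
Proof. by move=> KK H j jn; apply: lt_le_trans (H j jn) _; rewrite lerD2l ler_nat. Qed.

Lemma region_eq n K s s' : (forall j, (0 < j <= n)%N -> s j = s' j) -> region n K s -> region n K s'.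
Proof.
move=> E H j jn; have := H j jn; congr (_ < _ + _).
by apply: eq_big_nat => i /andP[_ i_n]; rewrite E.
Qed.

Lemma region_ex n s : exists K, region n K s.
Proof.
have [M M0 HM] := fin_bound n (fun j => (n - j)%:R - \sum_(j <= i < n) Re (s i.+1)).
exists (Num.truncn M).+1 => j jn; rewrite -ltrBlDl.
by apply: le_lt_trans (HM j jn) (truncnS_gt _).
Qed.

Lemma upd_tail s n w j : (j < n)%N ->
  \sum_(j <= i < n) Re (upd s n w i.+1) = \sum_(j <= i < n) Re (s i.+1) + Re w.
Proof.
case: n => // n; rewrite ltnS => jn; rewrite !big_nat_recr //= {2}/upd eqxx ReD addrA; congr (_ + _ + _).
by apply: eq_big_nat => i /andP[_ i_n]; rewrite /upd eqSS ltn_eqF.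
Qed.

Lemma upd_sum s n w (y : nat -> R) : y 0 = 0 ->
  \sum_(0 <= i < n) Re (upd s n w i.+1) * y i.+1 = \sum_(0 <= i < n) Re (s i.+1) * y i.+1 + Re w * y n.
Proof.
case: n => [|n] y0; first by rewrite !big_geq // y0 mulr0 addr0.
rewrite !big_nat_recr //= {2}/upd eqxx ReD mulrDl addrA; congr (_ + _ + _).
by apply: eq_big_nat => i /andP[_ i_n]; rewrite /upd eqSS ltn_eqF.
Qed.

Local Notation lY m j := (lnS R (ysum m j)).

Lemma lY0 m : lY m 0 = 0. Proof. by rewrite /ysum big_ord0 /lnS ln1. Qed.

(** Each factor is estimated in its sector. Index 0 contributes a constant only, as [lY m 0] is
    0. *)
Lemma term_bound n (W : R) : exists2 M : R, 0 <= M & forall s, (forall j, (j <= n)%N -> cmod (s j) <= W) ->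
  forall m, cmod (term n s m) <= M * expR (- \sum_(0 <= i < n) Re (s i.+1) * lY m i.+1).
Proof.
have [k [K [k0 K0 H _]]] := sect_all n; have [A A0 HA] := pw_sect R k K k0 K0.
exists (expR (A * W) ^+ n.+1); first by rewrite exprn_ge0 ?expR_ge0.
move=> s sW m; rewrite /term cmodM.
have t1 : cmod (\prod_(i < n) tau i ^+ m i) <= 1.
  rewrite cmod_prod; apply: prodr_ile1 => i _; rewrite cmod_ge0 cmodX /=.
  by rewrite exprn_ile1 ?cmod_ge0.
apply: le_trans (_ : 1 * cmod (\prod_(j < n.+1) pw (Xf m j) (s j)) <= _).
  by rewrite ler_wpM2r ?cmod_ge0.
rewrite mul1r cmod_prod.
have -> : - (\sum_(0 <= i < n) Re (s i.+1) * lY m i.+1) = \sum_(j < n.+1) - Re (s j) * lY m j.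
  rewrite big_ord_recl lY0 mulr0 add0r big_mkord -sumrN; apply: eq_bigr => i _.
  by rewrite /= /bump add1n mulNr.
rewrite expR_sum -[X in expR _ ^+ X](card_ord n.+1) -prodr_const -big_split /=.
apply: ler_prod => j _; rewrite cmod_ge0 /=; have jn : (j <= n)%N by rewrite -ltnS.
apply: le_trans (HA _ _ _ (Yf_ge1 m j) (H m j jn)) _; rewrite ler_wpM2r ?expR_ge0 //.
by rewrite ler_expR ler_wpM2l // sW.
Qed.

Definition tele n w s m : C :=
  term n s m * (tau n ^+ m n * pw (xf m n) w - tau n ^+ (m n).+1 * pw (xf m n + gam n) w).

Definition bdry n w s (b : nat) m : C :=
  tau n ^+ b * (term n s m * pw (Xf m n + gam n * b%:R) w).

(** The end m_n = 0 leaves the power -w of [Xf m n], which merges with the factor n and raises the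
    exponent s_n by w; the other end is [bdry]. *)
Lemma bs_tele n w s M : bs (bnd M) n.+1 (tele n w s) =
  box n (upd s n w) M - bs (bnd M) n (bdry n w s (bnd M n)).
Proof.
rewrite /box -bsB /=; apply: bs_eq => m.
pose u k := tau n ^+ k * pw (Xf m n + gam n * k%:R) w.
have -> : \sum_(k < bnd M n) tele n w s (ext m n k) = \sum_(0 <= k < bnd M n) - (term n s m) * (u k.+1 - u k).
  rewrite big_mkord; apply: eq_bigr => k _; rewrite /tele term_ext /xf Xf_ext // /u.
  have -> : ext m n k n = k by rewrite /ext eqxx.
  have -> : Xf m n + gam n * k.+1%:R = Xf m n + gam n * k%:R + gam n.
    by rewrite -[k.+1%:R]natr1; ring.
  ring.
rewrite -mulr_sumr telescope_sumr // /u term_upd /bdry mulr0 addr0 expr0; ring.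
Qed.

(** The base at the far end is at least of the order of both Y_n and b + 1, so its power -w is split
    into Y_n ^ (d - Re w) and (b + 1) ^ (- d). The first factor keeps the n-fold sum convergent, the
    second tends to 0. *)
Lemma bdry_cvg n w s : region n 0 (upd s n w) -> 0 < Re w ->
  ccvg (fun M => bs (bnd M) n (bdry n w s (bnd M n))) 0.
Proof.
move=> /region_marg [e e0 He] w0.
have [k [K [k0 K0 _ H]]] := sect_all n; have [A A0 HA] := pw_sect R k K k0 K0.
have [W W0 HW] := fin_bound n.+1 (fun j => cmod (s j)).
have [M M0 HM] := term_bound n W.
(* d <= e is covered by the reserve in [marg], d <= Re w by the decay in w. *)
pose d := Num.min e (Re w).
have d0 : 0 < d by rewrite lt_min e0.
have de : d <= e by rewrite ge_min lexx.
have dw : d <= Re w by rewrite ge_min lexx orbT.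
set L := M * expR (A * cmod w).
have L0 : 0 <= L by rewrite mulr_ge0 ?expR_ge0.
have B (b : nat) m : cmod (bdry n w s b m) <= (L * expR (- d * lnS R b)) * \prod_(i < n) qeps R e (m i).
  have T := HM s HW m.
  have [h1 _ _] := H (ext m n b).
  have P := HA _ w _ (Yf_ge1 _ _) h1.
  have xE : xf (ext m n b) n = Xf m n + gam n * b%:R by rewrite /xf Xf_ext // /ext eqxx.
  have yE : ysum (ext m n b) n.+1 = (ysum m n + b)%N.
    rewrite /ysum big_ord_recr /= /ext eqxx; congr (_ + _)%N; apply: eq_bigr => i _.
    by rewrite ltn_eqF.
  rewrite xE /Yf yE -/(lnS R (ysum m n + b)) in P.
  have tb : cmod (tau n ^+ b) <= 1 by rewrite cmodX exprn_ile1 ?cmod_ge0.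
  rewrite /bdry cmodM; apply: le_trans (_ : 1 * cmod (term n s m * pw (Xf m n + gam n * b%:R) w) <= _).
    by rewrite ler_wpM2r ?cmod_ge0.
  rewrite mul1r cmodM; apply: le_trans (ler_pM (cmod_ge0 _ _) (cmod_ge0 _ _) T P) _.
  have hy : - Re w * lnS R (ysum m n + b) <= - (Re w - d) * lY m n + - d * lnS R b.
    have a1 : lY m n <= lnS R (ysum m n + b) by apply: lnS_mono; rewrite leq_addr.
    have a2 : lnS R b <= lnS R (ysum m n + b) by apply: lnS_mono; rewrite leq_addl.
    rewrite -subr_ge0.
    have -> : - (Re w - d) * lY m n + - d * lnS R b - - Re w * lnS R (ysum m n + b) =
      (Re w - d) * (lnS R (ysum m n + b) - lY m n) + d * (lnS R (ysum m n + b) - lnS R b) by ring.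
    by rewrite addr_ge0 // mulr_ge0 ?subr_ge0 // ltW.
  have mj : expR (- \sum_(0 <= i < n) Re (upd s n (w - d%:C) i.+1) * lY m i.+1) <= \prod_(i < n) qeps R e (m i).
    apply: (majorant R n (fun i => Re (upd s n (w - d%:C) i)) e m e0) => j jn; have := He j jn; rewrite !upd_tail // addr0 ReB /=; lra.
  rewrite (upd_sum s n _ (fun j => lY m j) (lY0 m)) ReB /= in mj.
  set S := \sum_(0 <= i < n) _ in T mj *.
  apply: le_trans (_ : L * expR (- d * lnS R b) * expR (- (S + (Re w - d) * lY m n)) <= _).
    rewrite /L.
    have -> : M * expR (- S) * (expR (A * cmod w) * expR (- Re w * lnS R (ysum m n + b))) =
       M * expR (A * cmod w) * expR (- S + - Re w * lnS R (ysum m n + b)) by rewrite expRD; ring.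
    rewrite -[X in _ <= X]mulrA -expRD; apply: ler_wpM2l => //.
    by rewrite ler_expR opprD addrCA lerD2l addrC -mulNr.
  by apply: ler_wpM2l mj; rewrite mulr_ge0 ?expR_ge0.
set Q := (1 + e^-1) ^+ n.
have q0 (k' : nat) : 0 <= qeps R e k' by apply: expR_ge0.
have e1 : 0 <= 1 + e^-1 by rewrite addr_ge0 // invr_ge0 ltW.
have Q0 : 0 <= Q by rewrite exprn_ge0.
have T0 : 0 < L * Q + 1 by rewrite ltr_wpDl // mulr_ge0.
move=> eps eps0; have [N HN] := expR_lnS_small _ _ d0 (divr_gt0 eps0 T0).
exists N => k' Nk; rewrite subr0.
apply: le_trans (bs_le R (qeps R e) _ n _ _ (B (bnd k' n))) _.
have sm : expR (- d * lnS R (bnd k' n)) <= eps / (L * Q + 1).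
  by apply: HN; rewrite (leq_trans Nk) // leq_addr.
apply: le_trans (_ : L * expR (- d * lnS R (bnd k' n)) * Q <= _).
  apply: ler_wpM2l; first by rewrite mulr_ge0 ?expR_ge0.
  rewrite /Q -[X in _ ^+ X](card_ord n) -prodr_const; apply: ler_prod => i _.
  by rewrite qeps_sum // andbT; apply: sumr_ge0.
rewrite mulrAC; apply: le_trans (_ : (L * Q + 1) * (eps / (L * Q + 1)) <= _).
  by apply: ler_pM; rewrite ?mulr_ge0 ?expR_ge0 // lerDl.
by rewrite mulrCA divff ?mulr1 // gt_eqF.
Qed.

Definition rterm n K s m : C :=
  term n s m * tau n ^+ m n * Dfun (bt n) (gam n) (tau n) K (s n.+1) (xf m n).

Lemma gam_neq0 j : gam j != 0. Proof. exact: Re_gt0_neq0. Qed.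

(** This is [D_eq] at x = [xf m n] times the lower factors; tau ^ (m n) turns A(x) - tau A(x +
    gamma) into differences [tele]. *)
Lemma termS_expand n K s m : rf (tau n) (s n.+1) * term n.+1 s m =
  qf (tau n) (gam n) * tele n (s n.+1 - 1) s m +
  rf (tau n) (s n.+1) * \sum_(l < K) Acoef (bt n) (gam n) (tau n) l (s n.+1) * tele n (s n.+1 + l%:R) s m
  + rterm n K s m.
Proof.
rewrite termS mulrCA (D_eq R _ _ _ (gam_neq0 n) K) /Afun /rterm /tele.
have -> (S : C) (f : 'I_K -> C) (a b : 'I_K -> C) :
  \sum_(l < K) f l * (S * (tau n ^+ m n * a l - tau n ^+ (m n).+1 * b l)) =
  S * tau n ^+ m n * (\sum_(l < K) f l * a l) - S * tau n ^+ (m n).+1 * (\sum_(l < K) f l * b l).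
  by rewrite !mulr_sumr -sumrB; apply: eq_bigr => l _; ring.
rewrite exprS; ring.
Qed.

Lemma rterm_bound n K (W : R) : 0 <= W -> exists2 M : R, 0 <= M &
  forall s, (forall j, (j <= n.+1)%N -> cmod (s j) <= W) -> forall m,
  cmod (rterm n K s m) <=
    M * expR (- (\sum_(0 <= i < n.+1) Re (s i.+1) * lY m i.+1 + K%:R * lY m n.+1)).
Proof.
move=> W0; have [k [K' [k0 K0 _ H]]] := sect_all n.
have [M M0 HM] := term_bound n W.
have [D D0 HD] := dbdd_D R k K' (bt n) (gam n) k0 K0 (tau n) K W W0.
exists (M * D) => [|s sW m]; first by rewrite mulr_ge0.
have [h1 h2 h3] := H m.
have d := HD _ _ _ (Yf_ge1 m n.+1) (sW n.+1 (leqnn _)) h1 h2 h3.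
have t := HM s (fun j jn => sW j (leq_trans jn (leqnSn n))) m.
have tb : cmod (tau n ^+ m n) <= 1 by rewrite cmodX exprn_ile1 ?cmod_ge0.
rewrite /rterm 2!cmodM; apply: le_trans (_ : cmod (term n s m) * 1 * cmod (Dfun (bt n) (gam n) (tau n) K (s n.+1) (xf m n)) <= _).
  by apply: ler_wpM2r; rewrite ?cmod_ge0 // ler_wpM2l ?cmod_ge0.
rewrite mulr1; apply: le_trans (ler_pM (cmod_ge0 _ _) (cmod_ge0 _ _) t d) _.
rewrite mulrACA ler_wpM2l ?mulr_ge0 // -expRD ler_expR big_nat_recr //=.
by rewrite le_eqVlt; apply/orP; left; apply/eqP; rewrite /Yf /lnS; ring.
Qed.

Lemma rterm_maj n K (W : R) : 0 <= W -> exists2 M : R, 0 <= M &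
  forall s e, 0 < e -> (forall j, (j <= n.+1)%N -> cmod (s j) <= W) -> marg n.+1 K e s ->
  forall m, cmod (rterm n K s m) <= M * \prod_(i < n.+1) qeps R e (m i).
Proof.
move=> W0; have [M M0 HM] := rterm_bound n K W W0; exists M => // s e e0 sW hm m.
apply: le_trans (HM s sW m) _; apply: ler_wpM2l => //.
have mj : expR (- \sum_(0 <= i < n.+1) Re (upd s n.+1 K%:R i.+1) * lY m i.+1) <= \prod_(i < n.+1) qeps R e (m i).
  apply: (majorant R n.+1 (fun i => Re (upd s n.+1 K%:R i)) e m e0) => j jn; have := hm j jn; rewrite upd_tail // Re_nat; lra.
by rewrite (upd_sum s n.+1 _ (fun j => lY m j) (lY0 m)) Re_nat in mj.
Qed.

Definition Rem n K s : C := clim (fun M => bs (bnd M) n.+1 (rterm n K s)).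

Lemma qeps_ge0 (e : R) k : 0 <= qeps R e k. Proof. exact: expR_ge0. Qed.

Lemma Rem_cvg n K s : region n.+1 K s -> ccvg (fun M => bs (bnd M) n.+1 (rterm n K s)) (Rem n K s).
Proof.
move=> /region_marg [e e0 he]; have [W W0 HW] := fin_bound n.+2 (fun j => cmod (s j)).
have [M M0 HM] := rterm_maj n K W (ltW W0).
apply: (box_cvg R (qeps R e) (1 + e^-1) M n.+1 (rterm n K s)) => //.
- exact: qeps_ge0.
- by move=> b; apply: qeps_sum.
- by apply: HM.
Qed.

Section Step.
Variables (n : nat) (E : (nat -> C) -> C).
Hypothesis HE : forall s, region n 0 s -> ccvg (box n s) (E s).

(** Continues [rf] times the series with n + 1 variables: undivided, it has no pole of its own at
    s_(n+1) = 1. *)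
Definition stepK K s : C :=
  qf (tau n) (gam n) * E (upd s n (s n.+1 - 1)) +
  rf (tau n) (s n.+1) * \sum_(l < K) Acoef (bt n) (gam n) (tau n) l (s n.+1) * E (upd s n (s n.+1 + l%:R))
  + Rem n K s.

Lemma tele_cvg w s : region n 0 (upd s n w) -> 0 < Re w ->
  ccvg (fun M => bs (bnd M) n.+1 (tele n w s)) (E (upd s n w)).
Proof.
move=> h w0; have := ccvgD _ _ _ _ _ (HE _ h) (ccvgZ _ (- 1) _ _ (bdry_cvg n w s h w0)).
rewrite mulr0 addr0; apply: ccvg_eq => M; by rewrite bs_tele mulN1r.
Qed.

(** Dropping a variable lowers every tail condition by 1, which balances the loss in the exponent
    s_(n+1) - 1. Used for the leading term with K = 0 and for the term of index K in [stepKS]. *)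
Lemma region_upd K s w : region n.+1 K s -> K%:R + Re (s n.+1) - 1 <= Re w ->
  region n 0 (upd s n w) /\ 0 < Re w.
Proof.
move=> H hw; split.
  move=> j jn; have := H j (ltnW jn); rewrite upd_tail // big_nat_recr ?(ltnW jn) //= subSn ?(ltnW jn) // -natr1; lra.
have := H n (ltnSn n); rewrite big_nat1 subSnn; lra.
Qed.

Lemma step_cvg K s : region n.+1 0 s ->
  ccvg (fun M => rf (tau n) (s n.+1) * box n.+1 s M) (stepK K s).
Proof.
move=> H; have HK := regionW _ _ _ _ (leq0n K) H.
have t1 : ccvg (fun M => bs (bnd M) n.+1 (tele n (s n.+1 - 1) s)) (E (upd s n (s n.+1 - 1))).
  by have [] := region_upd 0 s (s n.+1 - 1) H; [rewrite ReB /= add0r|apply: tele_cvg].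
have t2 l : ccvg (fun M => bs (bnd M) n.+1 (tele n (s n.+1 + l%:R) s)) (E (upd s n (s n.+1 + l%:R))).
  have [] := region_upd 0 s (s n.+1 + l%:R) H; last exact: tele_cvg.
  by rewrite ReD Re_nat; have := ler0n R l; lra.
have := ccvgD _ _ _ _ _ (ccvgD _ _ _ _ _ (ccvgZ _ (qf (tau n) (gam n)) _ _ t1)
  (ccvgZ _ (rf (tau n) (s n.+1)) _ _ (ccvg_sum _ K _ _ (fun l => ccvgZ _ (Acoef (bt n) (gam n) (tau n) l (s n.+1)) _ _ (t2 l)))))
  (Rem_cvg n K s HK).
apply: ccvg_eq => M; rewrite /box -!bsZ.
under eq_bigr do rewrite -bsZ.
rewrite -bs_sum -bsZ -!bsD; apply: bs_eq => m.
by rewrite (termS_expand n K).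
Qed.

(** Where the remainder of order K converges, so does the telescoped series of index K, which may
    then be split off from it. *)
Lemma stepKS K s : region n.+1 K s -> stepK K s = stepK K.+1 s.
Proof.
move=> H; have H1 := regionW _ _ _ _ (leqnSn K) H.
have [r w0] : region n 0 (upd s n (s n.+1 + K%:R)) /\ 0 < Re (s n.+1 + K%:R).
  by apply: region_upd H _; rewrite ReD Re_nat; lra.
have t := tele_cvg _ _ r w0.
set a := rf (tau n) (s n.+1) * Acoef (bt n) (gam n) (tau n) K (s n.+1).
have e : Rem n K s = a * E (upd s n (s n.+1 + K%:R)) + Rem n K.+1 s.
  apply: ccvg_unique (Rem_cvg n K s H) _.
  have := ccvgD _ _ _ _ _ (ccvgZ _ a _ _ t) (Rem_cvg n K.+1 s H1).
  apply: ccvg_eq => M; rewrite -bsZ -bsD; apply: bs_eq => m.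
  have h := termS_expand n K s m; have := termS_expand n K.+1 s m; rewrite h big_ord_recr /= mulrDr.
  move=> h'; apply: (addrI (qf (tau n) (gam n) * tele n (s n.+1 - 1) s m +
     rf (tau n) (s n.+1) * \sum_(l < K) Acoef (bt n) (gam n) (tau n) l (s n.+1) * tele n (s n.+1 + l%:R) s m)).
  by rewrite h' /a; ring.
by rewrite /stepK e big_ord_recr /= mulrDr /a; ring.
Qed.

Lemma stepK_le K K' s : region n.+1 K s -> (K <= K')%N -> stepK K s = stepK K' s.
Proof.
move=> H /subnKC <-; elim: (K' - K)%N => [|d IH]; first by rewrite addn0.
by rewrite addnS IH stepKS //; apply: regionW H; rewrite leq_addr.
Qed.

(** The value does not depend on the number of terms subtracted. *)
Definition step s : C := stepK (projT1 (cid (region_ex n.+1 s))) s.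

Lemma stepE K s : region n.+1 K s -> step s = stepK K s.
Proof.
rewrite /step; case: cid => K' /= h' h.
by rewrite (stepK_le K' (maxn K K') s h' (leq_maxr _ _)) (stepK_le K (maxn K K') s h (leq_maxl _ _)).
Qed.

End Step.

(** * Holomorphy of the remainder in the exponents *)

Section Holomorphy.
Variables (nn : nat).
Local Notation V := 'rV[C]_nn.

Lemma pf_near (f : V -> C) p (e : R) : pf f -> 0 < e ->
  exists2 r : R, 0 < r & forall v, pdisc p r v -> cmod (f v - f p) <= e.
Proof.
move=> hf e0; have [L L0 HL] := apx_lip R nn p 8 f (ltr0n _ _) (apx_pf _ _ _ _ _ hf).
have L1 : 0 < L + 1 by rewrite ltr_wpDl.
exists (Num.min 1 (e / (L + 1))); first by rewrite lt_min ltr01 divr_gt0.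
move=> v hv; set r := Num.min _ _ in hv.
have r0 : 0 <= r by rewrite le_min ler01 divr_ge0 // ltW.
have r1 : r <= 8 / 8 by rewrite divff // ge_min lexx.
apply: le_trans (HL v p (pdisc_le _ _ _ _ _ _ hv r1) _) _.
  by apply: pdisc_center; rewrite divff // ler01.
have m : maxabs (v - p) <= r by apply: pdisc_maxabs.
apply: le_trans (_ : (L + 1) * (e / (L + 1)) <= _).
  apply: ler_pM => //; rewrite ?maxabs_ge0 ?lerDl // (le_trans m) // ge_min lexx orbT //.
by rewrite mulrCA divff ?mulr1 // gt_eqF.
Qed.

Lemma pf_near_fin (sg : V -> nat -> C) p (e : R) k : (forall j, pf (fun v => sg v j)) -> 0 < e ->
  exists2 r : R, 0 < r & forall j v, (j < k)%N -> pdisc p r v -> cmod (sg v j - sg p j) <= e.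
Proof.
move=> hf e0; elim: k => [|k [r r0 H]]; first by exists 1.
have [r' r'0 H'] := pf_near _ p e (hf k) e0.
exists (Num.min r r') => [|j v]; first by rewrite lt_min r0.
rewrite ltnS leq_eqVlt => /predU1P[->|jk] hv.
  by apply: H'; apply: pdisc_le hv _; rewrite ge_min lexx orbT.
by apply: H => //; apply: pdisc_le hv _; rewrite ge_min lexx.
Qed.

Lemma apx_ff p r (f : V -> C) l : apx p r f -> apx p r (fun v => ff (f v) l).
Proof.
move=> hf; apply: apx_prod => i; apply: apx_add (apx_cst _ _ _ _ _).
by apply: apx_ext (apx_mul _ _ _ _ _ _ (apx_cst _ _ _ _ (- 1)) hf) => v _; rewrite mulN1r.
Qed.

Lemma apx_pw p r (f : V -> C) x : apx p r f -> apx p r (fun v => pw x (f v)).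
Proof.
move=> hf; apply: apx_cexp; apply: apx_mul (apx_cst _ _ _ _ _).
by apply: apx_ext (apx_mul _ _ _ _ _ _ (apx_cst _ _ _ _ (- 1)) hf) => v _; rewrite mulN1r.
Qed.

Lemma apx_addc p r (f : V -> C) a : apx p r f -> apx p r (fun v => f v + a).
Proof. by move=> hf; apply: apx_add hf (apx_cst _ _ _ _ _). Qed.

Lemma apx_rf p r (f : V -> C) t : apx p r f -> apx p r (fun v => rf t (f v)).
Proof.
rewrite /rf; case: eqP => _ hf; last exact: apx_cst.
apply: apx_add (apx_cst _ _ _ _ _) _.
by apply: apx_ext (apx_mul _ _ _ _ _ _ (apx_cst _ _ _ _ (- 1)) hf) => v _; rewrite mulN1r.
Qed.

Lemma apx_Acoef p r (f : V -> C) b g t l : apx p r f -> apx p r (fun v => Acoef b g t l (f v)).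
Proof.
move=> hf; apply: apx_mul (apx_cst _ _ _ _ _); apply: apx_mul (apx_cst _ _ _ _ _) _.
exact: apx_ff.
Qed.

Lemma apx_Tay p r (f : V -> C) L x h : apx p r f -> apx p r (fun v => Tay L (f v) x h).
Proof.
move=> hf; apply: apx_add; first exact: apx_pw.
apply: apx_ext (apx_mul _ _ _ _ _ _ (apx_cst _ _ _ _ (- 1)) (apx_sum _ _ _ _ L
  (fun l v => ff (f v) l / (l`!)%:R * h ^+ l * pw x (f v + l%:R)) _)) => [v _|l]; first by rewrite mulN1r.
apply: apx_mul; last by apply: apx_pw; apply: apx_addc.
by apply: apx_mul (apx_cst _ _ _ _ _); apply: apx_mul (apx_cst _ _ _ _ _); apply: apx_ff.
Qed.

Lemma apx_D p r (f : V -> C) b g t K x : apx p r f -> apx p r (fun v => Dfun b g t K (f v) x).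
Proof.
move=> hf; apply: apx_add.
  by apply: apx_mul; [apply: apx_rf|apply: apx_Tay].
apply: apx_mul (apx_cst _ _ _ _ _) _; apply: apx_add.
  by apply: apx_mul (apx_cst _ _ _ _ _) _; apply: apx_Tay; apply: apx_addc.
apply: apx_mul; first exact: apx_rf.
apply: apx_sum => l; apply: apx_mul; first exact: apx_Acoef.
by apply: apx_Tay; apply: apx_addc.
Qed.

Lemma apx_rterm p r (sg : V -> nat -> C) n K m : (forall j, apx p r (fun v => sg v j)) ->
  apx p r (fun v => rterm n K (sg v) m).
Proof.
move=> hf; apply: apx_mul; last exact: apx_D.
apply: apx_mul (apx_cst _ _ _ _ _); apply: apx_mul (apx_cst _ _ _ _ _) _.
by apply: apx_prod => j; apply: apx_pw.
Qed.

(** A margin e at p leaves e / 2 nearby, so one majorant serves a whole polydisc and the limit is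
    uniform there. *)
Lemma Rem_apx (sg : V -> nat -> C) n K p : (forall j, pf (fun v => sg v j)) ->
  region n.+1 K (sg p) ->
  exists2 r : R, 0 < r & apx p r (fun v => Rem n K (sg v)) /\
    forall v, pdisc p r v -> region n.+1 K (sg v).
Proof.
move=> hf /region_marg [e e0 he].
have e2 : 0 < e / 2 by rewrite divr_gt0.
have n1 : (0 : R) < n.+1%:R by rewrite ltr0n.
(* A tail has at most n + 1 exponents, so its real part moves by at most e / 2; the bound 1 keeps
   the moduli below W + 1. *)
have d0 : 0 < Num.min 1 (e / 2 / n.+1%:R) by rewrite lt_min ltr01 !divr_gt0.
set d := Num.min _ _ in d0.
have [r r0 Hr] := pf_near_fin sg p d n.+2 hf d0.
have [W W0 HW] := fin_bound n.+2 (fun j => cmod (sg p j)).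
have W1 : 0 <= W + 1 by rewrite addr_ge0 // ltW.
have hm v : pdisc p r v -> marg n.+1 K (e / 2) (sg v).
  move=> hv j jn; have := he j jn.
  have -> : \sum_(j <= i < n.+1) Re (sg v i.+1) = \sum_(j <= i < n.+1) Re (sg p i.+1) +
     \sum_(j <= i < n.+1) Re (sg v i.+1 - sg p i.+1).
    by rewrite -big_split /=; apply: eq_bigr => i _; rewrite ReB; ring.
  have : `|\sum_(j <= i < n.+1) Re (sg v i.+1 - sg p i.+1)| <= e / 2.
    apply: le_trans (ler_norm_sum _ _ _) _.
    apply: le_trans (_ : \sum_(j <= i < n.+1) (e / 2 / n.+1%:R) <= _).
      rewrite big_nat_cond [leRHS]big_nat_cond; apply: ler_sum => i /andP[/andP[_ i_n] _].
      apply: le_trans (Re_cmod _ _) _; apply: le_trans (Hr _ _ _ hv) _ => //.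
      by rewrite ge_min lexx orbT.
    rewrite sumr_const_nat.
    have -> : (e / 2 / n.+1%:R) *+ (n.+1 - j) = (e / 2) * ((n.+1 - j)%:R / n.+1%:R).
      by rewrite -[LHS]mulr_natl; ring.
    rewrite ler_piMr ?(ltW e2) // ler_pdivrMr // mul1r ler_nat leq_subr //.
  rewrite ler_norml => /andP[h _] h'.
  have nj : (0 : R) <= (n.+1 - j)%:R by rewrite ler0n.
  have : (n.+1 - j)%:R * (1 + e / 2) <= (n.+1 - j)%:R * (1 + e) by rewrite ler_wpM2l //; lra.
  move: h h'; move: (\sum_(j <= i < n.+1) Re (sg p i.+1)) (\sum_(j <= i < n.+1) Re (_ - _)).
  move: ((n.+1 - j)%:R * (1 + e / 2)) ((n.+1 - j)%:R * (1 + e)) => P1 P2 S1 S2 h1 h2 h3; lra.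
exists r => //; split.
  have [M M0 HM] := rterm_maj n K (W + 1) W1.
  apply: (clim_bs_apx R (qeps R (e / 2)) (1 + (e / 2)^-1) _ _ nn p r n.+1 (fun v => rterm n K (sg v)) M) => //.
  - exact: qeps_ge0.
  - by move=> b; apply: qeps_sum.
  - by move=> m; apply: apx_rterm => j; apply: apx_pf.
  - move=> v m hv; apply: HM => // [j jn|]; last exact: hm.
    have -> : sg v j = sg p j + (sg v j - sg p j) by ring.
    rewrite (le_trans (cmodD _ _ _)) // lerD ?HW // (le_trans (Hr _ _ _ hv)) //.
    by rewrite ge_min lexx.
move=> v /hm h j jn; apply: lt_le_trans (h j jn).
rewrite mulrDr mulr1 -addrA ltrDl ltr_wpDl //.
by rewrite mulr_ge0 // ltW.
Qed.

End Holomorphy.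

End Levels.

Arguments Xf {R} gam c m j.
Arguments term {R} gam c tau n s m.
Arguments box {R} gam c tau n s M.
Arguments upd {R} s n w.
Arguments bt {R} c n.
Arguments xf {R} gam c m n.
Arguments region {R} n K s.
Arguments rterm {R} gam c tau n K s m.
Arguments Rem {R} gam c tau n K s.
Arguments stepK {R} gam c tau n E K s.
Arguments step {R} gam c tau n E s.

(** * Local approximability at a point *)

Section LocalApproximation.
Variable R : realType.
Local Notation C := (C R).
Variable nn : nat.
Local Notation V := 'rV[C]_nn.

Definition locapx (f : V -> C) (p : V) : Prop := exists2 r : R, 0 < r & apx p r f.

Lemma locapx_pf f p : pf f -> locapx f p.
Proof. by exists 1 => //; apply: apx_pf. Qed.

Lemma locapx_cst a p : locapx (fun=> a) p. Proof. exact: locapx_pf (pf_cst _ _ a). Qed.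

Lemma locapx_both f g p : locapx f p -> locapx g p ->
  exists2 r : R, 0 < r & apx p r f /\ apx p r g.
Proof.
move=> [r r0 hr] [s s0 hs]; exists (Num.min r s); first by rewrite lt_min r0.
split; [apply: apx_sub hr|apply: apx_sub hs] => v hv; apply: pdisc_le hv _;
  by rewrite ge_min lexx ?orbT.
Qed.

Lemma locapxD f g p : locapx f p -> locapx g p -> locapx (fun v => f v + g v) p.
Proof. by move=> hf hg; have [r r0 [a b]] := locapx_both _ _ _ hf hg; exists r => //; apply: apx_add. Qed.

Lemma locapxM f g p : locapx f p -> locapx g p -> locapx (fun v => f v * g v) p.
Proof. by move=> hf hg; have [r r0 [a b]] := locapx_both _ _ _ hf hg; exists r => //; apply: apx_mul. Qed.

Lemma locapx_sum n (f : 'I_n -> V -> C) p : (forall i, locapx (f i) p) ->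
  locapx (fun v => \sum_(i < n) f i v) p.
Proof.
elim: n f => [|n IH] f H.
  by have [r r0 h] := locapx_cst 0 p; exists r => //; apply: apx_ext h => v _; rewrite big_ord0.
have [r r0 h] := locapxD _ _ _ (IH _ (fun i => H (widen_ord (leqnSn n) i))) (H ord_max).
by exists r => //; apply: apx_ext h => v _; rewrite big_ord_recr.
Qed.

Lemma locapx_sum_cond n (P : pred 'I_n) (f : 'I_n -> V -> C) p : (forall i, P i -> locapx (f i) p) ->
  locapx (fun v => \sum_(i < n | P i) f i v) p.
Proof.
move=> H; have [|r r0 h] := locapx_sum n (fun i v => if P i then f i v else 0) p.
  by move=> i; case Pi: (P i); [apply: H|apply: locapx_cst].
by exists r => //; apply: apx_ext h => v _; rewrite [RHS]big_mkcond.
Qed.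

Lemma locapx_inv u p : pf u -> u p != 0 -> locapx (fun v => (u v)^-1) p.
Proof.
move=> hu u0; have c0 : 0 < cmod (u p) / 2 by rewrite divr_gt0 // cmod_gt0.
have [r r0 H] := pf_near _ _ _ p _ hu c0; exists r => //.
by apply: apx_inv u0 (apx_pf _ _ _ _ _ hu) H.
Qed.

Lemma locapx_ext f g p (s : R) : 0 < s -> (forall v, pdisc p s v -> f v = g v) ->
  locapx f p -> locapx g p.
Proof.
move=> s0 E [r r0 h]; exists (Num.min r s); first by rewrite lt_min r0.
apply: (apx_ext _ _ _ _ f) => [v hv|].
  by apply: E; apply: pdisc_le hv _; rewrite ge_min lexx orbT.
by apply: apx_sub h => v hv; apply: pdisc_le hv _; rewrite ge_min lexx.
Qed.

Lemma locapx_lip f p : locapx f p -> exists L r : R, [/\ 0 <= L, 0 < r &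
  forall v w, pdisc p r v -> pdisc p r w -> cmod (f v - f w) <= L * maxabs (v - w)].
Proof.
move=> [r r0 /(apx_lip _ _ _ _ _ r0) [L L0 H]].
by exists L, (r / 8); split=> //; rewrite divr_gt0.
Qed.

End LocalApproximation.

Arguments locapx {R nn} f p.

(** * Exact vanishing at nonpositive integers and at 1 *)

Section NegativeIntegers.
Variable R : realType.
Local Notation C := (C R).
Local Notation Re := complex.Re.

Lemma ffN N l : ff (- N%:R : C) l = (N ^_ l)%:R.
Proof.
elim: l => [|l IH]; first by rewrite ff0 ffactn0.
rewrite ffSr IH ffactnSr natrM opprK; have [lN|Nl] := leqP l N; first by rewrite natrB.
by rewrite ffact_small // !mul0r.
Qed.

(** x ^ N is a polynomial of degree N < L, equal to its Taylor sum. *)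
Lemma Tay_negint L N (x h : C) : (N < L)%N -> 0 < Re x -> 0 < Re (x + h) ->
  Tay L (- N%:R) x h = 0.
Proof.
move=> NL x0 xh0; rewrite /Tay pwN_nat // [x + h]addrC [h + x]addrC exprDn.
apply/eqP; rewrite subr_eq0; apply/eqP.
rewrite -(subnKC NL) big_split_ord /= [X in _ = _ + X]big1 ?addr0; last first.
  by move=> i _; rewrite ffN ffact_small ?mul0r // ltnS leq_addr.
apply: eq_bigr => i _; have iN : (i <= N)%N by rewrite -ltnS.
have -> : - N%:R + i%:R = - (N - i)%:R :> C by rewrite natrB //; ring.
rewrite pwN_nat // ffN -bin_ffact natrM mulfK ?fact_neq0 // -[LHS]mulr_natl; ring.
Qed.

(** Each Taylor remainder has order above the degree of its polynomial; for l > N the coefficient, a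
    falling factorial, vanishes instead. *)
Lemma Dfun_negint K N (b g x : C) : (N < K)%N -> 0 < Re x -> 0 < Re (x + b) -> 0 < Re (x + g) ->
  Dfun b g 1 K (- N%:R) x = 0.
Proof.
move=> NK x0 xb xg; rewrite /Dfun Tay_negint // mulr0 add0r mul1r.
have -> : - N%:R - 1 = - N.+1%:R :> C by rewrite -natr1; ring.
rewrite Tay_negint // mulr0 add0r big1 ?mulr0 // => l _.
have [lN|Nl] := leqP l N.
  have -> : - N%:R + l%:R = - (N - l)%:R :> C by rewrite natrB //; ring.
  by rewrite Tay_negint ?mulr0 // ltn_sub2r // (leq_ltn_trans lN).
by rewrite /Acoef ffN ffact_small // mulr0 !mul0r.
Qed.

(** [rf] vanishes at s = 1, and the leading term is then the constant x ^ 0. *)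
Lemma Dfun_one K (b g x : C) : 0 < Re x -> 0 < Re (x + g) -> Dfun b g 1 K 1 x = 0.
Proof.
move=> x0 xg; rewrite /Dfun /rf eqxx subrr !mul0r add0r addr0 mul1r.
by have := Tay_negint K.+1 0 x g isT x0 xg; rewrite oppr0 => ->; rewrite mulr0.
Qed.

End NegativeIntegers.

(** * The factor epsilon *)

Section EpsilonFactor.
Variable R : realType.
Local Notation C := (C R).
Variables L M : nat.

(** The normalised binomial factor [binom (L - d) (L + M + 1)], which vanishes
    at [d = 0] to first order. *)
Definition epsf (d : C) : C := (- 1) ^+ M.+1 / (L`!%:R * M`!%:R) * ff (- L%:R + d) (L + M).+1.

Let g (d : C) : C := (- 1) ^+ M / (L`!%:R * M`!%:R) * (ff (- L%:R + d) L * ff (1 + d) M).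

Lemma epsf_g d : epsf d = d * g d.
Proof.
rewrite /epsf /g -addnS -ff_add ffS.
have -> : - L%:R + d + L%:R = d :> C by ring.
by rewrite [d + 1]addrC exprS; ring.
Qed.

Lemma g0 : g 0 = 1.
Proof.
rewrite /g !addr0 ffN ffactnn.
have -> : ff (1 : C) M = (- 1) ^+ M * M`!%:R.
  elim: M => [|n IH]; first by rewrite ff0 fact0 mulr1.
  by rewrite ffSr IH factS natrM exprS -natr1; ring.
have h : ((- 1) ^+ M * (- 1) ^+ M : C) = 1 by rewrite -exprMn mulrNN mulr1 expr1n.
have -> : (- 1) ^+ M / (L`!%:R * M`!%:R) * (L`!%:R * ((- 1) ^+ M * M`!%:R)) =
  ((- 1) ^+ M * (- 1) ^+ M) * (L`!%:R * M`!%:R / (L`!%:R * M`!%:R)) :> C by ring.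
by rewrite h divff ?mulr1 // mulf_neq0 ?fact_neq0.
Qed.

(** The cofactor [g] of d is polynomial with value 1 at 0, hence 1 + O(d); rows of length 1 bring it
    under [locapx_lip]. *)
Lemma epsf_asymp : exists ce ee : R, [/\ 0 < ce, 0 < ee &
  forall d : C, cmod d < ee -> cmod (epsf d - d) <= ce * cmod d ^+ 2].
Proof.
have lg : locapx (fun v : 'rV[C]_1 => g (v ord0 ord0)) 0.
  exists 1 => //; apply: apx_mul (apx_cst _ _ _ _ _) _; apply: apx_mul.
    apply: apx_ff; apply: apx_pf; apply: pf_add (pf_cst _ _ _) _; exact: pf_coord.
  apply: apx_ff; apply: apx_pf; apply: pf_add (pf_cst _ _ _) _; exact: pf_coord.
have [Lp [r [Lp0 r0 H]]] := locapx_lip _ _ _ _ lg.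
exists (Lp + 1), r; split=> // [|d dr]; first by rewrite ltr_wpDl.
have := H (const_mx d) 0; rewrite subr0 !mxE g0 => h.
have md : maxabs (const_mx d : 'rV[C]_1) = cmod d.
  by rewrite /maxabs big_ord_recl big_ord0 mxE max_l // cmod_ge0.
have -> : epsf d - d = d * (g d - 1) by rewrite epsf_g; ring.
rewrite cmodM expr2 mulrA [leRHS]mulrC; apply: ler_wpM2l; first exact: cmod_ge0.
apply: le_trans (h _ _) _; last by rewrite md ler_wpM2r ?cmod_ge0 // lerDl.
  by move=> j; rewrite !mxE subr0 ltW.
by apply: pdisc_center; apply: ltW.
Qed.

End EpsilonFactor.

Arguments epsf {R} L M d.

Section SequenceOfVector.
Variable R : realType.
Local Notation C := (C R).

(** The coordinates move up by one; the exponent 0 at index 0 makes the auxiliary power of [c 0]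
    equal to 1. *)
Definition sl n (v : 'rV[C]_n) : nat -> C := fun j => if j is j'.+1 then sv v j' else 0.

Lemma pf_sv n j : pf (fun v : 'rV[C]_n => sv v j).
Proof. by rewrite /sv; case: insubP => [i _ _|_]; [apply: pf_coord|apply: pf_cst]. Qed.

Lemma pf_sl n j : pf (fun v : 'rV[C]_n => sl n v j).
Proof. by case: j => [|j]; [apply: pf_cst|apply: pf_sv]. Qed.

Lemma svE n (v : 'rV[C]_n) j (h : (j < n)%N) : sv v j = v ord0 (Ordinal h).
Proof. by rewrite /sv insubT. Qed.

Lemma sv_ord n (v : 'rV[C]_n) (i : 'I_n) : sv v i = v ord0 i.
Proof. by rewrite (svE _ _ _ (ltn_ord i)); congr (v _ _); apply: val_inj. Qed.

Lemma sv_row n (f : nat -> C) j : (j < n)%N -> sv (\row_(i < n) f i) j = f j.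
Proof. by move=> h; rewrite (svE _ _ _ h) mxE. Qed.

Lemma sv0 n j : sv (0 : 'rV[C]_n) j = 0.
Proof. by rewrite /sv; case: insubP => [i _ _|//]; rewrite mxE. Qed.

Lemma sv_maxabs n (v : 'rV[C]_n) j : cmod (sv v j) <= maxabs v.
Proof.
rewrite /sv; case: insubP => [i _ _|_]; first exact: le_maxabs.
by rewrite cmod0 maxabs_ge0.
Qed.

End SequenceOfVector.

Arguments sl {R n} v.

(** * Continuation through the twisted and the two untwisted levels *)

Section Continuation.
Variable R : realType.
Local Notation C := (C R).
Local Notation Re := complex.Re.
Local Notation Im := complex.Im.
Implicit Types (s : nat -> C) (m : nat -> nat).
Variables (gam c tau : nat -> C).
Hypothesis gam0 : forall j, 0 < Re (gam j).
Hypothesis c0 : forall j, 0 < Re (c j).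
Hypothesis tau1 : forall j, cmod (tau j) <= 1.

Local Notation box_ := (box gam c tau).
Local Notation step_ := (step gam c tau).
Local Notation stepK_ := (stepK gam c tau).
Local Notation Rem_ := (Rem gam c tau).
Local Notation rterm_ := (rterm gam c tau).

Definition depends n (E : (nat -> C) -> C) : Prop :=
  forall s s', (forall j, (j <= n)%N -> s j = s' j) -> E s = E s'.

Definition converges n (E : (nat -> C) -> C) : Prop :=
  forall s, region n 0 s -> ccvg (box_ n s) (E s).

Lemma rterm_eq n K s s' m : (forall j, (j <= n.+1)%N -> s j = s' j) ->
  rterm_ n K s m = rterm_ n K s' m.
Proof.
move=> H; rewrite /rterm (term_eq _ _ _ _ _ s s') => [|j jn]; last by rewrite H // ltnW.
by rewrite H.
Qed.

Lemma Rem_eq n K s s' : (forall j, (j <= n.+1)%N -> s j = s' j) -> Rem_ n K s = Rem_ n K s'.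
Proof.
move=> H; rewrite /Rem; congr clim; apply/funext => M; apply: bs_eq => m; exact: rterm_eq.
Qed.

Lemma depends_step n E : converges n E -> depends n E -> depends n.+1 (step_ n E).
Proof.
move=> HE hE s s' H; have [K hK] := region_ex R n.+1 s.
have hK' : region n.+1 K s' by apply: region_eq hK => j /andP[_ jn]; apply: H.
have U w w' : w = w' -> E (upd s n w) = E (upd s' n w').
  by move=> <-; apply: hE => j jn; rewrite /upd; case: eqP => _; rewrite H // ltnW.
rewrite (stepE _ gam c tau gam0 c0 tau1 n E HE K s hK) (stepE _ gam c tau gam0 c0 tau1 n E HE K s' hK').
rewrite /stepK (Rem_eq n K s s' H) (U (s n.+1 - 1) (s' n.+1 - 1)) ?H //; congr (_ + _ * _ + _).
by apply: eq_bigr => l _; rewrite (U (s' n.+1 + l%:R) (s' n.+1 + l%:R)).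
Qed.

(** Holomorphy is asked of E only at the shifted exponents that occur, so that E may have poles
    elsewhere. *)
Lemma step_locapx nn (sg : 'rV[C]_nn -> nat -> C) p n E : converges n E ->
  (forall j, pf (fun v => sg v j)) ->
  locapx (fun v => E (upd (sg v) n (sg v n.+1 - 1))) p ->
  (forall l, locapx (fun v => E (upd (sg v) n (sg v n.+1 + l%:R))) p) ->
  locapx (fun v => step_ n E (sg v)) p.
Proof.
move=> HE hsg h1 h2; have [K hK] := region_ex R n.+1 (sg p).
have [r r0 [hR hreg]] := Rem_apx R gam c tau gam0 c0 tau1 nn sg n K p hsg hK.
apply: (locapx_ext _ _ (fun v => stepK_ n E K (sg v)) _ p r r0) => [v /hreg h|].
  by rewrite (stepE _ gam c tau gam0 c0 tau1 n E HE K).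
apply: locapxD; last by exists r.
apply: locapxD; first by apply: locapxM (locapx_cst _ _ _ _) _.
apply: locapxM.
  by exists 1 => //; apply: apx_rf; apply: apx_pf.
apply: locapx_sum => l; apply: locapxM => //.
by exists 1 => //; apply: apx_Acoef; apply: apx_pf.
Qed.

Lemma pf_upd nn (sg : 'rV[C]_nn -> nat -> C) n (w : 'rV[C]_nn -> C) :
  (forall j, pf (fun v => sg v j)) -> pf w -> forall j, pf (fun v => upd (sg v) n (w v) j).
Proof. by move=> h hw j; rewrite /upd; case: eqP => // _; apply: pf_add. Qed.

Lemma pf_addc nn (f : 'rV[C]_nn -> C) a : pf f -> pf (fun v => f v + a).
Proof. by move=> h; apply: pf_add h (pf_cst _ _ _). Qed.

Fixpoint Tw n s : C := if n is n'.+1 then step_ n' (Tw n') s else pw (c 0%N) (s 0%N).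

(** Holomorphy along every polynomial substitution of the exponents: a form stable under [upd], in
    any number of variables. *)
Definition entire (E : (nat -> C) -> C) : Prop :=
  forall nn (sg : 'rV[C]_nn -> nat -> C) p, (forall j, pf (fun v => sg v j)) ->
    locapx (fun v => E (sg v)) p.

Lemma entire_step n E : converges n E -> entire E -> entire (step_ n E).
Proof.
move=> HE hE nn sg p hsg; apply: step_locapx => //.
  by apply: hE; apply: pf_upd => //; apply: pf_addc.
by move=> l; apply: hE; apply: pf_upd => //; apply: pf_addc.
Qed.

(** For a twist other than 1, [rf] is 1 and the step itself is the continuation. *)
Lemma TwP n : (forall j, (j < n)%N -> tau j != 1) ->
  [/\ converges n (Tw n), entire (Tw n) & depends n (Tw n)].
Proof.
elim: n => [|n IH] H.
  split=> [s _|nn sg p hsg|s s' hs].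
  - apply: ccvg_eq (ccvg_cst _ (Tw 0 s)) => M.
    by rewrite /box /= /term big_ord0 big_ord1 mul1r /Xf big_ord0 addr0.
  - by exists 1 => //; apply: apx_pw; apply: apx_pf.
  - by rewrite /= hs.
have [HE hE dE] := IH (fun j jn => H j (leq_trans jn (leqnSn n))).
split; [|exact: entire_step|exact: depends_step].
move=> s hs; have [K hK] := region_ex R n.+1 s.
rewrite /= (stepE _ gam c tau gam0 c0 tau1 n _ HE K) //.
apply: ccvg_eq (step_cvg R gam c tau gam0 c0 tau1 n _ HE K s hs) => M.
by rewrite /rf (negbTE (H n (ltnSn n))) mul1r.
Qed.

Lemma converges_untwisted n E : tau n = 1 -> converges n E ->
  converges n.+1 (fun s => step_ n E s / (1 - s n.+1)).
Proof.
move=> tn HE s hs; have [K hK] := region_ex R n.+1 s.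
have s1 : 1 - s n.+1 != 0.
  rewrite subr_eq0; apply/eqP => e; have := hs n (ltnSn n).
  by rewrite subSnn big_nat1 -e /= addr0 ltxx.
rewrite (stepE _ gam c tau gam0 c0 tau1 n _ HE K) // mulrC.
apply: ccvg_eq (ccvgZ _ (1 - s n.+1)^-1 _ _ (step_cvg R gam c tau gam0 c0 tau1 n _ HE K s hs)) => M.
by rewrite /rf tn eqxx mulrA mulVf // mul1r.
Qed.

Lemma Rem0 n K s : (forall m, rterm_ n K s m = 0) -> Rem_ n K s = 0.
Proof.
move=> H; apply: climP; apply: ccvg_eq (ccvg_cst _ 0) => M.
by rewrite -(bs0 R (bnd M) n.+1); apply: bs_eq => m; rewrite H.
Qed.

Lemma xf_pos n m : [/\ 0 < Re (xf gam c m n), 0 < Re (xf gam c m n + bt c n) &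
  0 < Re (xf gam c m n + gam n)].
Proof.
have [k [K [k0 K0 _ H]]] := sect_all R gam c gam0 c0 n; have [h1 h2 h3] := H m.
by split; apply: (sect_Re _ _ _ _ _ k0 (Yf_ge1 R m n.+1)); eassumption.
Qed.

Lemma Rem_negint n K s N : tau n = 1 -> s n.+1 = - N%:R -> (N < K)%N -> Rem_ n K s = 0.
Proof.
move=> tn sn NK; apply: Rem0 => m; have [h1 h2 h3] := xf_pos n m.
by rewrite /rterm tn sn Dfun_negint ?mulr0.
Qed.

(** Only the leading term survives at s_(n+1) = 1; up to sign this is the residue of the untwisted
    level. *)
Lemma step_one n E s : tau n = 1 -> converges n E -> depends n E -> s n.+1 = 1 ->
  step_ n E s = - (gam n)^-1 * E s.
Proof.
move=> tn HE dE sn; have [K hK] := region_ex R n.+1 s.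
rewrite (stepE _ gam c tau gam0 c0 tau1 n _ HE K) // /stepK tn sn /rf eqxx subrr mul0r addr0.
rewrite Rem0 ?addr0 /qf ?eqxx; last first.
  by move=> m; have [h1 h2 h3] := xf_pos n m; rewrite /rterm tn sn Dfun_one ?mulr0.
by congr (_ * _); apply: dE => j jn; rewrite /upd; case: eqP => [->|//]; rewrite addr0.
Qed.

Variable k : nat.
Hypothesis tau_tw : forall j, (j < k)%N -> tau j != 1.
Hypothesis tauk : tau k = 1.
Hypothesis tauk1 : tau k.+1 = 1.

(** Here k = n - 2. Up to the factor mu_1 from the shift of m_1, [Zfun] is the (n-1)-fold function
    and [Ffun] the n-fold one; [Ufun] and [Gfun] are their numerators. [Ufun] is entire, while
    [Gfun] inherits poles of [Zfun] at s_(n-1) + s_n + l = 1 with l >= -1. *)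
Definition Ufun s : C := step_ k (Tw k) s.
Definition Zfun s : C := Ufun s / (1 - s k.+1).
Definition Gfun s : C := step_ k.+1 Zfun s.
Definition Ffun s : C := Gfun s / (1 - s k.+2).

Lemma Ufun_entire : entire Ufun.
Proof. by have [h1 h2 _] := TwP k tau_tw; apply: entire_step. Qed.

Lemma Ufun_depends : depends k.+1 Ufun.
Proof. by have [h1 _ h2] := TwP k tau_tw; apply: depends_step. Qed.

Lemma Ufun_one s : s k.+1 = 1 -> Ufun s = - (gam k)^-1 * Tw k s.
Proof. by have [h1 _ h2] := TwP k tau_tw; apply: step_one. Qed.

Lemma Zfun_converges : converges k.+1 Zfun.
Proof. by have [h1 _ h2] := TwP k tau_tw; apply: converges_untwisted. Qed.

Lemma Zfun_depends : depends k.+1 Zfun.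
Proof. by move=> s s' H; rewrite /Zfun (Ufun_depends s s') // H. Qed.

Lemma Ffun_converges : converges k.+2 Ffun.
Proof. exact: converges_untwisted Zfun_converges. Qed.

Lemma Zfun_locapx nn (sg : 'rV[C]_nn -> nat -> C) p : (forall j, pf (fun v => sg v j)) ->
  sg p k.+1 != 1 -> locapx (fun v => Zfun (sg v)) p.
Proof.
move=> hsg h; apply: locapxM; first exact: Ufun_entire.
apply: locapx_inv; first by apply: pf_add (pf_cst _ _ _) _; apply: pf_opp.
by rewrite subr_eq0 eq_sym.
Qed.

(** The conditions exclude, in turn, the zero of the final divisor, the pole of the leading term
    (exponent s_n - 1) and those of the terms with exponent s_n + l. *)
Lemma Ffun_locapx nn (sg : 'rV[C]_nn -> nat -> C) p : (forall j, pf (fun v => sg v j)) ->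
  sg p k.+2 != 1 -> sg p k.+1 + sg p k.+2 != 2 ->
  (forall l, sg p k.+1 + sg p k.+2 != 1 - l%:R) -> locapx (fun v => Ffun (sg v)) p.
Proof.
move=> hsg h1 h2 h3; apply: locapxM; last first.
  apply: locapx_inv; first by apply: pf_add (pf_cst _ _ _) _; apply: pf_opp.
  by rewrite subr_eq0 eq_sym.
apply: (step_locapx _ _ _ _ _ Zfun_converges hsg).
  apply: Zfun_locapx; first by apply: pf_upd => //; apply: pf_addc.
  rewrite /upd eqxx addrA subr_eq; apply: contra_neq h2 => ->; ring.
move=> l; apply: Zfun_locapx; first by apply: pf_upd => //; apply: pf_addc.
by rewrite /upd eqxx addrA; apply: contra_neq (h3 l) => e; rewrite -[X in _ = X - _]e; ring.
Qed.

(** Clears the finitely many poles that meet [region k.+2 K]. *)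
Definition hden K s : C := (1 - s k.+2) *
  ((2 - (s k.+1 + s k.+2)) * \prod_(l < K) (1 - l%:R - (s k.+1 + s k.+2))).

(** [Ffun] times [hden], with the linear factor under each [Zfun] already cancelled, so that only
    [Ufun], polynomials and the remainder are left. *)
Definition gnum K s : C :=
  - (gam k.+1)^-1 * Ufun (upd s k.+1 (s k.+2 - 1)) * (\prod_(l < K) (1 - l%:R - (s k.+1 + s k.+2)))
  + (1 - s k.+2) * (\sum_(l < K) Acoef (bt c k.+1) (gam k.+1) 1 l (s k.+2) * Ufun (upd s k.+1 (s k.+2 + l%:R))
       * ((2 - (s k.+1 + s k.+2)) * \prod_(i < K | i != l) (1 - i%:R - (s k.+1 + s k.+2))))
  + Rem_ k.+1 K s * ((2 - (s k.+1 + s k.+2)) * \prod_(l < K) (1 - l%:R - (s k.+1 + s k.+2))).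

Lemma gnumE K s : region k.+2 K s -> s k.+2 != 1 -> s k.+1 + s k.+2 != 2 ->
  (forall l : nat, s k.+1 + s k.+2 != 1 - l%:R) -> Ffun s * hden K s = gnum K s.
Proof.
move=> hK h1 h2 h3.
have n1 : 1 - s k.+2 != 0 by rewrite subr_eq0 eq_sym.
have n2 : 2 - (s k.+1 + s k.+2) != 0 by rewrite subr_eq0 eq_sym.
have n3 (l : nat) : 1 - l%:R - (s k.+1 + s k.+2) != 0 by rewrite subr_eq0 eq_sym.
rewrite /Ffun /Gfun (stepE _ gam c tau gam0 c0 tau1 k.+1 _ Zfun_converges K) // /stepK tauk1.
rewrite /hden [LHS]mulrA mulfVK // /rf eqxx /qf eqxx /gnum [LHS]mulrDl [X in X + _ = _]mulrDl; congr (_ + _ + _).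
  rewrite /Zfun {2}/upd eqxx.
  have -> : 1 - (s k.+1 + (s k.+2 - 1)) = 2 - (s k.+1 + s k.+2) by ring.
  have aux (x y d z : C) : d != 0 -> x * (y / d) * (d * z) = x * y * z by move=> d0; field.
  exact: aux.
rewrite -mulrA; congr (_ * _); rewrite mulr_suml; apply: eq_bigr => l _.
rewrite /Zfun {2}/upd eqxx (bigD1 l) //=.
have -> : 1 - (s k.+1 + (s k.+2 + l%:R)) = 1 - l%:R - (s k.+1 + s k.+2) by ring.
have aux (x y f d z : C) : f != 0 -> x * (y / f) * (d * (f * z)) = x * y * (d * z).
  by move=> d0; field.
exact: aux.
Qed.

Lemma pf_prod nn n (P : pred 'I_n) (f : 'I_n -> 'rV[C]_nn -> C) : (forall i, pf (f i)) ->
  pf (fun v => \prod_(i < n | P i) f i v).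
Proof.
move=> H; elim: n P f H => [|n IH] P f H; first by apply: pf_eq (pf_cst _ _ 1) => v; rewrite big_ord0.
have h := IH (fun i => P (widen_ord (leqnSn n) i)) _ (fun i => H (widen_ord (leqnSn n) i)).
have hl : pf (fun v => if P ord_max then f ord_max v else 1).
  by case: (P _) => //; apply: pf_cst.
apply: pf_eq (pf_mul _ _ _ _ h hl) => v; rewrite [RHS]big_mkcond big_ord_recr /= -big_mkcond //.
Qed.

Lemma pf_fac nn (sg : 'rV[C]_nn -> nat -> C) a : (forall j, pf (fun v => sg v j)) ->
  pf (fun v => a - (sg v k.+1 + sg v k.+2)).
Proof. by move=> h; apply: pf_add (pf_cst _ _ _) _; apply: pf_opp; apply: pf_add. Qed.

Lemma hden_pf nn (sg : 'rV[C]_nn -> nat -> C) K : (forall j, pf (fun v => sg v j)) ->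
  pf (fun v => hden K (sg v)).
Proof.
move=> h; apply: pf_mul; first by apply: pf_add (pf_cst _ _ _) _; apply: pf_opp.
by apply: pf_mul; [apply: pf_fac|apply: pf_prod => i; apply: pf_fac].
Qed.

Lemma gnum_locapx nn (sg : 'rV[C]_nn -> nat -> C) K p : (forall j, pf (fun v => sg v j)) ->
  region k.+2 K (sg p) -> locapx (fun v => gnum K (sg v)) p.
Proof.
move=> h hK; have [r r0 [hR _]] := Rem_apx R gam c tau gam0 c0 tau1 nn sg k.+1 K p h hK.
have u w : pf w -> locapx (fun v => Ufun (upd (sg v) k.+1 (w v))) p.
  by move=> hw; apply: Ufun_entire; apply: pf_upd.
have pr (P : pred 'I_K) : pf (fun v => \prod_(i < K | P i) (1 - i%:R - (sg v k.+1 + sg v k.+2))).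
  by apply: pf_prod => i; apply: pf_fac.
apply: locapxD; last first.
  apply: locapxM; first by exists r.
  by apply: locapx_pf; apply: pf_mul; [apply: pf_fac|apply: pr].
apply: locapxD.
  apply: locapxM; last by apply: locapx_pf; apply: pr.
  by apply: locapxM (locapx_cst _ _ _ _) _; apply: u; apply: pf_addc.
apply: locapxM; first by apply: locapx_pf; apply: pf_add (pf_cst _ _ _) _; apply: pf_opp.
apply: locapx_sum => l; apply: locapxM.
  apply: locapxM; first by exists 1 => //; apply: apx_Acoef; apply: apx_pf.
  by apply: u; apply: pf_addc.
by apply: locapx_pf; apply: pf_mul; [apply: pf_fac|apply: (pr (fun i => i != l))].
Qed.

(** * Asymptotics at nonpositive integers *)

Section Asymptotics.
Variable N : nat -> nat.
Local Notation M := (N k).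
Local Notation L := (N k.+1).
Local Notation ls := (M + L).+1.
Local Notation g := (gam k.+1).
Local Notation V := 'rV[C]_k.+2.

Definition sN (d : V) : nat -> C := fun j => if j is j'.+1 then - (N j')%:R + sv d j' else 0.

(** The value of the Hurwitz zeta-function at - l; see [bern_hurwitz]. *)
Definition bern l : C := l`!%:R * pc 1 (bt c k.+1 / g) l.

Lemma pf_sN j : pf (fun d => sN d j).
Proof. by case: j => [|j]; [apply: pf_cst|apply: pf_add (pf_cst _ _ _) _; apply: pf_sv]. Qed.

Lemma sN0 j : sN 0 j.+1 = - (N j)%:R. Proof. by rewrite /= sv0 addr0. Qed.

(** All of [Ffun] except the term of index N_(n-1) + N_n + 1, the one whose polar hyperplane passes
    through delta = 0. *)
Definition regpart K (d : V) : C :=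
  - g^-1 / (1 - sN d k.+2) * Zfun (upd (sN d) k.+1 (sN d k.+2 - 1)) +
  (\sum_(l < K | l != ls :> nat) Acoef (bt c k.+1) g 1 l (sN d k.+2) * Zfun (upd (sN d) k.+1 (sN d k.+2 + l%:R))
   + Rem_ k.+1 K (sN d) / (1 - sN d k.+2)).

Lemma one_sN_neq0 : 1 - sN (0 : V) k.+2 != 0.
Proof. by rewrite sN0 opprK addrC natr1 natC_neq0. Qed.

Lemma pf_one_sN : pf (fun d : V => 1 - sN d k.+2).
Proof. by apply: pf_add (pf_cst _ _ _) _; apply: pf_opp; apply: pf_sN. Qed.

Lemma regpart_locapx K : region k.+2 K (sN 0) -> locapx (regpart K) 0.
Proof.
move=> hK; have [r r0 [hR _]] := Rem_apx R gam c tau gam0 c0 tau1 _ sN k.+1 K 0 pf_sN hK.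
have inv1 : locapx (fun d : V => (1 - sN d k.+2)^-1) 0.
  exact: locapx_inv pf_one_sN one_sN_neq0.
(* At delta = 0 the last exponent is w 0 - M; it equals 1 exactly when w 0 = ls - L. *)
have Zl (w : V -> C) : pf w -> w 0 - (M + L).+1%:R + L%:R != 0 ->
   locapx (fun d : V => Zfun (upd (sN d) k.+1 (w d))) 0.
  move=> hw h; apply: Zfun_locapx; first by apply: pf_upd => // j; apply: pf_sN.
  rewrite /upd eqxx sN0; apply: contra_neq h => e.
  by rewrite -natr1 natrD -[X in _ - (_ + X)]e; ring.
apply: locapxD.
  apply: locapxM; first by apply: locapxM inv1; apply: locapx_cst.
  apply: Zl; first by apply: pf_addc; apply: pf_sN.
  rewrite sN0; have -> : - L%:R - 1 - (M + L).+1%:R + L%:R = - ((M + L).+2%:R) :> C.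
    by rewrite -[(M + L).+2%:R]natr1; ring.
  by rewrite oppr_eq0 natC_neq0.
apply: locapxD.
  apply: locapx_sum_cond => l hl; apply: locapxM.
    by exists 1 => //; apply: apx_Acoef; apply: apx_pf; apply: pf_sN.
  apply: Zl; first by apply: pf_addc; apply: pf_sN.
  rewrite sN0; have -> : - L%:R + l%:R - (M + L).+1%:R + L%:R = l%:R - (M + L).+1%:R :> C by ring.
  apply: contraNneq hl => /(congr1 (@complex.Re R)); rewrite ReB !Re_nat => /eqP.
  by rewrite subr_eq0 eqr_nat.
by apply: locapxM inv1; exists r.
Qed.

Lemma Acoef_neg l : Acoef (bt c k.+1) g 1 l (- L%:R) = 'C(L, l)%:R * bern l * g ^+ l.
Proof. by rewrite /Acoef ffN /bern -bin_ffact natrM; ring. Qed.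

(** The remainder vanishes exactly at s_n = - L with L < K, and the binomial coefficients stop the
    sum at L, before the excluded index. *)
Lemma regpart0 K : (ls < K)%N -> regpart K 0 =
  - (L.+1%:R)^-1 * Zfun (upd (sN 0) k.+1 (- L%:R - 1)) * g^-1 +
  \sum_(l < L.+1) 'C(L, l)%:R * Zfun (upd (sN 0) k.+1 (- L%:R + l%:R)) * bern l * g ^+ l.
Proof.
move=> lK; have LK : (L < K)%N by apply: leq_ltn_trans lK; rewrite (leq_trans (leq_addl M L)).
rewrite /regpart (Rem_negint _ _ _ L tauk1 (sN0 _) LK) mul0r addr0 !sN0.
congr (_ + _); first by rewrite opprK [1 + _]addrC natr1; ring.
rewrite -(subnKC LK) big_split_ord /= [X in _ + X]big1 ?addr0; last first.
  by move=> i _; rewrite Acoef_neg bin_small ?ltnS ?leq_addr // !mul0r.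
rewrite [LHS]big_mkcond /=; apply: eq_bigr => i _.
have -> : (i != ls :> nat) by rewrite ltn_eqF // (leq_trans (ltn_ord i)) // ltnS leq_addl.
by rewrite Acoef_neg; ring.
Qed.

Lemma Ffun_split K d : region k.+2 K (sN d) -> (ls < K)%N -> 1 - sN d k.+2 != 0 ->
  Ffun (sN d) = regpart K d +
    Acoef (bt c k.+1) g 1 ls (sN d k.+2) * Zfun (upd (sN d) k.+1 (sN d k.+2 + ls%:R)).
Proof.
move=> hK lK h; rewrite /Ffun /Gfun (stepE _ gam c tau gam0 c0 tau1 k.+1 _ Zfun_converges K) //.
rewrite /stepK tauk1 /rf eqxx /qf eqxx /regpart (bigD1 (Ordinal lK)) //=.
have aux (q z r a S m : C) : r != 0 -> (q * z + r * (a + S) + m) / r = q / r * z + (S + m / r) + a.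
  by move=> r0; field.
exact: aux.
Qed.

Lemma Acoef_epsf (d : V) : Acoef (bt c k.+1) g 1 ls (sN d k.+2) =
  (- 1) ^+ M.+1 * L`!%:R * M`!%:R / ls`!%:R * epsf L M (sv d k.+1) * bern ls * g ^+ ls.
Proof.
have h : ((- 1) ^+ M.+1 * (- 1) ^+ M.+1 : C) = 1 by rewrite -exprMn mulrNN mulr1 expr1n.
have f1 := fact_neq0 R L; have f2 := fact_neq0 R M; have f3 := fact_neq0 R ls.
rewrite /Acoef /bern /epsf /= [(L + M)%N]addnC.
move: (ff _ _) (pc _ _ _) (g ^+ _) => x y z.
have -> : (-1) ^+ M.+1 * L`!%:R * M`!%:R / ls`!%:R *
  ((-1) ^+ M.+1 / (L`!%:R * M`!%:R) * x) * (ls`!%:R * y) * z =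
  ((- 1) ^+ M.+1 * (- 1) ^+ M.+1) * ((L`!%:R * M`!%:R) / (L`!%:R * M`!%:R)) * (ls`!%:R / ls`!%:R) * (y * x * z) by ring.
by rewrite h !divff ?mulf_neq0 // !mul1r.
Qed.

(** The last exponent becomes a free variable x, which can be set to the polar value 1 while the
    others stay at - N + d. *)
Let vrow (d : V) (x : C) : 'rV[C]_k.+1 := \row_(j < k.+1) (if (j < k)%N then sN d j.+1 else x).

Lemma vrow_lt d x j : (j < k)%N -> sl (vrow d x) j.+1 = sN d j.+1.
Proof. move=> jk; have := sv_row R k.+1 (fun i => if (i < k)%N then sN d i.+1 else x) j (ltnW jk).
by rewrite /= jk. Qed.

Lemma vrow_k d x : sl (vrow d x) k.+1 = x.
Proof. have := sv_row R k.+1 (fun i => if (i < k)%N then sN d i.+1 else x) k (ltnSn k).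
by rewrite /= ltnn. Qed.

Lemma Ufun_vrow d w : Ufun (upd (sN d) k.+1 w) = Ufun (sl (vrow d (sN d k.+1 + w))).
Proof.
apply: Ufun_depends => j; rewrite leq_eqVlt => /predU1P[->|].
  by rewrite vrow_k /upd eqxx.
case: j => [|j]; first by rewrite /upd.
by rewrite !ltnS => jk; rewrite vrow_lt // /upd eqSS ltn_eqF.
Qed.

Lemma Ufun_vrow1 d : Ufun (sl (vrow d 1)) = - (gam k)^-1 * Tw k (sN d).
Proof.
rewrite Ufun_one ?vrow_k //; congr (_ * _); have [_ _ dT] := TwP k tau_tw; apply: dT.
by case=> [//|j] jk; rewrite vrow_lt.
Qed.

(** One Lipschitz bound around the row with d = 0 and last entry 1 serves all small d at once. *)
Lemma Ufun_lip : exists L1 r1 : R, [/\ 0 <= L1, 0 < r1 &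
  forall d w, maxabs d <= r1 -> cmod w <= r1 ->
    cmod (Ufun (sl (vrow d (1 + w))) - Ufun (sl (vrow d 1))) <= L1 * cmod w].
Proof.
have lU : locapx (fun v : 'rV[C]_k.+1 => Ufun (sl v)) (vrow 0 1).
  by apply: Ufun_entire => j; apply: pf_sl.
have [L1 [r1 [L10 r10 H]]] := locapx_lip _ _ _ _ lU.
have pd d w : maxabs d <= r1 -> cmod w <= r1 -> pdisc (vrow 0 1) r1 (vrow d (1 + w)).
  move=> hd hw j; rewrite !mxE; case: ifP => jk.
    rewrite /sN sv0 addr0 addrAC subrr add0r; exact: le_trans (sv_maxabs _ _ _ _) hd.
  by rewrite addrAC subrr add0r.
exists L1, r1; split=> // d w hd hw.
have e1 : vrow d 1 = vrow d (1 + 0) by rewrite addr0.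
have p1 : pdisc (vrow 0 1) r1 (vrow d 1).
  by rewrite e1; apply: pd => //; rewrite cmod0 ltW.
apply: le_trans (H _ _ (pd d w hd hw) p1) _; apply: ler_wpM2l => //.
apply: maxabs_le; first exact: cmod_ge0.
move=> j; rewrite !mxE; case: ifP => jk; first by rewrite subrr cmod0 cmod_ge0.
by rewrite addrAC subrr add0r.
Qed.

Definition singpart (d : V) : C :=
  (- 1) ^+ M.+1 * L`!%:R * M`!%:R / ls`!%:R * (epsf L M (sv d k.+1) / (sv d k + sv d k.+1))
   * Tw k (sN d) * bern ls * (gam k)^-1 * g ^+ ls.

(** With eta = d_(n-1) + d_n, the two expressions share the factor epsilon / eta and differ in
    [Ufun] at 1 + eta against 1. That difference is O(eta), so eta cancels, and epsilon = O(maxabs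
    d) remains. *)
Lemma sing_bound : exists c1 e1 : R, [/\ 0 <= c1, 0 < e1 &
  forall d : V, maxabs d <= e1 -> sv d k + sv d k.+1 != 0 ->
    cmod (Acoef (bt c k.+1) g 1 ls (sN d k.+2) * Zfun (upd (sN d) k.+1 (sN d k.+2 + ls%:R)) - singpart d)
      <= c1 * maxabs d].
Proof.
have [ce [ee [ce0 ee0 He]]] := epsf_asymp R L M.
have [L1 [r1 [L10 r10 HU]]] := Ufun_lip.
pose B : C := (- 1) ^+ M.+1 * L`!%:R * M`!%:R / ls`!%:R * bern ls * g ^+ ls.
(* The bound 1 makes the quadratic error of epsilon linear, ee / 2 yields the strict inequality for
   [epsf_asymp], and r1 / 2 ensures cmod eta <= r1. *)
exists (cmod B * (1 + ce) * L1), (Num.min (Num.min 1 (ee / 2)) (r1 / 2)).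
split; first by rewrite !mulr_ge0 ?cmod_ge0 ?addr_ge0 // ltW.
  by rewrite !lt_min ltr01 !divr_gt0.
move=> d; rewrite !le_min => /andP[/andP[d1 de] dr]; set eta := sv d k + sv d k.+1 => eta0.
have h1 := sv_maxabs _ _ d k; have h2 := sv_maxabs _ _ d k.+1.
have he : cmod eta <= r1 by rewrite (le_trans (cmodD _ _ _)) //; lra.
have dr1 : maxabs d <= r1 by lra.
have lip := HU d eta dr1 he.
have x : sN d k.+1 + (sN d k.+2 + ls%:R) = 1 + eta.
  by rewrite /= /eta -natr1 natrD; ring.
have Zval : Zfun (upd (sN d) k.+1 (sN d k.+2 + ls%:R)) = - (Ufun (sl (vrow d (1 + eta))) / eta).
  have u : upd (sN d) k.+1 (sN d k.+2 + ls%:R) k.+1 = 1 + eta by rewrite -x /upd eqxx.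
  have e1 : 1 - (1 + eta) = - eta by ring.
  by rewrite /Zfun Ufun_vrow x u e1 invrN mulrN.
have e : Acoef (bt c k.+1) g 1 ls (sN d k.+2) * Zfun (upd (sN d) k.+1 (sN d k.+2 + ls%:R)) - singpart d =
   - B * epsf L M (sv d k.+1) * ((Ufun (sl (vrow d (1 + eta))) - Ufun (sl (vrow d 1))) / eta).
  by rewrite Zval Acoef_epsf Ufun_vrow1 /singpart /B -/eta; ring.
have ep : cmod (epsf L M (sv d k.+1)) <= (1 + ce) * maxabs d.
  have lt : cmod (sv d k.+1) < ee by apply: le_lt_trans h2 _; lra.
  have -> : epsf L M (sv d k.+1) = sv d k.+1 + (epsf L M (sv d k.+1) - sv d k.+1) by ring.
  rewrite (le_trans (cmodD _ _ _)) // mulrDl mul1r lerD // (le_trans (He _ lt)) //.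
  rewrite ler_wpM2l ?(ltW ce0) // expr2 -[leRHS]mulr1.
  by apply: ler_pM; rewrite ?cmod_ge0 // (le_trans h2).
rewrite e [cmod (_ * _)]cmodM [cmod (- B * _)]cmodM [cmod (_ / eta)]cmodM cmodN cmodV.
apply: le_trans (_ : cmod B * ((1 + ce) * maxabs d) * (L1 * cmod eta / cmod eta) <= _).
  apply: ler_pM; rewrite ?mulr_ge0 ?invr_ge0 ?cmod_ge0 //.
    by rewrite ler_wpM2l ?cmod_ge0.
  by rewrite ler_wpM2r ?invr_ge0 ?cmod_ge0.
by rewrite mulfK ?cmod_eq0 // le_eqVlt; apply/orP; left; apply/eqP; ring.
Qed.

Lemma Ffun_asymp : exists c2 e2 : R, [/\ 0 < c2, 0 < e2 &
  forall d : V, maxabs d < e2 -> sv d k + sv d k.+1 != 0 ->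
    cmod (Ffun (sN d) -
      (- (L.+1%:R)^-1 * Zfun (upd (sN 0) k.+1 (- L%:R - 1)) * g^-1 +
       \sum_(l < L.+1) 'C(L, l)%:R * Zfun (upd (sN 0) k.+1 (- L%:R + l%:R)) * bern l * g ^+ l
       + singpart d)) <= c2 * maxabs d].
Proof.
(* K exceeds ls, so that the singular term occurs in the finite sum. *)
have [K0 hK0] := region_ex R k.+2 (sN 0); pose K := maxn K0 ls.+1.
have hK : region k.+2 K (sN 0) by apply: regionW hK0; apply: leq_maxl.
have lK : (ls < K)%N by apply: leq_maxr.
have [r r0 [_ hreg]] := Rem_apx R gam c tau gam0 c0 tau1 _ sN k.+1 K 0 pf_sN hK.
have [L0 [r3 [L00 r30 Hreg]]] := locapx_lip _ _ _ _ (regpart_locapx K hK).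
have [c1 [e1 [c10 e10 Hs]]] := sing_bound.
have m0 : 0 < cmod (1 - sN (0 : V) k.+2) / 2 by rewrite divr_gt0 // cmod_gt0 one_sN_neq0.
have [r4 r40 H4] := pf_near _ _ _ 0 _ pf_one_sN m0.
exists (L0 + c1 + 1), (Num.min (Num.min r r3) (Num.min e1 r4)); split.
- by rewrite ltr_wpDl // addr_ge0.
- by rewrite !lt_min r0 r30 e10 r40.
move=> d; rewrite !lt_min => /andP[/andP[dr dr3] /andP[de1 dr4]] eta0.
have pd (s : R) : maxabs d < s -> pdisc (0 : V) s d.
  by move=> h j; rewrite !mxE subr0; apply: le_trans (le_maxabs _ _ _ _) (ltW h).
have one : 1 - sN d k.+2 != 0.
  have := H4 d (pd _ dr4); apply: contraTneq => ->; rewrite sub0r cmodN -ltNge.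
  by rewrite gtr_pMr ?invf_lt1 ?ltr1n // cmod_gt0 one_sN_neq0.
rewrite (Ffun_split K _ (hreg _ (pd _ dr)) lK one).
rewrite -(regpart0 K lK).
have := Hs d (ltW de1) eta0; have := Hreg d 0 (pd _ dr3) (pdisc_center _ _ _ _ (ltW r30)).
rewrite subr0; move: (regpart K d) (regpart K 0) (singpart d).
move: (Acoef (bt c k.+1) g 1 ls (sN d k.+2) * Zfun (upd (sN d) k.+1 (sN d k.+2 + ls%:R))).
move=> x a b y h1 h2.
have -> : a + x - (b + y) = (a - b) + (x - y) by ring.
rewrite (le_trans (cmodD _ _ _)) //.
have := maxabs_ge0 _ _ d; lra.
Qed.

End Asymptotics.

End Continuation.

Arguments Tw {R} gam c tau n s.
Arguments Ufun {R} gam c tau k s.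
Arguments Zfun {R} gam c tau k s.
Arguments Ffun {R} gam c tau k s.
Arguments hden {R} k K s.
Arguments gnum {R} gam c tau k K s.
Arguments sN {R k} N d _.
Arguments bern {R} gam c k l.
Arguments singpart {R} gam c tau k N d.
Arguments converges {R} gam c tau n E.
Arguments entire {R} E.

(** * Passage to the topology of the library; connectedness *)

Section Topology.
Variable R : realType.
Local Notation C := (C R).
Local Notation Re := complex.Re.
Local Notation Im := complex.Im.

Lemma posC_real (e : C) : 0 < e -> exists2 x : R, 0 < x & e = x%:C.
Proof.
move=> e0; have /complex_realP [x hx] : e \is Num.real by rewrite gtr0_real.
by exists x => //; move: e0; rewrite hx ltcR.
Qed.

Lemma ccvg_cvg (u : nat -> C) (l : C) : ccvg u l -> u @ \oo --> l.
Proof.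
move=> h; apply/cvgrPdist_le => e /posC_real [x x0 ->].
have [N HN] := h x x0; exists N => // k /= Nk.
by rewrite normC_cmod lecR cmodBC HN.
Qed.

Lemma nbhs_pdisc n (p : 'rV[C]_n) (P : 'rV[C]_n -> Prop) (r : R) : 0 < r ->
  (forall v, pdisc p r v -> P v) -> \forall v \near p, P v.
Proof.
move=> r0 H; apply/nbhs_normP; exists (r%:C); first by rewrite /= ltcR.
move=> v; rewrite /ball_ /= normV_maxabs ltcR => h; apply: H => j.
rewrite cmodBC; apply: le_trans (ltW h).
by have := le_maxabs _ _ (p - v) j; rewrite !mxE.
Qed.

Lemma near_pdisc n (p : 'rV[C]_n) (P : 'rV[C]_n -> Prop) : (\forall v \near p, P v) ->
  exists2 r : R, 0 < r & forall v, pdisc p r v -> P v.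
Proof.
move=> /nbhs_normP [e /= /posC_real [r r0 ->] H]; exists (r / 2); first by rewrite divr_gt0.
move=> v hv; apply: H; rewrite /ball_ /= normV_maxabs ltcR.
apply: le_lt_trans (_ : r / 2 < r); last by rewrite ltr_pdivrMr // mulr_natr mulr2n ltrDl.
apply: maxabs_le; first by rewrite divr_ge0 // ltW.
by move=> j; rewrite !mxE cmodBC.
Qed.

Lemma open_pdisc n (D : set 'rV[C]_n) :
  (forall p, D p -> exists2 r : R, 0 < r & forall v, pdisc p r v -> D v) -> open D.
Proof.
by move=> H; rewrite openE => p /H [r r0 h]; apply: nbhs_pdisc r0 h.
Qed.

Lemma locapx_differentiable n (f : 'rV[C]_n -> C) p : locapx f p -> differentiable f p.
Proof. by move=> [r r0 h]; apply: apx_differentiable r0 h. Qed.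

Lemma locapx_near n (f : 'rV[C]_n -> C) p : locapx f p -> \forall v \near p, differentiable f v.
Proof.
move=> [r r0 h]; have r2 : 0 < r / 2 by rewrite divr_gt0.
apply: (nbhs_pdisc n p _ _ r2) => v hv; apply: (apx_differentiable R n v (r / 2)) => //.
by apply: apx_sub h => w hw; apply: pdisc_trans hv hw _; rewrite -splitr.
Qed.

(** A countable set has Lebesgue measure 0, the whole line does not. *)
Lemma uncountable_avoid (h : nat -> R) : exists c, forall i, c <> h i.
Proof.
apply/not_existsP => H.
have E : range h = [set` `]-oo, +oo[%R].
  apply/seteqP; split => x //= _; apply: contrapT => hx.
  by apply: (H x) => i e; apply: hx; exists i.
have : lebesgue_measure (range h) = 0%E.
  by apply: countable_lebesgue_measure0; apply: card_image_le.
by rewrite E lebesgue_measure_itv /=.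
Qed.

(** Two points of the complex line through p and q are joined by the parabolic
    arcs [u + i c u (1 - u)]; distinct c give arcs meeting only at the ends, so
    countably many points of the line can be avoided. *)
Lemma connected_line n (D : set 'rV[C]_n) :
  (forall p q, D p -> D q -> exists f : nat -> C,
      forall t : C, ~ D (p + t *: (q - p)) -> exists i, t = f i) ->
  connected D.
Proof.
move=> H; have [[p0 Dp0]|D0] := pselect (exists p, D p); last first.
  have -> : D = set0 by apply/seteqP; split => // p Dp; apply: D0; exists p.
  exact: connected0.
pose arc (c u : R) : C := u +i* (c * (u * (1 - u))).
have /choice [cc Hcc] : forall q, exists c : R, D q ->
    forall u : R, 0 <= u <= 1 -> D (p0 + arc c u *: (q - p0)).
  move=> q; have [Dq|nDq] := pselect (D q); last by exists 0 => /nDq.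
  have [f Hf] := H p0 q Dp0 Dq.
  (* Away from its ends, the arc of parameter c passes through f i only for this value of c. *)
  have [c Hc] := uncountable_avoid (fun i => Im (f i) / (Re (f i) * (1 - Re (f i)))).
  exists c => _ u /andP[u0 u1]; apply: contrapT => nD.
  have [e0|n0] := eqVneq (u * (1 - u)) 0; last first.
    have [i e] := Hf _ nD; apply: (Hc i); rewrite -e /= mulfK //.
  apply: nD; have : (u == 0) || (1 - u == 0) by rewrite -mulf_eq0 e0.
  rewrite /arc e0 mulr0 subr_eq0 => /orP[/eqP->|/eqP<-].
    by rewrite -[0 +i* 0]/(0 : C) scale0r addr0.
  by rewrite -[1 +i* 0]/(1 : C) scale1r addrC subrK.
have -> : D = \bigcup_(q in D) [set p0 + arc (cc q) u *: (q - p0) | u in `[0, 1]].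
  apply/seteqP; split => [q Dq|x [q Dq [u /=]]].
    exists q => //; exists 1; first by rewrite /= in_itv /= ler01 lexx.
    rewrite /arc subrr !mulr0 -[1 +i* 0]/(1 : C) scale1r addrC subrK //.
  by rewrite in_itv /= => hu <-; apply: Hcc.
apply: bigcup_connected.
  exists p0 => q Dq; exists 0; first by rewrite /= in_itv /= ler01 lexx.
  by rewrite /arc !mul0r mulr0 -[0 +i* 0]/(0 : C) scale0r addr0.
move=> q _; apply: connected_continuous_connected (@segment_connected R 0 1) _.
apply: continuous_subspaceT => u0.
apply: cvgD; first exact: cvg_cst.
apply: continuousZr_tmp.
apply/cvgrPdist_le => e /posC_real [x x0 ->].
set g := fun u : R => cc q * (u * (1 - u)).
have gc : continuous g.
  move=> u; apply: cvgM; first exact: cvg_cst.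
  apply: cvgM; first exact: cvg_id.
  by apply: cvgB; [exact: cvg_cst|exact: cvg_id].
have x2 : 0 < x / 2 by rewrite divr_gt0.
have h1 : \forall u \near u0, `|u0 - u| <= x / 2.
  by have /cvgrPdist_le /(_ _ x2) := @cvg_id _ (nbhs u0).
have h2 : \forall u \near u0, `|g u0 - g u| <= x / 2.
  by have /cvgrPdist_le /(_ _ x2) := gc u0.
near=> u; rewrite normC_cmod lecR; apply: le_trans (cmod_ReIm _ _) _.
rewrite ReB ImB /= -/(g u0) -/(g u) (splitr x); apply: lerD; by near: u.
Unshelve. all: by end_near.
Qed.

End Topology.

(** * The given series as a box sum *)

Section BoxSumOfSeries.
Variable R : realType.
Local Notation C := (C R).
Local Notation Re := complex.Re.
Local Notation Im := complex.Im.

Definition natof n B (m : {ffun 'I_n -> 'I_B}) : nat -> nat :=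
  fun i => if (insub i : option 'I_n) is Some j then nat_of_ord (m j) else 0%N.

Lemma natof_ord n B (m : {ffun 'I_n -> 'I_B}) (i : 'I_n) : natof n B m i = m i.
Proof. by rewrite /natof valK. Qed.

(** Induction on n: a function on n + 1 indices is its restriction paired with its last value. *)
Lemma sum_ffun n B (f : (nat -> nat) -> C) :
  \sum_(m : {ffun 'I_n -> 'I_B}) f (natof n B m) = bs (fun=> B) n f.
Proof.
elim: n f => [|n IH] f.
  have e (m : {ffun 'I_0 -> 'I_B}) : natof 0 B m = (fun=> 0%N).
    by apply/funext => i; rewrite /natof; case: insubP => // -[].
  under eq_bigr do rewrite e.
  by rewrite sumr_const card_ffun !card_ord expn0.
rewrite /= -(IH (fun m => \sum_(k < B) f (ext m n k))) pair_bigA /=.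
pose h (p : {ffun 'I_n -> 'I_B} * 'I_B) : {ffun 'I_n.+1 -> 'I_B} :=
  [ffun i => if unlift ord_max i is Some j then p.1 j else p.2].
pose h' (m : {ffun 'I_n.+1 -> 'I_B}) : {ffun 'I_n -> 'I_B} * 'I_B :=
  ([ffun j => m (lift ord_max j)], m ord_max).
rewrite (reindex h); last first.
  exists h' => [[p k] _|m _].
    rewrite /h' /h ffunE unlift_none; congr (_, _); apply/ffunP => j.
    by rewrite !ffunE liftK.
  apply/ffunP => i; rewrite /h /h' !ffunE /=.
  by case: unliftP => [j ->|->]; rewrite ?ffunE.
apply: eq_bigr => -[p k] _; congr f; apply/funext => i; rewrite /ext /=.
have [->|ni] := eqVneq i n.
  by rewrite (natof_ord n.+1 B (h (p, k)) ord_max) /h ffunE unlift_none.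
rewrite /natof; case: (insubP 'I_n i) => [j _ ji|ji].
  case: insubP => [i' _ ii'|]; last by rewrite -ji ltnS (ltnW (ltn_ord j)).
  rewrite /h ffunE; have -> : i' = lift ord_max j.
    by apply: val_inj; rewrite /= /bump leqNgt ltn_ord add0n ji.
  by rewrite liftK.
case: insubP => [i' i'n ii'|//]; exfalso.
by move: i'n; rewrite ltnS leq_eqVlt (negbTE ni) (negbTE ji).
Qed.

Definition sh (m : nat -> nat) : nat -> nat := fun i => (m i + (i == 0))%N.

Lemma bs_shift M n (f : (nat -> nat) -> C) :
  bs (fun=> M.+1) n.+1 (fun m => if m 0%N == 0%N then 0 else f m) =
  bs (bnd M) n.+1 (fun m => f (sh m)).
Proof.
elim: n f => [|n IH] f.
  rewrite /= big_ord_recl {1}/ext eqxx /= add0r /bnd addn0; apply: eq_bigr => k _.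
  by congr f; apply/funext => i; rewrite /sh /ext /bump /= add1n; case: (i == 0%N); rewrite ?addn1 ?addn0.
transitivity (bs (fun=> M.+1) n.+1 (fun m => if m 0%N == 0%N then 0 else \sum_(k < M.+1) f (ext m n.+1 k))).
  apply: (bs_eq R (fun=> M.+1) n.+1) => m; have e k : ext m n.+1 k 0%N = m 0%N by [].
  by under eq_bigr do rewrite e; case: ifP => // _; rewrite big1.
rewrite IH; apply: (bs_eq R (bnd M) n.+1) => m; rewrite /bnd addn1; apply: eq_bigr => k _.
congr f; apply/funext => i; rewrite /sh /ext; case: (eqVneq i n.+1) => [->|//].
by rewrite addn0.
Qed.

Variables (n0 k : nat) (gam b mu : nat -> C).
Hypothesis gam_pos : forall j, (j < n0)%N -> 0 < Re (gam j).
Hypothesis b_pos : forall j, (j < n0)%N -> - Re (gam 0%N) < Re (b j).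
Hypothesis mu1 : forall j, (j < k)%N -> cmod (mu j) = 1.
Hypothesis n00 : (0 < n0)%N.

(** The parameters of the shifted series, in which every index starts at 0;
    they are extended by 1 beyond the range of the given ones. *)
Definition gam' j : C := if (j < n0)%N then gam j else 1.
Definition c' j : C := if j is j'.+1 then (if (j' < n0)%N then gam 0%N + b j' else 1) else gam 0%N.
Definition tau' j : C := if (j < k)%N then mu j else 1.

Lemma gam'_pos j : 0 < Re (gam' j).
Proof. by rewrite /gam'; case: ifP => [/gam_pos//|_]; rewrite /= ltr01. Qed.

Lemma c'_pos j : 0 < Re (c' j).
Proof.
case: j => [|j] /=; first exact: gam_pos.
by case: ifP => [/b_pos h|_]; rewrite /= ?ltr01 // ReD -ltrBlDl sub0r.
Qed.

Lemma tau'_le j : cmod (tau' j) <= 1.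
Proof. by rewrite /tau'; case: ifP => [/mu1->|_]; rewrite ?cmod1 lexx. Qed.

(** Raising m_1 by 1 splits off one factor mu_1 and moves gamma_1 into the constants gamma_1 + b_j.
    For k = 0 the split factor [tau' 0] is 1. *)
Lemma zterm_term n (s : 'rV[C]_n) (m : nat -> nat) : (n <= n0)%N -> (0 < n)%N ->
  zterm k s gam b mu (fun i : 'I_n => sh m i) = tau' 0 * term gam' c' tau' n (sl s) m.
Proof.
move=> nn0 n_gt0; rewrite /zterm /term big_ord_recl /= [pw _ 0]pw0 mul1r mulrA; congr (_ * _).
  transitivity (\prod_(j < n) tau' j ^+ sh m j).
    by rewrite big_mkcond; apply: eq_bigr => j _; rewrite /tau'; case: ifP; rewrite ?expr1n.
  case: n s nn0 n_gt0 => // n _ _ _; rewrite !big_ord_recl /= mulrA -exprS /sh addn1; congr (_ * _).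
  by apply: eq_bigr => j _; rewrite /bump /= addn0.
rewrite -prodfV; apply: eq_bigr => j _.
have X : \sum_(i < n | (i <= j)%N) gam i * (sh m i)%:R + b j = Xf gam' c' m (lift ord0 j).
  rewrite /Xf /= /bump /= add1n (leq_trans (ltn_ord j) nn0).
  transitivity (\sum_(i < j.+1) gam' i * (sh m i)%:R + b j).
    rewrite (big_ord_widen n (fun i => gam' i * (sh m i)%:R)) //; congr (_ + _).
    by apply: eq_big => [i|i _]; rewrite ?ltnS // /gam' (leq_trans (ltn_ord i) nn0).
  rewrite !big_ord_recl /sh /= addn1 -natr1 /gam' n00.
  under eq_bigr do rewrite addn0.
  ring.
have p : 0 < Re (Xf gam' c' m (lift ord0 j)).
  have [k1 [K1 [k0 K0 H _]]] := sect_all R gam' c' gam'_pos c'_pos n.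
  by apply: (sect_Re _ _ _ _ _ k0 (Yf_ge1 R m (lift ord0 j))); apply: H; rewrite -ltnS.
rewrite X cpowV //; congr pw; rewrite /sl /= /bump /= add0n.
by rewrite sv_ord.
Qed.

Lemma zpart_box n (s : 'rV[C]_n) M : (n <= n0)%N -> (0 < n)%N ->
  zpart k s gam b mu M = tau' 0 * box gam' c' tau' n (sl s) M.
Proof.
move=> nn0 n_gt0; rewrite /box -bsZ; case: n s nn0 n_gt0 => // n s nn0 n_gt0.
pose f (m : nat -> nat) := zterm k s gam b mu (fun i : 'I_n.+1 => m i).
transitivity (bs (bnd M) n.+1 (fun m => f (sh m))); last by apply: bs_eq => m; apply: zterm_term.
rewrite -bs_shift -sum_ffun /zpart big_mkcond; apply: eq_bigr => m _.
have e0 : natof n.+1 M.+1 m 0%N = m ord0 by rewrite (natof_ord _ _ m ord0).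
have -> : [forall i : 'I_n.+1, (nat_of_ord i == 0%N) ==> (0 < m i)%N] = (natof n.+1 M.+1 m 0%N != 0%N).
  rewrite e0 -lt0n; apply/forallP/idP => [/(_ ord0)//|h i]; apply/implyP => /eqP i0.
  by have -> : i = ord0 by apply: val_inj.
case: eqP => //= _; rewrite /f; congr zterm; apply/funext => i; by rewrite natof_ord.
Qed.

Lemma absconv_region n (s : 'rV[C]_n) : absconv s -> region n 0 (sl s).
Proof.
move=> H j jn; have := H (Ordinal jn); rewrite /= addr0 Re_sum.
rewrite big_geq_mkord; congr (_ < _).
by apply: eq_big => [i|i _] //; rewrite -sv_ord.
Qed.

End BoxSumOfSeries.

(** * The Hurwitz zeta-function and its values at nonpositive integers *)

Section Hurwitz.
Variable R : realType.
Local Notation C := (C R).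
Local Notation Re := complex.Re.
Local Notation Im := complex.Im.

(** e^((x + 1) X) / (1 - e^X) = e^(x X) / (1 - e^X) - e^(x X), read through [pc_unique]. *)
Lemma pc_shift (x : C) l : pc 1 (x + 1) l = pc 1 x l - x ^+ l / l`!%:R.
Proof.
have rel y n : pc 1 y n = y ^+ n / n`!%:R - (n.+1)`!%:R^-1 + \sum_(i < n.+1) pc 1 y i / (n - i)`!%:R :> C.
  by rewrite {1}pc_rel /pm1 eqxx !mul1r mulN1r.
apply: (pc_unique R (x + 1) (pc 1 (x + 1)) (fun l => pc 1 x l - x ^+ l / l`!%:R) _ _ l) => n.
  exact: rel.
under eq_bigr do rewrite mulrBl.
rewrite sumrB {1}(rel x n).
have -> : \sum_(i < n.+1) x ^+ i / i`!%:R / (n - i)`!%:R = (x + 1) ^+ n / n`!%:R.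
  rewrite addrC exprDn mulr_suml; apply: eq_bigr => i _; have i_n : (i <= n)%N by rewrite -ltnS.
  rewrite expr1n mul1r -[_ *+ _]mulr_natl -(bin_fact i_n) !natrM.
  have h1 := fact_neq0 R i; have h2 := fact_neq0 R (n - i).
  have h3 : ('C(n, i)%:R : C) != 0 by rewrite -cmod_gt0 cmod_nat ltr0n bin_gt0.
  by field; rewrite h1 h2 h3.
ring.
Qed.

Lemma pc_shift_nat (x : C) m l :
  pc 1 (x + m%:R) l = pc 1 x l - (\sum_(j < m) (x + j%:R) ^+ l) / l`!%:R.
Proof.
elim: m => [|m IH]; first by rewrite addr0 big_ord0 mul0r subr0.
by rewrite -natr1 addrA pc_shift IH big_ord_recr /= mulrDl; ring.
Qed.

Lemma ccvg_shift (u : nat -> C) l m : ccvg (fun M => u (M + m)%N) l -> ccvg u l.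
Proof.
move=> h e e0; have [N HN] := h e e0; exists (N + m)%N => n Nn.
have mn : (m <= n)%N := leq_trans (leq_addl N m) Nn.
by rewrite -(subnK mn); apply: HN; rewrite -(leq_add2r m) subnK.
Qed.

Lemma pw_1 (w : C) : pw 1 w = 1.
Proof.
have -> : pw 1 w = cexp (- w * (0 : C)).
  by rewrite /pw /lg /= expr0n /= expr1n addr0 ln1 !mul0r atan0.
by rewrite mulr0 cexp0.
Qed.

Lemma term1 (gam c tau : nat -> C) s m : term gam c tau 1 s m =
  tau 0%N ^+ m 0%N * (pw (c 0%N) (s 0%N) * pw (c 1%N + gam 0%N * (m 0%N)%:R) (s 1%N)).
Proof.
rewrite /term big_ord_recl big_ord0 mulr1; congr (_ * _).
by rewrite big_ord_recl big_ord1 /Xf big_ord0 addr0 big_ord1.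
Qed.

Variable a : C.
Hypothesis a_nonpos : ~ nonpos_real a.

Lemma a_neq0 j : j%:R + a != 0.
Proof.
apply/eqP => h; apply: a_nonpos; have -> : a = - j%:R by rewrite -[RHS]addr0 -h; ring.
by rewrite /nonpos_real ImN ReN Im_nat Re_nat oppr0 oppr_le0.
Qed.

Lemma shift_ex : exists m0, 0 < Re (a + m0%:R).
Proof.
exists (Num.truncn (`|Re a|)).+1; rewrite ReD Re_nat.
have h := truncnS_gt (`|Re a|); have := ler_norm (- Re a); rewrite normrN => h'.
by rewrite -ltrBlDl sub0r (le_lt_trans h').
Qed.

Let m0 := projT1 (cid shift_ex).
Let m0P : 0 < Re (a + m0%:R). Proof. exact: projT2 (cid shift_ex). Qed.

Let gH (j : nat) : C := 1.
Let cH (j : nat) : C := if j is 0%N then 1 else a + m0%:R.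

Let gH0 j : 0 < Re (gH j). Proof. by rewrite /= ltr01. Qed.
Let cH0 j : 0 < Re (cH j). Proof. by case: j => [|j] /=; rewrite ?ltr01 ?m0P. Qed.
Let tH1 j : cmod (gH j) <= 1. Proof. by rewrite cmod1. Qed.

Let sz (z : C) : nat -> C := fun j => if j == 1%N then z else 0.

Let E1 (z : C) : C := step gH cH gH 0 (Tw gH cH gH 0) (sz z) / (1 - z).

(** Re a may be nonpositive, so the first m0 terms, entire in z, are split off. The rest is an
    untwisted level: [gH] = 1 is both step and twist, and [cH 0] = 1 makes the auxiliary factor
    1. *)
Definition hurwitz (z : C) : C := \sum_(j < m0) cexp (- z * Log (j%:R + a)) + E1 z.

Lemma E1_cvg z : 1 < Re z -> ccvg (fun M => \sum_(k < M) pw (a + m0%:R + k%:R) z) (E1 z).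
Proof.
move=> hz; have [h0 _ _] := TwP R gH cH gH gH0 cH0 tH1 0 (fun j (h : (j < 0)%N) => False_ind _ (elimF idP (ltn0 j) h)).
have reg : region 1 0 (sz z) by move=> [|j] //; rewrite big_nat1 /= addr0.
apply: ccvg_eq (converges_untwisted R gH cH gH gH0 cH0 tH1 0 _ erefl h0 (sz z) reg) => M.
rewrite /box /= /bnd addn0; apply: eq_bigr => k _.
by rewrite term1 expr1n pw_1 !mul1r.
Qed.

Lemma hurwitz_series z : 1 < Re z ->
  ccvg (fun M => \sum_(m < M) 1 / cpow (m%:R + a) z) (hurwitz z).
Proof.
move=> hz; apply: (ccvg_shift _ _ m0).
apply: ccvg_eq (ccvgD _ _ _ _ _ (ccvg_cst _ _) (E1_cvg z hz)) => M.
rewrite addnC big_split_ord /=; congr (_ + _).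
  apply: eq_bigr => j _; rewrite div1r /cpow (negbTE (a_neq0 j)) -cexpN; congr cexp; ring.
apply: eq_bigr => k _; rewrite div1r natrD.
have -> : m0%:R + k%:R + a = a + m0%:R + k%:R by ring.
by rewrite cpowV // ReD Re_nat ltr_wpDr.
Qed.

Lemma hurwitz_locapx (p : 'rV[C]_1) : p ord0 ord0 != 1 -> locapx (fun v => hurwitz (v ord0 ord0)) p.
Proof.
move=> p1; have [h0 e0 _] := TwP R gH cH gH gH0 cH0 tH1 0 (fun j (h : (j < 0)%N) => False_ind _ (elimF idP (ltn0 j) h)).
have pc0 : pf (fun v : 'rV[C]_1 => v ord0 ord0) by apply: pf_coord.
apply: locapxD.
  apply: locapx_sum => j; exists 1 => //; apply: apx_cexp; apply: apx_pf.
  by apply: pf_mul (pf_cst _ _ _); apply: pf_opp.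
apply: locapxM; last first.
  apply: locapx_inv; first by apply: pf_add (pf_cst _ _ _) _; apply: pf_opp.
  by rewrite subr_eq0 eq_sym.
apply: (entire_step R gH cH gH gH0 cH0 tH1 0 _ h0 e0 1 (fun v => sz (v ord0 ord0))) => j.
by rewrite /sz; case: eqP => _; [|apply: pf_cst].
Qed.

(** The remainder vanishes and all powers of 1 are 1, so the tail is a finite sum of coefficients
    with parameter a + m0 - 1. [pc_rel] and [pc_shift] collapse it to the coefficient for a + m0,
    and by [pc_shift_nat] the first m0 terms cancel. *)
Lemma hurwitz_negint N : hurwitz (- N%:R) = N`!%:R * pc 1 a N.
Proof.
have [h0 _ _] := TwP R gH cH gH gH0 cH0 tH1 0 (fun j (h : (j < 0)%N) => False_ind _ (elimF idP (ltn0 j) h)).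
have [K0 hK0] := region_ex R 1 (sz (- N%:R)); pose K := maxn K0 N.+1.
have hK : region 1 K (sz (- N%:R)) by apply: regionW hK0; apply: leq_maxl.
have NK : (N < K)%N by apply: leq_maxr.
have b'E : bt cH 0 / gH 0 = a + m0%:R - 1 by rewrite /bt /gH divr1.
have E : E1 (- N%:R) = N`!%:R * pc 1 (a + m0%:R) N.
  rewrite /E1 (stepE R gH cH gH gH0 cH0 tH1 0 _ h0 K) // /stepK.
  rewrite (Rem_negint R gH cH gH gH0 cH0 0 K _ N) // addr0 /= !pw_1 mulr1.
  under eq_bigr do rewrite pw_1 mulr1.
  have szE : sz (- N%:R) 1 = - N%:R by [].
  rewrite {1 2}/gH /qf /rf eqxx invr1 opprK.
  have N1 : (1 + N%:R : C) != 0 by rewrite addrC natr1 natC_neq0.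
  rewrite !szE mulrDl [(1 + N%:R) * _]mulrC mulfK // mulN1r.
  have f := fact_neq0 R N.
  set b' := bt cH 0 / gH 0.
  have -> : \sum_(l < K) Acoef (bt cH 0) (gH 0) (gH 0) l (- N%:R) =
     \sum_(l < N.+1) N`!%:R * (pc 1 b' l / (N - l)`!%:R).
    rewrite -(subnKC NK) big_split_ord /= [X in _ + X]big1 ?addr0; last first.
      by move=> i _; rewrite /Acoef ffN ffact_small ?ltnS ?leq_addr // mulr0 mul0r.
    apply: eq_bigr => l _; have lN : (l <= N)%N by rewrite -ltnS.
    rewrite /Acoef ffN {3}/gH expr1n mulr1 -(ffact_fact lN) natrM.
    by have := fact_neq0 R (N - l); rewrite /b' /gH => h; field.
  rewrite -mulr_sumr.
  have -> : a + m0%:R = b' + 1 by rewrite /b' b'E subrK.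
  rewrite pc_shift {1}[pc 1 b' N]pc_rel /pm1 eqxx !mul1r factS natrM [1 + _]addrC natr1.
  by have := natC_neq0 R N; move: (\sum_(l < _) _) (N.+1%:R : C) => S n1 n10; field; rewrite f n10.
rewrite /hurwitz E pc_shift_nat mulrBr [_ * (_ / _)]mulrCA divff ?fact_neq0 // mulr1 addrC.
have -> : \sum_(j < m0) cexp (- - N%:R * Log (j%:R + a)) = \sum_(j < m0) (a + j%:R) ^+ N.
  by apply: eq_bigr => j _; rewrite opprK cexp_nat cexp_Log ?a_neq0 // addrC.
by rewrite subrK.
Qed.

Lemma hurwitz_contP : hurwitz_cont a hurwitz.
Proof.
split=> [s s1|s hs]; last by apply: ccvg_cvg; apply: hurwitz_series.
pose w : 'rV[C]_1 := const_mx 1.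
have lw (z : C) : (z *: w) ord0 ord0 = z by rewrite !mxE mulr1.
(* [locapx] speaks of rows, so the function is factored through rows of length 1. *)
have -> : hurwitz = (fun v : 'rV[C]_1 => hurwitz (v ord0 ord0)) \o (fun z : C => z *: w).
  by apply/funext => z /=; rewrite lw.
apply: differentiable_comp; first by apply: differentiableZl.
by apply: locapx_differentiable; apply: hurwitz_locapx; rewrite lw.
Qed.

End Hurwitz.

(** * The singular hyperplanes and the final statement *)

Section Final.
Variable R : realType.
Local Notation C := (C R).
Local Notation Re := complex.Re.
Local Notation Im := complex.Im.

Lemma sv_line n (p q : 'rV[C]_n) (t : C) j : sv (p + t *: (q - p)) j = sv p j + t * (sv q j - sv p j).
Proof.
rewrite /sv; case: insubP => [i _ _|_]; first by rewrite !mxE.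
by rewrite subrr mulr0 addr0.
Qed.

Lemma solve_line (x y v t : C) : x != v -> x + t * (y - x) = v -> t = (v - x) / (y - x).
Proof.
move=> xv e; have d : y - x != 0.
  by apply: contra_neq xv => d0; rewrite -e d0 mulr0 addr0.
by rewrite -e [x + _]addrC addrK mulfK.
Qed.

Lemma int_le2 (j : int) : (j <= 2)%R -> exists l : nat, j%:~R = 2 - l%:R :> C.
Proof.
move=> j2; exists (absz (2 - j)); have e : j = 2 - (absz (2 - j))%:Z.
  by rewrite gez0_abs ?subr_ge0 //; ring.
by rewrite {1}e rmorphB /= .
Qed.

Lemma sing_setP k (v : 'rV[C]_k.+2) : sing_set k.+2 v <->
  sv v k.+1 = 1 \/ exists l : nat, sv v k + sv v k.+1 = 2 - l%:R.
Proof.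
split=> -[h|h]; [by left| |by left|].
  by right; case: h => j [/int_le2 [l ->] ->]; exists l.
right; case: h => l ->; exists (2 - l%:Z); split; first by rewrite gerBl.
by rewrite rmorphB.
Qed.

(** A hyperplane that misses p meets the complex line through p and q in at most one point; index 0
    stands for s_n = 1, index l + 1 for s_(n-1) + s_n = 2 - l. *)
Lemma sing_connected k : connected (~` (sing_set k.+2 : set 'rV[C]_k.+2)).
Proof.
apply: connected_line => p q /= hp hq.
exists (fun i => if i is l.+1 then (2 - l%:R - (sv p k + sv p k.+1)) / ((sv q k + sv q k.+1) - (sv p k + sv p k.+1))
  else (1 - sv p k.+1) / (sv q k.+1 - sv p k.+1)).
move=> t /contrapT /sing_setP; rewrite !sv_line => -[h|[l h]].
  exists 0%N; apply: solve_line h; apply/eqP => e; apply: hp; apply/sing_setP; by left.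
exists l.+1; apply: solve_line; last by rewrite -h; ring.
by apply/eqP => e; apply: hp; apply/sing_setP; right; exists l.
Qed.

Lemma pf_avoid n (f : 'rV[C]_n -> C) a p : pf f -> f p != a ->
  exists2 r : R, 0 < r & forall v, pdisc p r v -> f v != a.
Proof.
move=> hf h; have m : 0 < cmod (f p - a) / 2 by rewrite divr_gt0 // cmod_gt0 subr_eq0.
have [r r0 H] := pf_near _ _ _ p _ hf m; exists r => // v /H h2.
apply/eqP => e; move: h2; rewrite e cmodBC leNgt => /negP; apply.
by rewrite ltr_pdivrMr // mulr_natr mulr2n ltrDl cmod_gt0 subr_eq0.
Qed.

Lemma hden_sing k K (v : 'rV[C]_k.+2) : ~ sing_set k.+2 v -> hden k K (sl v) != 0.
Proof.
move=> /sing_setP h; rewrite /hden; apply: mulf_neq0.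
  by rewrite subr_eq0 eq_sym; apply/eqP => e; apply: h; left.
apply: mulf_neq0; first by rewrite subr_eq0 eq_sym; apply/eqP => e; apply: h; right; exists 0%N; rewrite subr0.
apply/prodf_neq0 => l _; rewrite subr_eq0 eq_sym; apply/eqP => e; apply: h; right; exists l.+1.
by rewrite -[sv v k + _]/(sl v k.+1 + sl v k.+2) e -natr1; ring.
Qed.

(** In [region k.+2 K] the real part of s_(n-1) + s_n exceeds 2 - K, so the hyperplanes absent from
    [hden] do not reach it. *)
Lemma sing_hden k K (v : 'rV[C]_k.+2) : region k.+2 K (sl v) -> hden k K (sl v) != 0 -> ~ sing_set k.+2 v.
Proof.
move=> hK; rewrite /hden !mulf_eq0 !negb_or => /andP[h1 /andP[h2 /prodf_neq0 h3]] /sing_setP [e|[l e]].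
  by move: h1; rewrite subr_eq0 /= e eqxx.
case: l e => [|l] e; first by move: h2; rewrite subr_eq0 /= e subr0 eqxx.
have [lK|Kl] := ltnP l K.
  by have := h3 (Ordinal lK) isT; rewrite /= e -natr1 subr_eq0 => /eqP; apply; ring.
have := hK k (ltnW (ltnSn _)); have -> : (k.+2 - k = 2)%N by rewrite -addn2 addKn.
rewrite big_ltn ?leqnSn // big_nat1 -ReD /= e ReB !Re_nat => h.
have Kl' : (K%:R : R) <= l%:R by rewrite ler_nat.
move: h; rewrite -[l.+1%:R]natr1; move: (K%:R) (l%:R) Kl' => x y; lra.
Qed.

Lemma zpart0 k (s : 'rV[C]_0) gam b mu M : zpart k s gam b mu M = 1.
Proof.
rewrite /zpart (eq_bigr (fun=> 1)) => [|m _].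
  rewrite (eq_bigl (fun=> true)) => [|m]; last by apply/forallP => -[].
  by rewrite sumr_const card_ffun !card_ord expn0.
by rewrite /zterm !big_ord0 divr1.
Qed.

Lemma avoid_seq (cs : seq R) (r : R) : 0 < r -> exists2 t, 0 < t <= r & t \notin cs.
Proof.
elim: cs r => [|c cs IH] r r0; first by exists r => //; rewrite r0 lexx.
have [c0|c0] := lerP c 0.
  have [t /andP[t0 tr] h] := IH r r0; exists t; first by rewrite t0.
  by rewrite inE negb_or h gt_eqF // (le_lt_trans c0).
have m0 : 0 < Num.min r (c / 2) by rewrite lt_min r0 divr_gt0.
have [t /andP[t0]] := IH _ m0; rewrite le_min => /andP[tr tc] h; exists t; first by rewrite t0.
by rewrite inE negb_or h andbT lt_eqF //; lra.
Qed.

(** Moving the last coordinate by a small real t > 0 gives every factor the form x - t, and t avoids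
    the finitely many real parts of the x. *)
Lemma hden_dense k K (p : 'rV[C]_k.+2) : ~ (\forall v \near p, hden k K (sl v) = 0).
Proof.
move=> /near_pdisc [r r0 H].
pose sg := sv p k + sv p k.+1.
have [t /andP[t0 tr] ht] := avoid_seq
  [:: Re (1 - sv p k.+1), Re (2 - sg) & [seq Re (1 - l%:R - sg) | l <- iota 0 K]] r r0.
pose f j : C := sv p j + (if j == k.+1 then t%:C else 0).
pose v : 'rV[C]_k.+2 := \row_j f j.
have vk : sv v k = sv p k by rewrite sv_row ?leqnSn // /f ltn_eqF ?addr0.
have vk1 : sv v k.+1 = sv p k.+1 + t%:C by rewrite sv_row // /f eqxx.
have nz (x : C) : t != Re x -> x - t%:C != 0.
  by apply: contra_neq => /eqP; rewrite subr_eq0 => /eqP ->.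
have pv : pdisc p r v.
  move=> j; rewrite mxE /f sv_ord addrAC subrr add0r; case: ifP => _; last by rewrite cmod0 ltW.
  by rewrite /cmod /= expr0n /= addr0 sqrtr_sqr gtr0_norm.
have := H v pv; apply/eqP; rewrite /hden /= vk vk1.
move: ht; rewrite !inE !negb_or => /andP[h1 /andP[h2 h3]].
apply: mulf_neq0; first by rewrite opprD addrA; apply: nz.
apply: mulf_neq0; first by rewrite addrA opprD addrA; apply: nz.
apply/prodf_neq0 => l _; rewrite addrA opprD addrA; apply: nz.
apply: contra h3 => /eqP e; apply/mapP; exists (l : nat) => //.
by rewrite mem_iota /=.
Qed.

Section MainFunctions.
Variables (k : nat) (gam b mu : nat -> C).
Hypothesis gam_pos : forall j, (j < k.+2)%N -> 0 < Re (gam j).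
Hypothesis b_pos : forall j, (j < k.+2)%N -> - Re (gam 0%N) < Re (b j).
Hypothesis mu1 : forall j, (j < k)%N -> cmod (mu j) = 1.
Hypothesis mu_tw : forall j, (j < k)%N -> mu j != 1.

Local Notation G := (gam' R k.+2 gam).
Local Notation Cc := (c' R k.+2 gam b).
Local Notation T := (tau' R k mu).

Let Gp := gam'_pos R k.+2 gam gam_pos.
Let Cp := c'_pos R k.+2 gam b gam_pos b_pos isT.
Let T1 := tau'_le R k mu mu1.

Lemma tau'_tw j : (j < k)%N -> T j != 1.
Proof. by move=> jk; rewrite /tau' jk mu_tw. Qed.

Lemma tau'_k : T k = 1. Proof. by rewrite /tau' ltnn. Qed.

Lemma tau'_k1 : T k.+1 = 1. Proof. by rewrite /tau' ltnNge leqnSn. Qed.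

Lemma zpart_cvg n E (s : 'rV[C]_n) : (n <= k.+2)%N -> (0 < n)%N -> converges G Cc T n E ->
  absconv s -> zpart k s gam b mu M @[M --> \oo] --> T 0 * E (sl s).
Proof.
move=> nk n0 hE hs; apply: ccvg_cvg.
apply: ccvg_eq (ccvgZ _ (T 0) _ _ (hE _ (absconv_region _ _ _ hs))) => M.
by rewrite (zpart_box R k.+2 k gam b mu gam_pos b_pos).
Qed.

(** The factor [T 0] from the shift of m_1 is common to [Fv], [Z1v] and [Z0v], so the asymptotic
    relation between them is that of the unscaled functions. *)
Definition Fv (v : 'rV[C]_k.+2) : C := T 0 * Ffun G Cc T k (sl v).
Definition Z1v (v : 'rV[C]_k.+1) : C := T 0 * Zfun G Cc T k (sl v).
Definition Z0v (v : 'rV[C]_k) : C := T 0 * Tw G Cc T k (sl v).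
Definition D1 : set 'rV[C]_k.+1 := [set v | sv v k != 1].

Let Zc := Zfun_converges R G Cc T Gp Cp T1 k tau'_tw tau'_k.

Lemma Fv_locapx p : ~ sing_set k.+2 p -> locapx Fv p.
Proof.
move=> /sing_setP h; apply: locapxM (locapx_cst _ _ _ _) _.
apply: (Ffun_locapx R G Cc T Gp Cp T1 k tau'_tw tau'_k) => /=.
- by move=> j; apply: pf_sl.
- by apply/eqP => e; apply: h; left.
- by apply/eqP => e; apply: h; right; exists 0%N; rewrite subr0.
- by move=> l; apply/eqP => e; apply: h; right; exists l.+1; rewrite e -natr1; ring.
Qed.

Lemma region_near p K : region k.+2 K (sl p) ->
  exists2 r : R, 0 < r & forall v : 'rV[C]_k.+2, pdisc p r v -> region k.+2 K (sl v).
Proof.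
move=> hK; have [|r r0 [_ h]] := Rem_apx R G Cc T Gp Cp T1 k.+2 sl k.+1 K p _ hK; last by exists r.
by move=> j; apply: pf_sl.
Qed.

(** Near p the singular set is the zero set of the polynomial [hden] for a single K. *)
Lemma sing_closed : open (~` (sing_set k.+2 : set 'rV[C]_k.+2)).
Proof.
apply: open_pdisc => p hp; have [K hK] := region_ex R k.+2 (sl p).
have [r1 r10 H1] := region_near p K hK.
have [|r2 r20 H2] := pf_avoid _ (fun v => hden k K (sl v)) 0 p _ (hden_sing _ K _ hp).
  by apply: hden_pf => j; apply: pf_sl.
exists (Num.min r1 r2); first by rewrite lt_min r10.
move=> v hv; apply: (sing_hden _ K); [apply: H1|apply: H2]; apply: pdisc_le hv _.
  by rewrite ge_min lexx.
by rewrite ge_min lexx orbT.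
Qed.

Lemma absconv_nonsing s : absconv s -> (~` sing_set k.+2) (s : 'rV[C]_k.+2).
Proof.
move=> /absconv_region h; have := h k.+1 (ltnSn _); have := h k (ltnW (ltnSn _)).
have -> : (k.+2 - k = 2)%N by rewrite -addn2 addKn.
rewrite subSnn !addr0 big_nat1 big_ltn ?leqnSn // big_nat1 -ReD /= => h2 h1 /sing_setP [e|[l e]].
  by move: h1; rewrite e ltxx.
by move: h2; rewrite e ReB !Re_nat ltNge gerBl ler0n.
Qed.

Lemma Fv_cont : zeta_cont k gam b mu (~` sing_set k.+2) Fv.
Proof.
split; [exact: sing_closed|exact: sing_connected|exact: absconv_nonsing| |].
  by move=> s hs; apply: locapx_differentiable; apply: Fv_locapx.
move=> s; apply: zpart_cvg => //.
exact: (Ffun_converges R G Cc T Gp Cp T1 k tau'_tw tau'_k tau'_k1).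
Qed.

Lemma Fv_meromorphic : meromorphic_off Fv (sing_set k.+2).
Proof.
move=> p; have [K hK] := region_ex R k.+2 (sl p).
have hp j : pf (fun v : 'rV[C]_k.+2 => sl v j) by apply: pf_sl.
exists (fun v => T 0 * gnum G Cc T k K (sl v)), (fun v => hden k K (sl v)); split; last exact: hden_dense.
have lg : locapx (fun v : 'rV[C]_k.+2 => T 0 * gnum G Cc T k K (sl v)) p.
  apply: locapxM (locapx_cst _ _ _ _) _.
  exact: (gnum_locapx R G Cc T Gp Cp T1 k tau'_tw).
have lh : locapx (fun v : 'rV[C]_k.+2 => hden k K (sl v)) p by apply: locapx_pf; apply: hden_pf.
have [r r0 H] := region_near p K hK.
near=> v; split.
- by near: v; apply: locapx_near.
- by near: v; apply: locapx_near.
move=> /sing_setP h; have hv : region k.+2 K (sl v) by near: v; apply: nbhs_pdisc r0 H.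
rewrite /Fv -mulrA; congr (_ * _).
apply: (gnumE R G Cc T Gp Cp T1 k tau'_tw tau'_k tau'_k1) => //=.
- by apply/eqP => e; apply: h; left.
- by apply/eqP => e; apply: h; right; exists 0%N; rewrite subr0.
- by move=> l; apply/eqP => e; apply: h; right; exists l.+1; rewrite e -natr1; ring.
Unshelve. all: by end_near.
Qed.

Lemma Z1v_cont : zeta_cont k gam b mu D1 Z1v.
Proof.
have hp j : pf (fun v : 'rV[C]_k.+1 => sl v j) by apply: pf_sl.
split.
- by apply: open_pdisc => p hv; apply: pf_avoid hv; apply: pf_sv.
- apply: connected_line => p q /= hv hq.
  exists (fun _ => (1 - sv p k) / (sv q k - sv p k)) => t /negP; rewrite negbK => /eqP e.
  by exists 0%N; apply: solve_line => //; rewrite -sv_line.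
- move=> s /absconv_region /(_ k (ltnSn _)); rewrite subSnn addr0 big_nat1 /D1 /= => h.
  by apply/eqP => e; move: h; rewrite e ltxx.
- move=> s hs; apply: locapx_differentiable; apply: locapxM (locapx_cst _ _ _ _) _.
  exact: (Zfun_locapx R G Cc T Gp Cp T1 k tau'_tw).
- by move=> s; apply: zpart_cvg.
Qed.

(** The case n = 0 is apart: the empty series has no m_1 to shift, and its value is 1. The equation
    n = k permits the case analysis on n. *)
Lemma zpart_Tw n (s : 'rV[C]_n) : n = k -> absconv s ->
  zpart k s gam b mu M @[M --> \oo] --> T 0 * Tw G Cc T n (sl s).
Proof.
case: n s => [|n] s nk; last first.
  apply: zpart_cvg; rewrite // nk ?(leq_trans (leqnSn k)) //.
  by have [] := TwP R G Cc T Gp Cp T1 k tau'_tw.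
move=> _; apply: ccvg_cvg; rewrite /= pw0 mulr1 /tau' -nk /=.
by apply: ccvg_eq (ccvg_cst _ 1) => M; rewrite zpart0.
Qed.

Lemma Z0v_cont : zeta_cont k gam b mu setT Z0v.
Proof.
have [hc he _] := TwP R G Cc T Gp Cp T1 k tau'_tw.
split; [exact: openT| |by []| |].
- by apply: connected_line => p q _ _; exists (fun _ => 0) => t [].
- move=> s _; apply: locapx_differentiable; apply: locapxM (locapx_cst _ _ _ _) _.
  by apply: he => j; apply: pf_sl.
- by move=> s; apply: zpart_Tw.
Qed.

Variable N : nat -> nat.

Lemma sv_mNstar l j : (j <= k)%N -> sv (mNstar k.+2 N l : 'rV[C]_k.+1) j =
  if (j < k)%N then - (N j)%:R else - (((N k + N k.+1)%N)%:Z + l)%:~R.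
Proof.
move=> jk; have := sv_row R k.+1
  (fun j => if (j < k)%N then - (N j)%:R else - (((N k + N k.+1)%N)%:Z + l)%:~R) j.
by rewrite ltnS; apply.
Qed.

Lemma Z1v_mNstar l w : (l%:~R : C) = - (N k.+1)%:R - w -> 
  Z1v (mNstar k.+2 N l) = T 0 * Zfun G Cc T k (upd (sN N (0 : 'rV[C]_k.+2)) k.+1 w).
Proof.
move=> e; congr (_ * _); apply: (Zfun_depends R G Cc T Gp Cp T1 k tau'_tw) => -[|j] //=.
rewrite ltnS => jk; rewrite sv_mNstar // /upd eqSS !sN0.
move: jk; rewrite leq_eqVlt => /predU1P[->|jk]; last by rewrite jk ltn_eqF.
by rewrite ltnn eqxx rmorphD /= e PoszD rmorphD /=; ring.
Qed.

(** The last exponent is - m, at most 0, hence not 1. *)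
Lemma D1_mNstar l (m : nat) : (N k + N k.+1)%N%:Z + l = m -> D1 (mNstar k.+2 N l).
Proof.
move=> e; rewrite /D1 /= sv_mNstar // ltnn e.
apply/eqP => /(congr1 (@complex.Re R)); rewrite ReN [complex.Re _]Re_nat /= => h.
by have := ler0n R m; rewrite -oppr_le0 h; apply/negP; rewrite -ltNge ltr01.
Qed.

Lemma Fv_row (d : 'rV[C]_k.+2) :
  Fv (\row_(j < k.+2) (- (N j)%:R + d ord0 j)) = T 0 * Ffun G Cc T k (sN N d).
Proof.
have dF : depends R k.+2 (Ffun G Cc T k).
  have dZ := Zfun_depends R G Cc T Gp Cp T1 k tau'_tw.
  by move=> s s' H; rewrite /Ffun /Gfun (depends_step R G Cc T Gp Cp T1 _ _ Zc dZ s s' H) H.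
congr (_ * _); apply: dF => -[|j] //= jk.
by rewrite !(svE _ _ _ _ jk) mxE.
Qed.

Lemma Z0v_row (d : 'rV[C]_k.+2) :
  Z0v (\row_(j < k) (- (N j)%:R + sv d j)) = T 0 * Tw G Cc T k (sN N d).
Proof.
have [_ _ dT] := TwP R G Cc T Gp Cp T1 k tau'_tw.
congr (_ * _); apply: dT => -[|j] //= jk.
by rewrite (sv_row R k (fun j => - (N j)%:R + sv d j)).
Qed.

(** The summand gamma_1 added to both b_n and b_(n-1) cancels in their difference. *)
Lemma bern_hurwitz l : let a := (b k.+1 - b k) / gam k.+1 in ~ nonpos_real a ->
  bern G Cc k l = hurwitz R a (- l%:R).
Proof.
move=> a ha; rewrite hurwitz_negint // /bern /bt /gam' /= !ltnS leqnn leqnSn.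
by rewrite opprD addrACA subrr add0r.
Qed.

Lemma Fv_asymp : let a := (b k.+1 - b k) / gam k.+1 in
  let L := N k.+1 in let M := N k in let Hz := hurwitz R a in ~ nonpos_real a ->
  exists c e : R, 0 < c /\ 0 < e /\
    forall d : 'rV[C]_k.+2, maxabs d < e -> sv d k + sv d k.+1 != 0 ->
    cmod (Fv (\row_(j < k.+2) (- (N j)%:R + d ord0 j)) -
      (- (L.+1%:R)^-1 * Z1v (mNstar k.+2 N 1) * (gam k.+1)^-1 +
       \sum_(l < L.+1) 'C(L, l)%:R * Z1v (mNstar k.+2 N (- l%:Z)) * Hz (- l%:R) * gam k.+1 ^+ l +
       (-1) ^+ M.+1 * L`!%:R * M`!%:R / (M + L).+1`!%:R *
       (epsf L M (sv d k.+1) / (sv d k + sv d k.+1)) *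
       Z0v (\row_(j < k) (- (N j)%:R + sv d j)) * Hz (- (M + L).+1%:R) *
       (gam k)^-1 * gam k.+1 ^+ (M + L).+1)) <= c * maxabs d.
Proof.
move=> a L M Hz ha.
have [c2 [e2 [c20 e20 H]]] := Ffun_asymp R G Cc T Gp Cp T1 k tau'_tw tau'_k tau'_k1 N.
exists c2, e2; split=> //; split=> // d hd h; apply: le_trans (H d hd h).
have Gk : G k = gam k by rewrite /gam' ltnS leqnSn.
have Gk1 : G k.+1 = gam k.+1 by rewrite /gam' leqnn.
(* The common factor [T 0] has modulus at most 1 and preserves the bound. *)
rewrite -[leRHS]mul1r; apply: le_trans (_ : cmod (T 0) * _ <= _); last first.
  by apply: ler_wpM2r; [apply: cmod_ge0|apply: T1].
rewrite -cmodM le_eqVlt; apply/orP; left; apply/eqP; congr cmod.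
have Hb l : Hz (- l%:R) = bern G Cc k l by rewrite (bern_hurwitz l ha).
rewrite Fv_row Z0v_row /singpart Hb Gk Gk1.
rewrite (Z1v_mNstar 1 (- L%:R - 1)); last by rewrite /L; ring.
rewrite mulrBr !mulrDr mulr_sumr; congr (_ - (_ + _ + _)).
- ring.
- apply: eq_bigr => l _; rewrite (Z1v_mNstar (- l%:Z) (- L%:R + l%:R)); last by rewrite /L rmorphN /=; ring.
  by rewrite Hb; ring.
- by rewrite -/L -/M; ring.
Qed.

End MainFunctions.

End Final.

(* 0-based indices: gamma_j = gam (j-1), b_j = b (j-1), mu_j = mu (j-1),
   N_j = N (j-1); so gamma_n = gam n.-1, gamma_{n-1} = gam n.-2, etc. *)
Theorem theorem3p2 (R : realType) (n : nat) (gam b mu : nat -> C R) :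
  (2 <= n)%N ->
  (forall j, (j < n)%N -> 0 < complex.Re (gam j)) ->
  (forall j, (j < n)%N -> - complex.Re (gam 0%N) < complex.Re (b j)) ->
  ~ nonpos_real (b n.-1 - b n.-2) ->
  ~ nonpos_real ((b n.-1 - b n.-2) / gam n.-1) ->
  (forall j, (j < n.-2)%N -> cmod (mu j) = 1 /\ mu j != 1) ->
  exists F : 'rV[C R]_n -> C R,
    [/\ zeta_cont n.-2 gam b mu (~` sing_set n) F,
        meromorphic_off F (sing_set n) &
    (forall N : nat -> nat,
    let a := (b n.-1 - b n.-2) / gam n.-1 in
    let Nn := N n.-1 in
    let Nn1 := N n.-2 in
    exists (D1 : set 'rV[C R]_(n.-1)) (Z1 : 'rV[C R]_(n.-1) -> C R)
           (D0 : set 'rV[C R]_(n.-2)) (Z0 : 'rV[C R]_(n.-2) -> C R)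
           (Hz : C R -> C R) (eps : C R -> C R),
      [/\ zeta_cont n.-2 gam b mu D1 Z1,
          D1 (mNstar n N 1) /\ (forall l, (l <= Nn)%N -> D1 (mNstar n N (- l%:Z))),
          zeta_cont n.-2 gam b mu D0 Z0 /\ D0 (\row_(j < n.-2) - (N j)%:R),
          hurwitz_cont a Hz /\
          (exists ce ee : R, 0 < ce /\ 0 < ee /\
             forall d : C R, cmod d < ee -> cmod (eps d - d) <= ce * cmod d ^+ 2) &
          (exists c e : R, 0 < c /\ 0 < e /\
            forall d : 'rV[C R]_n, maxabs d < e ->
              sv d n.-2 + sv d n.-1 != 0 ->
              cmod (F (\row_(j < n) (- (N j)%:R + d ord0 j))
                - ( - (Nn.+1%:R)^-1 * Z1 (mNstar n N 1) * (gam n.-1)^-1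
                    + \sum_(l < Nn.+1)
                        'C(Nn, l)%:R * Z1 (mNstar n N (- l%:Z)) * Hz (- l%:R)
                          * gam n.-1 ^+ l
                    + (-1) ^+ Nn1.+1 * (Nn`!)%:R * (Nn1`!)%:R
                        / ((Nn1 + Nn).+1`!)%:R
                      * (eps (sv d n.-1) / (sv d n.-2 + sv d n.-1))
                      * Z0 (\row_(j < n.-2) (- (N j)%:R + sv d j))
                      * Hz (- ((Nn1 + Nn).+1)%:R)
                      * (gam n.-2)^-1 * gam n.-1 ^+ (Nn1 + Nn).+1))
              <= c * maxabs d)]) ].
Proof.
case: n => [//|[//|k]] _ /= gam_pos b_pos _ ha hmu.
have mu1 j jk := (hmu j jk).1; have mu_tw j jk := (hmu j jk).2.
exists (Fv R k gam b mu); split; [exact: Fv_cont|exact: Fv_meromorphic|move=> N /=].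
exists (D1 R k), (Z1v R k gam b mu), setT, (Z0v R k gam b mu).
exists (hurwitz R ((b k.+1 - b k) / gam k.+1)), (epsf (N k.+1) (N k)); split.
- exact: Z1v_cont.
- split; first by apply: (D1_mNstar _ _ _ _ (N k + N k.+1).+1); rewrite -PoszD addn1.
  (* l <= N_n keeps N_(n-1) + N_n - l a natural number. *)
  move=> l lN; apply: (D1_mNstar _ _ _ _ (N k + N k.+1 - l)); rewrite subzn //.
  exact: leq_trans lN (leq_addl _ _).
- by split=> //; apply: Z0v_cont.
- split; first exact: hurwitz_contP.
  by have [ce [ee [h1 h2 h3]]] := epsf_asymp R (N k.+1) (N k); exists ce, ee.
- exact: Fv_asymp.
Qed.
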